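(* Let the sets $\Omega_1,\Omega_2,\mathcal H$ satisfy $(\mathbf H_\Omega)$ and let (C1)--(C4) hold (see context). Let $x_0\in\mathcal H$, $0<t_0-h<t_0<T$, and let $r>0$ be such that there exists a $W^{2,\infty}$-diffeomorphism $\Psi$ of $B(x_0,r)$ onto $\tilde\Omega:=\Psi(B(x_0,r))\subset\mathbb R^N$ with $\Psi(\mathcal H\cap B(x_0,r))=\{x_N=0\}\cap\tilde\Omega$. Set $Q:=B(x_0,r)\times(t_0-h,t_0)$ and $\partial_pQ:=\big(B(x_0,r)\times\{t_0-h\}\big)\cup\big(\partial B(x_0,r)\times[t_0-h,t_0)\big)$. If $u$ and $v$ are respectively a bounded usc subsolution and a bounded lsc supersolution of $w_t+\mathbb H^-(x,t,Dw)=0$ in $Q$, then $$\|(u-v)_+\|_{L^\infty(Q)}\le\|(u-v)_+\|_{L^\infty(\partial_pQ)}.$$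
   Context: Geometry $(\mathbf H_\Omega)$: $\mathbb R^N=\Omega_1\cup\Omega_2\cup\mathcal H$, where $\Omega_1,\Omega_2$ are disjoint open sets and $\mathcal H=\partial\Omega_1=\partial\Omega_2$ is a $W^{2,\infty}$-hypersurface (the signed distance to $\mathcal H$ is $W^{2,\infty}$ in a neighbourhood of $\mathcal H$). For $z\in\mathcal H$, $\mathbf n_i(z)$ is the unit normal to $\partial\Omega_i$ at $z$ pointing outwards $\Omega_i$. $D_{\mathcal H}$ is the tangential gradient on $\mathcal H$, $T_z\mathcal H$ the tangent space. $B(x_0,r)$ is the open ball. A $W^{2,\infty}$-diffeomorphism is one which is $W^{2,\infty}$ together with its inverse. Control data: $T>0$; for $i=1,2$, $b_i:\overline{\Omega_i}\times[0,T]\times A_i\to\mathbb R^N$, $l_i:\overline{\Omega_i}\times[0,T]\times A_i\to\mathbb R$. (C1) $A_i$ is a compact metric space, $b_i$ is continuous, $|b_i|\le M_b$ and $|b_i(z,s,\alpha_i)-b_i(z',s',\alpha_i)|\le L_b(|z-z'|+|s-s'|)$. (C2) $l_i$ is uniformly continuous, $|l_i|\le M_l$, and $|l_i(z,s,\alpha_i)-l_i(z',s',\alpha_i)|\le m_l(|z-z'|+|s-s'|)$ for a modulus of continuity $m_l$. (C3) For all $z\in\overline{\Omega_i}$, $s\in[0,T]$, the set $\{(b_i(z,s,\alpha_i),l_i(z,s,\alpha_i)):\alpha_i\in A_i\}$ is closed and convex. (C4) There is $\delta>0$ such that for $i=1,2$, $z\in\mathcal H$, $s\in[0,T]$: $\{b_i(z,s,\alpha_i)\cdot\mathbf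 n_i(z):\alpha_i\in A_i\}\supset[-\delta,\delta]$. Hamiltonians: $H_i(x,t,p)=\sup_{\alpha_i\in A_i}\{-b_i(x,t,\alpha_i)\cdot p-l_i(x,t,\alpha_i)\}$ for $x\in\overline{\Omega_i}$. With $A:=A_1\times A_2\times[0,1]$ and $a=(\alpha_1,\alpha_2,\mu)$, for $z\in\mathcal H$: $b_{\mathcal H}(z,s,a)=\mu b_1(z,s,\alpha_1)+(1-\mu)b_2(z,s,\alpha_2)$, $l_{\mathcal H}(z,s,a)=\mu l_1(z,s,\alpha_1)+(1-\mu)l_2(z,s,\alpha_2)$, $A_0(z,s)=\{a\in A: b_{\mathcal H}(z,s,a)\cdot\mathbf n_1(z)=0\}$, and for $p\in T_z\mathcal H$, $H_T(z,s,p)=\sup_{a\in A_0(z,s)}\{-b_{\mathcal H}(z,s,a)\cdot p-l_{\mathcal H}(z,s,a)\}$. Sub/supersolutions of $w_t+\mathbb H^-(x,t,Dw)=0$ in $Q$: $u$ and $v$ are bounded functions on $\overline Q$, usc and lsc respectively. $u$ is a subsolution if, in the viscosity sense (local maxima of $u-\phi$ in $Q$, $\phi\in C^1$), $u_t+H_i(x,t,Du)\le0$ in $Q\cap(\Omega_i\times(0,T))$, $i=1,2$, $u_t+\min\{H_1,H_2\}(x,t,Du)\le0$ on $Q\cap(\mathcal H\times(0,T))$, and in addition $u_t+H_T(x,t,D_{\mathcal H}u)\le0$ on $Q\cap(\mathcal H\times(0,T))$, meaning that for every $C^1$ function $\phi$ on $\mathcal H\times[0,T]$ and every local maximum point $(x,t)$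 of $u|_{Q\cap(\mathcal H\times(0,T))}-\phi$ one has $\phi_t(x,t)+H_T(x,t,D_{\mathcal H}\phi(x,t))\le0$. $v$ is a supersolution if $v_t+H_i(x,t,Dv)\ge0$ in $Q\cap(\Omega_i\times(0,T))$, $i=1,2$, and $v_t+\max\{H_1,H_2\}(x,t,Dv)\ge0$ on $Q\cap(\mathcal H\times(0,T))$ (local minima in $Q$); no tangential condition is required of $v$. Here $\|f\|_{L^\infty(E)}:=\sup_E|f|$ (pointwise supremum), $f_+=\max(f,0)$. *)

(* Defs.v *)
(* R is any realType and R^N is 'rV[R]_n.+1, so N = n.+1 >= 1 and x_N is the
   coordinate ord_max; points of R^N x R are pairs (x, t). *)
From HB Require Import structures.
From mathcomp Require Import all_boot all_order all_algebra.
From mathcomp Require Import all_classical all_reals all_analysis.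

Set Implicit Arguments.
Unset Strict Implicit.
Unset Printing Implicit Defensive.
Import Order.TTheory GRing.Theory Num.Theory.
Import numFieldNormedType.Exports.
Local Open Scope classical_set_scope.
Local Open Scope ring_scope.

(* The library norm `|x| on 'rV[R]_n.+1 is the sup norm: it gives the right
   topology and differentiability, but |x| and B(x,r) are Euclidean here. *)
Section euclidean.
Context {R : realType} {n : nat}.
Implicit Types (x y : 'rV[R]_n.+1) (A : set 'rV[R]_n.+1).

Definition dotp x y : R := \sum_i x 0 i * y 0 i.

Definition enorm x : R := Num.sqrt (dotp x x).

Definition eball x (r : R) : set 'rV[R]_n.+1 := [set y | enorm (y - x) < r].

Definition edist_set A x : R := inf [set enorm (x - y) | y in A].

Definition bdry A : set 'rV[R]_n.+1 := closure A `\` A°.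

End euclidean.

Section regularity.
Context {R : realType} {V W : normedModType R}.
Implicit Types (U S : set V) (f : V -> W).

Definition C1_on U f : Prop := forall p, U p ->
  differentiable f p /\ forall v, {for p, continuous ('D_v f)}.

(* For S = M x [0,T] with M a hypersurface, which is not open: near each of its
   points f must be the restriction to S of a C^1 function on an open set. *)
Definition C1_on_sub S f : Prop := forall p, S p ->
  exists U g, [/\ open U, U p, C1_on U g & forall q, U q -> S q -> f q = g q].

(* Sobolev spaces with exponent oo on an open set U, through their continuous
   representatives. The Lipschitz constant is uniform, but the Lipschitz bound
   is local, because U need not be convex. *)
Definition W1oo U f : Prop :=
  [bounded f x | x in U] /\
  exists k : R, forall x, U x -> exists2 B, nbhs x B & k.-lipschitz_B f.

Definition W2oo U f : Prop :=
  [/\ forall x, U x -> differentiable f x,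
      W1oo U f
    & forall v, W1oo U ('D_v f)].

End regularity.

Definition W2oo_diffeo {R : realType} {V W : normedModType R}
    (U : set V) (Psi : V -> W) : Prop :=
  [/\ open (Psi @` U),
      W2oo U Psi
    & exists Phi : W -> V,
        (forall x, U x -> Phi (Psi x) = x) /\ W2oo (Psi @` U) Phi].

Section geometry.
Context {R : realType} {n : nat}.
Local Notation E := 'rV[R]_n.+1.
Implicit Types (Om H : set E) (z p tau : E).

Definition signed_dist Om H z : R :=
  if z \in Om then - edist_set H z else edist_set H z.

Record geometry (Om1 Om2 H : set E) : Prop := {
  geo_open1 : open Om1 ;
  geo_open2 : open Om2 ;
  geo_disj : Om1 `&` Om2 = set0 ;
  geo_cover : Om1 `|` Om2 `|` H = setT ;
  geo_bdry1 : H = bdry Om1 ;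
  geo_bdry2 : H = bdry Om2 ;
  geo_W2oo : exists2 U : set E, open U /\ H `<=` U & W2oo U (signed_dist Om1 H)
}.

Definition tangent_curve H z (gamma : R -> E) tau : Prop :=
  [/\ gamma 0 = z, is_derive (0 : R) 1 gamma tau
    & \forall s \near (0 : R), H (gamma s)].

Definition tangent_space H z : set E :=
  [set tau | exists gamma, tangent_curve H z gamma tau].

Definition outward_unit_normal H Om z (nu : E) : Prop :=
  [/\ enorm nu = 1,
      forall tau, tangent_space H z tau -> dotp nu tau = 0
    & \forall s \near 0^'+, Om (z - s *: nu) /\ ~ closure Om (z + s *: nu)].

Definition grad (f : E -> R) z : E := \row_i 'D_(delta_mx 0 i) f z.

(* p = D_H f(z); only the values of f on H matter. *)
Definition tangential_gradient H (f : E -> R) z p : Prop :=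
  tangent_space H z p /\
  forall gamma tau, tangent_curve H z gamma tau ->
    is_derive (0 : R) 1 (f \o gamma) (dotp p tau).

End geometry.

Section control.
Context {R : realType} {n : nat}.
Local Notation E := 'rV[R]_n.+1.

(* b and l are total functions of which only the values on
   closure Om x [0,T] x A are meaningful. *)
Record control_C1 (A : metricType R) (Om : set E) (T : R)
    (b : E -> R -> A -> E) (Mb Lb : R) : Prop := {
  C1_compact : compact [set: A] ;
  C1_continuous :
    {within closure Om `*` `[0, T] `*` [set: A],
      continuous (fun q : E * R * A => b q.1.1 q.1.2 q.2)} ;
  C1_bounded : forall z s a, closure Om z -> s \in `[0, T] ->
    enorm (b z s a) <= Mb ;
  C1_lipschitz : forall z z' s s' a, closure Om z -> closure Om z' ->
    s \in `[0, T] -> s' \in `[0, T] ->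
    enorm (b z s a - b z' s' a) <= Lb * (enorm (z - z') + `|s - s'|)
}.

Definition modulus (m : R -> R) : Prop :=
  [/\ m 0 = 0, {in `[0, +oo[ &, {homo m : x y / x <= y}}
    & m x @[x --> 0^'+] --> 0].

Record control_C2 (A : metricType R) (Om : set E) (T : R)
    (l : E -> R -> A -> R) (Ml : R) (ml : R -> R) : Prop := {
  C2_unif_continuous : forall e : R, 0 < e -> exists2 d : R, 0 < d &
    forall z z' s s' (a a' : A), closure Om z -> closure Om z' ->
      s \in `[0, T] -> s' \in `[0, T] ->
      enorm (z - z') < d -> `|s - s'| < d -> mdist a a' < d ->
      `|l z s a - l z' s' a'| < e ;
  C2_bounded : forall z s a, closure Om z -> s \in `[0, T] ->
    `|l z s a| <= Ml ;
  C2_modulus : modulus ml ;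
  C2_modulus_bound : forall z z' s s' a, closure Om z -> closure Om z' ->
    s \in `[0, T] -> s' \in `[0, T] ->
    `|l z s a - l z' s' a| <= ml (enorm (z - z') + `|s - s'|)
}.

Definition BL_set (A : Type) (b : E -> R -> A -> E) (l : E -> R -> A -> R)
    (z : E) (s : R) : set (E * R)%type :=
  [set (b z s a, l z s a) | a in [set: A]].

Definition control_C3 (A : Type) (Om : set E) (T : R)
    (b : E -> R -> A -> E) (l : E -> R -> A -> R) : Prop :=
  forall z s, closure Om z -> s \in `[0, T] ->
    closed (BL_set b l z s) /\ convex_set (BL_set b l z s).

Definition control_C4 (A : Type) (H : set E) (T : R)
    (b : E -> R -> A -> E) (nu : E -> E) (delta : R) : Prop :=
  forall z s, H z -> s \in `[0, T] ->
    `[- delta, delta] `<=` [set dotp (b z s a) (nu z) | a in [set: A]].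

Definition hamiltonian (A : Type) (b : E -> R -> A -> E) (l : E -> R -> A -> R)
    (x : E) (t : R) (p : E) : R :=
  sup [set - dotp (b x t a) p - l x t a | a in [set: A]].

Section interface.
Variables (A1 A2 : Type).
Variables (b1 : E -> R -> A1 -> E) (b2 : E -> R -> A2 -> E).
Variables (l1 : E -> R -> A1 -> R) (l2 : E -> R -> A2 -> R).

(* a = (alpha1, alpha2, mu); the constraint mu \in [0,1] is put in A0_set. *)
Definition bH (z : E) (s : R) (a : A1 * A2 * R) : E :=
  a.2 *: b1 z s a.1.1 + (1 - a.2) *: b2 z s a.1.2.

Definition lH (z : E) (s : R) (a : A1 * A2 * R) : R :=
  a.2 * l1 z s a.1.1 + (1 - a.2) * l2 z s a.1.2.

Definition A0_set (n1 : E -> E) (z : E) (s : R) : set (A1 * A2 * R) :=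
  [set a | a.2 \in `[0, 1] /\ dotp (bH z s a) (n1 z) = 0].

Definition tangential_hamiltonian (n1 : E -> E) (z : E) (s : R) (p : E) : R :=
  sup [set - dotp (bH z s a) p - lH z s a | a in A0_set n1 z s].

End interface.
End control.

Section viscosity.
Context {R : realType} {n : nat}.
Local Notation E := 'rV[R]_n.+1.
Implicit Types (Q D S : set (E * R)) (u v f phi : E * R -> R).
Implicit Types (F : E -> R -> E -> R).

Definition usc_on S f : Prop := forall p, S p -> forall a, f p < a ->
  \forall q \near within S (nbhs p), f q < a.

Definition lsc_on S f : Prop := forall p, S p -> forall a, a < f p ->
  \forall q \near within S (nbhs p), a < f q.

Definition local_max_in S f (p : E * R) : Prop :=
  S p /\ \forall q \near within S (nbhs p), f q <= f p.

Definition local_min_in S f (p : E * R) : Prop :=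
  S p /\ \forall q \near within S (nbhs p), f p <= f q.

Definition Dt phi (p : E * R) : R := derive1 (fun s : R => phi (p.1, s)) p.2.

Definition Dx phi (p : E * R) : E := grad (fun y => phi (y, p.2)) p.1.

(* u_t + F(x,t,Du) <= 0 on D, with local maxima taken in Q *)
Definition visc_sub Q D F u : Prop := forall phi, C1_on Q phi ->
  forall p, D p -> local_max_in Q (fun q => u q - phi q) p ->
    Dt phi p + F p.1 p.2 (Dx phi p) <= 0.

Definition visc_super Q D F v : Prop := forall phi, C1_on Q phi ->
  forall p, D p -> local_min_in Q (fun q => v q - phi q) p ->
    0 <= Dt phi p + F p.1 p.2 (Dx phi p).

Definition visc_sub_tangential (H : set E) (T : R) Q F u : Prop :=
  forall phi, C1_on_sub (H `*` `[0, T]) phi ->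
  forall p, local_max_in (Q `&` (H `*` `]0, T[)) (fun q => u q - phi q) p ->
  forall g, tangential_gradient H (fun y => phi (y, p.2)) p.1 g ->
    Dt phi p + F p.1 p.2 g <= 0.

Record subsolution_Hminus (Om1 Om2 H : set E) (T : R)
    (H1 H2 HT : E -> R -> E -> R) Q u : Prop := {
  sub_bounded : [bounded u p | p in closure Q] ;
  sub_usc : usc_on (closure Q) u ;
  sub_Om1 : visc_sub Q (Om1 `*` `]0, T[) H1 u ;
  sub_Om2 : visc_sub Q (Om2 `*` `]0, T[) H2 u ;
  sub_H : visc_sub Q (H `*` `]0, T[)
    (fun x t p => Num.min (H1 x t p) (H2 x t p)) u ;
  sub_HT : visc_sub_tangential H T Q HT u
}.

Record supersolution_Hminus (Om1 Om2 H : set E) (T : R)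
    (H1 H2 : E -> R -> E -> R) Q v : Prop := {
  super_bounded : [bounded v p | p in closure Q] ;
  super_lsc : lsc_on (closure Q) v ;
  super_Om1 : visc_super Q (Om1 `*` `]0, T[) H1 v ;
  super_Om2 : visc_super Q (Om2 `*` `]0, T[) H2 v ;
  super_H : visc_super Q (H `*` `]0, T[)
    (fun x t p => Num.max (H1 x t p) (H2 x t p)) v
}.

Definition Qcyl (x0 : E) (r t0 h : R) : set (E * R) :=
  eball x0 r `*` `]t0 - h, t0[.

Definition parabolic_bdry (x0 : E) (r t0 h : R) : set (E * R) :=
  (eball x0 r `*` [set t0 - h]) `|` (bdry (eball x0 r) `*` `[t0 - h, t0[).

(* pointwise supremum *)
Definition sup_norm S f : \bar R := ereal_sup [set `|f p|%:E | p in S].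

End viscosity.

(* Main.v *)
(* If the inequality fails, then u - tau - v, with a suitable tau(t) such that
   tau' >= eta > 0, has a local maximum at some point of Q, and u - tau is a
   strict subsolution. Away from H doubling the variables is a contradiction.
   Near H let d be the signed distance. First maximize
   u(X1) - tau(X1) - v(X2) - k |X1 - X2|^2 - |X1 - X|^2 under the constraint
   d(X1) = d(X2). At a maximum with d = 0 the tangential inequality for u,
   convexity and controllability give one normal slope q for which both H_1 and
   H_2 inequalities hold for u. Then drop the constraint, subtract
   q (d(X1) - d(X2)) + c g(d(X1), d(X2)) and let c go to infinity, where g
   penalizes d(X1) <> d(X2) so that X1 and X2 are never on opposite sides of H:
   by coercivity in the normal direction the slope c is excluded. On the same
   side the usual estimate applies, at d(X1) = d(X2) = 0 the slope q is
   available for u, and if d(X1) = 0 but d(X2) <> 0, then a one-sided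
   subsolution inequality, q and quasiconvexity give the right slope for u. *)
Require Import Defs.
From HB Require Import structures.
From mathcomp Require Import all_boot all_order all_algebra.
From mathcomp Require Import all_classical all_reals all_analysis.
From mathcomp Require Import ring lra.

Set Implicit Arguments.
Unset Strict Implicit.
Unset Printing Implicit Defensive.
Import Order.TTheory GRing.Theory Num.Theory.
Import numFieldNormedType.Exports.
Local Open Scope classical_set_scope.
Local Open Scope ring_scope.

(** * Euclidean scalar product and norm *)

Section euclid.
Context {R : realType} {n : nat}.
Implicit Types (x y z : 'rV[R]_n.+1) (a b : R).

(** The obstacle: at a doubled maximum on the interface [u] satisfies an inequality for one of the
    two Hamiltonians and [v] for one of them, not necessarily the same. The tangential inequality
    repairs this, but it accepts only maxima of [u] restricted to H. This is why the constraint
    [d X1 = d X2] precedes every normal penalty, and why [q] is known before [c] is sent to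
    infinity. Parameters are fixed in the order eta, k, q, c. Squared distances to the constrained
    maximum force the later maxima back to it, and half of the strictness margin pays for using the
    slope [q] at nearby points. Normal slopes are not controlled by k |X1 - X2|. Coercivity, which
    comes from (C4), bounds them by a multiple of |p| + |a| + 1. The product of this with |X1 - X2|
    is small, and so is the effect of the variation of the Hamiltonians and of the Lipschitz field
    [nd] between X1 and X2. *)

Lemma dotpC x y : dotp x y = dotp y x.
Proof. by apply: eq_bigr => i _; rewrite mulrC. Qed.

Lemma dotpDl x y z : dotp (x + y) z = dotp x z + dotp y z.
Proof. by rewrite -big_split; apply: eq_bigr => i _; rewrite mxE mulrDl. Qed.

Lemma dotpZl a x y : dotp (a *: x) y = a * dotp x y.
Proof. by rewrite mulr_sumr; apply: eq_bigr => i _; rewrite mxE mulrA. Qed.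

Lemma dotpDr x y z : dotp z (x + y) = dotp z x + dotp z y.
Proof. by rewrite dotpC dotpDl !(dotpC z). Qed.

Lemma dotpZr a x y : dotp x (a *: y) = a * dotp x y.
Proof. by rewrite dotpC dotpZl dotpC. Qed.

Lemma dotpNl x y : dotp (- x) y = - dotp x y.
Proof. by rewrite -scaleN1r dotpZl mulN1r. Qed.

Lemma dotpNr x y : dotp x (- y) = - dotp x y.
Proof. by rewrite dotpC dotpNl dotpC. Qed.

Lemma dotpBl x y z : dotp (x - y) z = dotp x z - dotp y z.
Proof. by rewrite dotpDl dotpNl. Qed.

Lemma dotpBr x y z : dotp z (x - y) = dotp z x - dotp z y.
Proof. by rewrite dotpDr dotpNr. Qed.

Lemma dotp0l x : dotp 0 x = 0.
Proof. by rewrite -(scale0r 0) dotpZl mul0r. Qed.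

Lemma dotp0r x : dotp x 0 = 0.
Proof. by rewrite dotpC dotp0l. Qed.

Lemma dotp_delta x i : dotp x (delta_mx 0 i) = x 0 i.
Proof.
rewrite /dotp (bigD1 i)//= big1 ?addr0; first by rewrite mxE !eqxx mulr1.
by move=> j ji; rewrite mxE (negbTE ji) andbF mulr0.
Qed.

Lemma dotp_ge0 x : 0 <= dotp x x.
Proof. by apply: sumr_ge0 => i _; rewrite -expr2 sqr_ge0. Qed.

Lemma coord_sqr_le x i : x 0 i ^+ 2 <= dotp x x.
Proof.
rewrite /dotp (bigD1 i)//= -expr2 lerDl; apply: sumr_ge0 => j _.
by rewrite -expr2 sqr_ge0.
Qed.

Lemma dotp_eq0 x : dotp x x = 0 -> x = 0.
Proof.
move=> x0; apply/rowP => i; rewrite mxE; apply/eqP; rewrite -sqrf_eq0.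
by rewrite eq_le sqr_ge0 andbT -x0 coord_sqr_le.
Qed.

Lemma enorm_ge0 x : 0 <= enorm x. Proof. exact: sqrtr_ge0. Qed.

Lemma sqr_enorm x : enorm x ^+ 2 = dotp x x.
Proof. by rewrite sqr_sqrtr// dotp_ge0. Qed.

Lemma enorm0 : enorm (0 : 'rV[R]_n.+1) = 0.
Proof. by rewrite /enorm dotp0l sqrtr0. Qed.

Lemma enorm_eq0 x : enorm x = 0 -> x = 0.
Proof. by move=> x0; apply: dotp_eq0; rewrite -sqr_enorm x0 expr0n. Qed.

Lemma dotp_le x y : dotp x y <= enorm x * enorm y.
Proof.
have [x0|x0] := eqVneq (enorm x) 0.
  by rewrite (enorm_eq0 x0) dotp0l enorm0 mul0r.
have [y0|y0] := eqVneq (enorm y) 0.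
  by rewrite (enorm_eq0 y0) dotp0r enorm0 mulr0.
have xp : 0 < enorm x by rewrite lt_def x0 enorm_ge0.
have yp : 0 < enorm y by rewrite lt_def y0 enorm_ge0.
(* Cauchy-Schwarz: the square of [|y| x - |x| y] equals [2 |x| |y| (|x| |y| - x.y)]. *)
have := dotp_ge0 (enorm y *: x - enorm x *: y).
rewrite dotpBl !dotpBr !dotpZl !dotpZr -!sqr_enorm (dotpC y x) => H.
have : 0 <= (2 * (enorm x * enorm y)) * (enorm x * enorm y - dotp x y) by nra.
by rewrite pmulr_rge0 ?subr_ge0// !mulr_gt0.
Qed.

Lemma dotp_abs x y : `|dotp x y| <= enorm x * enorm y.
Proof.
rewrite ler_norml dotp_le andbT lerNl -dotpNl.
by apply: (le_trans (dotp_le _ _)); rewrite /enorm dotpNl dotpNr opprK.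
Qed.

Lemma enormN x : enorm (- x) = enorm x.
Proof. by rewrite /enorm dotpNl dotpNr opprK. Qed.

Lemma enormB x y : enorm (x - y) = enorm (y - x).
Proof. by rewrite -enormN opprB. Qed.

Lemma enormZ a x : enorm (a *: x) = `|a| * enorm x.
Proof.
by rewrite /enorm dotpZl dotpZr mulrA -expr2 sqrtrM ?sqr_ge0// sqrtr_sqr.
Qed.

Lemma enormD x y : enorm (x + y) <= enorm x + enorm y.
Proof.
rewrite -(@ler_pXn2r _ 2)// ?nnegrE ?addr_ge0 ?enorm_ge0//.
rewrite sqr_enorm dotpDl !dotpDr -!sqr_enorm (dotpC y x).
have := dotp_le x y; nra.
Qed.

Lemma enorm_triang x y z : enorm (x - z) <= enorm (x - y) + enorm (y - z).
Proof. by rewrite (_ : x - z = (x - y) + (y - z)) ?enormD// addrA subrK. Qed.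

Lemma coord_le_enorm x i : `|x 0 i| <= enorm x.
Proof.
rewrite -(@ler_pXn2r _ 2)// ?nnegrE ?enorm_ge0//.
by rewrite sqr_enorm real_normK ?num_real// coord_sqr_le.
Qed.

Lemma norm_le_enorm x : `|x| <= enorm x.
Proof.
rewrite /Num.norm /= mx_normrE; apply: bigmax_le => [|[i j] _]; first exact: enorm_ge0.
by rewrite (ord1 i) coord_le_enorm.
Qed.

Lemma cvg_dotp (T : Type) (F : set_system T) {FF : Filter F} (f g : T -> 'rV[R]_n.+1) x y :
  f t @[t --> F] --> x -> g t @[t --> F] --> y ->
  dotp (f t) (g t) @[t --> F] --> dotp x y.
Proof.
move=> fx gy; rewrite /dotp; apply: cvg_big => [|i _]; first exact: add_continuous.
apply: cvgM.
  by apply: (@cvg_comp _ _ _ f (fun M => M 0 i) _ _ _ fx); exact: coord_continuous.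
by apply: (@cvg_comp _ _ _ g (fun M => M 0 i) _ _ _ gy); exact: coord_continuous.
Qed.

Lemma cvg_enorm (T : Type) (F : set_system T) {FF : Filter F} (f : T -> 'rV[R]_n.+1) x :
  f t @[t --> F] --> x -> enorm (f t) @[t --> F] --> enorm x.
Proof.
move=> fx; rewrite /enorm.
have H := cvg_dotp fx fx.
exact: (cvg_comp _ _ (H FF) (@sqrt_continuous R _)).
Qed.

End euclid.

(** * Functions with an explicit continuous gradient *)

Section calculus.
Context {R : realType}.

Lemma is_diff_lin (V W : normedModType R) (f : V -> W) (x : V) :
  linear f -> continuous f -> is_diff x f f.
Proof.
move=> lf cf; pose fM := GRing.isLinear.Build _ _ _ _ _ lf.
pose fL : {linear _ -> _} := HB.pack f fM.
rewrite (_ : f = fL :> (V -> W))//; apply: DiffDef; first exact: linear_differentiable.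
by rewrite diff_lin.
Qed.

Lemma is_diff_sum (V W : normedModType R) m (f df : 'I_m -> V -> W) (x : V) :
  (forall i, is_diff x (f i) (df i)) ->
  is_diff x (fun y => \sum_i f i y) (fun y => \sum_i df i y).
Proof.
move=> H; rewrite (_ : (fun y => _) = \sum_i f i); last first.
  by apply/funext => y; rewrite fct_sumE.
rewrite (_ : (fun y => _) = \sum_i df i); last first.
  by apply/funext => y; rewrite fct_sumE.
by elim/big_ind2 : _ => // *; [exact: is_diff_cst|exact: is_diffD].
Qed.

Lemma is_diff_ext (V W : normedModType R) (f g df dg : V -> W) (x : V) :
  f =1 g -> df =1 dg -> is_diff x f df -> is_diff x g dg.
Proof. by move=> /funext -> /funext ->. Qed.

Lemma is_diff_continuous (V W : normedModType R) (f df : V -> W) (x : V) :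
  is_diff x f df -> {for x, continuous f}.
Proof. by move=> H; exact: differentiable_continuous. Qed.

Lemma is_derive_is_diff (h : R -> R) (a l : R) : is_derive a 1 h l -> is_diff a h (fun y => l * y).
Proof.
move=> [d1 d2]; apply: DiffDef; first exact/derivable1_diffP.
by rewrite diff1E ?derive1E ?d2; [apply/funext => y /=; rewrite mulrC|exact/derivable1_diffP].
Qed.

Context {n : nat}.
Local Notation E := 'rV[R]_n.+1.
Implicit Types (f g : E * R -> R) (G : E * R -> E) (A : E * R -> R).

(** A test function is carried together with its space gradient [G] and time derivative [A], so that
    the slopes in the viscosity inequalities are known terms. Regularity on the whole space keeps
    sums, products and compositions free of side conditions; local functions are extended by a
    cutoff. *)
Definition C1_gradient f G A :=
  [/\ forall X, is_diff X f (fun V => dotp (G X) V.1 + A X * V.2),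
      continuous G & continuous A].

Lemma C1_gradient_C1_on f G A (S : set (E * R)) : C1_gradient f G A -> C1_on S f.
Proof.
move=> [df cG cA] X _; split=> [|v]; first by have := df X => dfX; exact: ex_diff.
rewrite (_ : 'D_v f = fun X => dotp (G X) v.1 + A X * v.2); last first.
  by apply/funext => Y; have dfY := df Y; rewrite deriveE// diff_val.
apply: cvgD; first by apply: (@cvg_dotp _ _ _ (nbhs X) _ G (fun=> v.1)); [exact: cG|exact: cvg_cst].
by apply: cvgM; [exact: cA|exact: cvg_cst].
Qed.

Lemma C1_gradient_slice f G A X : C1_gradient f G A ->
  is_diff (X.1) (fun y => f (y, X.2)) (dotp (G X)).
Proof.
move=> [df _ _].
have dp : is_diff (X.1) (fun y : E => (y, X.2)) (fun v => (v, 0)).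
  exact: (is_diff_pair (is_diff_id X.1) (is_diff_cst X.2 X.1)).
have dfX : is_diff ((fun y : E => (y, X.2)) X.1) f (fun V => dotp (G X) V.1 + A X * V.2).
  by rewrite /= -surjective_pairing.
have := is_diff_comp dp dfX; apply: is_diff_ext => // v.
by rewrite /= mulr0 addr0.
Qed.

Lemma C1_gradient_Dx f G A X : C1_gradient f G A -> Dx f X = G X.
Proof.
move=> hf; have H := C1_gradient_slice X hf; apply/rowP => i; rewrite mxE.
by rewrite deriveE// diff_val dotp_delta.
Qed.

Lemma C1_gradient_Dt f G A X : C1_gradient f G A -> Dt f X = A X.
Proof.
move=> [df _ _]; rewrite /Dt derive1E.
have dp : is_diff (X.2) (fun s : R => (X.1, s)) (fun v => (0, v)).
  exact: (is_diff_pair (is_diff_cst X.1 X.2) (is_diff_id X.2)).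
have dfX : is_diff ((fun s : R => (X.1, s)) X.2) f (fun V => dotp (G X) V.1 + A X * V.2).
  by rewrite /= -surjective_pairing.
have H := is_diff_comp dp dfX.
rewrite (_ : (fun y => _) = f \o (fun s => (X.1, s)))//.
by rewrite deriveE// diff_val /= dotp0r add0r mulr1.
Qed.

Lemma C1_gradientD f G A f' G' A' : C1_gradient f G A -> C1_gradient f' G' A' ->
  C1_gradient (fun X => f X + f' X) (fun X => G X + G' X) (fun X => A X + A' X).
Proof.
move=> [df cG cA] [df' cG' cA']; split=> [X|X|X].
- have := is_diffD (df X) (df' X); apply: is_diff_ext => // V /=.
  by rewrite fctE dotpDl; ring.
- by apply: cvgD; [exact: cG|exact: cG'].
- by apply: cvgD; [exact: cA|exact: cA'].
Qed.

Lemma C1_gradientZ k f G A : C1_gradient f G A ->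
  C1_gradient (fun X => k * f X) (fun X => k *: G X) (fun X => k * A X).
Proof.
move=> [df cG cA]; split=> [X|X|X].
- have := is_diffZ k (df X); apply: is_diff_ext => // V.
  by rewrite /= fctE dotpZl /GRing.scale/=; ring.
- by apply: cvgZr; exact: cG.
- by apply: cvgM; [exact: cvg_cst|exact: cA].
Qed.

Lemma C1_gradientN f G A : C1_gradient f G A ->
  C1_gradient (fun X => - f X) (fun X => - G X) (fun X => - A X).
Proof.
move=> /(C1_gradientZ (-1)).
rewrite (_ : (fun X => -1 * f X) = fun X => - f X); last by apply/funext => X; rewrite mulN1r.
rewrite (_ : (fun X => -1 *: G X) = fun X => - G X); last by apply/funext => X; rewrite scaleN1r.
by rewrite (_ : (fun X => -1 * A X) = fun X => - A X)//; apply/funext => X; rewrite mulN1r.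
Qed.

Lemma C1_gradientM f G A f' G' A' : C1_gradient f G A -> C1_gradient f' G' A' ->
  C1_gradient (fun X => f X * f' X) (fun X => f X *: G' X + f' X *: G X)
    (fun X => f X * A' X + f' X * A X).
Proof.
move=> [df cG cA] [df' cG' cA']; split=> [X|X|X].
- have := is_diffM (df X) (df' X); apply: is_diff_ext => // V.
  rewrite -[LHS]/(f X * (dotp (G' X) V.1 + A' X * V.2)
                + f' X * (dotp (G X) V.1 + A X * V.2)).
  by rewrite dotpDl !dotpZl; ring.
- apply: cvgD; apply: cvgZ; first exact: (is_diff_continuous (df X)).
  + exact: cG'.
  + exact: (is_diff_continuous (df' X)).
  + exact: cG.
- apply: cvgD; apply: cvgM; first exact: (is_diff_continuous (df X)).
  + exact: cA'.
  + exact: (is_diff_continuous (df' X)).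
  + exact: cA.
Qed.

Lemma C1_gradient_comp (h h' : R -> R) f G A :
  (forall a : R, is_derive a 1 h (h' a)) -> continuous h' -> C1_gradient f G A ->
  C1_gradient (fun X => h (f X)) (fun X => h' (f X) *: G X) (fun X => h' (f X) * A X).
Proof.
move=> dh ch [df cG cA]; have cf X := is_diff_continuous (df X).
have cc X : {for X, continuous (fun X => h' (f X))}.
  by apply: (@continuous_comp _ _ _ f h') => //; exact: ch.
split=> [X|X|X].
- have := is_diff_comp (df X) (is_derive_is_diff (dh (f X))); apply: is_diff_ext => // V.
  by rewrite /= dotpZl; ring.
- by apply: cvgZ; [exact: cc|exact: cG].
- by apply: cvgM; [exact: cc|exact: cA].
Qed.

Lemma C1_gradient_snd : C1_gradient (fun X => X.2) (fun=> 0) (fun=> 1).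
Proof.
split=> [X|X|X]; [|exact: cvg_cst|exact: cvg_cst].
have : is_diff X (fun X : E * R => X.2) (fun X => X.2).
  by apply: is_diff_lin => [a [x s] [y t]| []]; [|move=> ? ?; exact: cvg_snd].
by apply: is_diff_ext => // V; rewrite dotp0l; ring.
Qed.

Lemma C1_gradient_cst a : C1_gradient (fun=> a) (fun=> 0) (fun=> 0).
Proof.
split=> [X|X|X]; [|exact: cvg_cst|exact: cvg_cst].
by have := is_diff_cst a X; apply: is_diff_ext => // V; rewrite dotp0l mul0r addr0.
Qed.

Lemma C1_gradient_fst (d : E -> R) (nd : E -> E) :
  (forall x, is_diff x d (dotp (nd x))) -> continuous nd ->
  C1_gradient (fun X => d X.1) (fun X => nd X.1) (fun=> 0).
Proof.
move=> dd cn; split=> [X|X|X]; [|by apply: (@continuous_comp _ _ _ fst nd); [exact: cvg_fst|exact: cn]|exact: cvg_cst].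
have fl : is_diff X (fun X : E * R => X.1) (fun X => X.1).
  by apply: is_diff_lin => [a [x s] [y t]| []]; [|move=> ? ?; exact: cvg_fst].
have := is_diff_comp fl (dd X.1); apply: is_diff_ext => // V.
by rewrite /= mul0r addr0.
Qed.

Lemma is_diff_sqdist (y x : E) :
  is_diff x (fun x => dotp (x - y) (x - y)) (dotp (2 *: (x - y))).
Proof.
have H : is_diff x (fun x => \sum_i (x 0 i - y 0 i) ^+ 2)
    (fun v => \sum_i 2 * (x 0 i - y 0 i) * v 0 i).
  apply: is_diff_sum => i.
  have l : is_diff x (fun x : E => x 0 i) (fun x => x 0 i).
    by apply: is_diff_lin => [a u v|]; [rewrite !mxE|exact: coord_continuous].
  have := is_diffX 1 (is_diffB l (is_diff_cst (y 0 i) x)).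
  apply: is_diff_ext => v; rewrite //= !fctE /GRing.scale/= /cst.
  by rewrite (_ : (0 : E -> R) v = 0)// subr0 expr1.
move: H; apply: is_diff_ext => v; rewrite /dotp; apply: eq_bigr => i _.
  by rewrite !mxE expr2.
by rewrite !mxE.
Qed.

Definition sqd (X Y : E * R) : R := dotp (X.1 - Y.1) (X.1 - Y.1) + (X.2 - Y.2) ^+ 2.

Lemma C1_gradient_sqd (Y : E * R) :
  C1_gradient (sqd ^~ Y) (fun X => 2 *: (X.1 - Y.1)) (fun X => 2 * (X.2 - Y.2)).
Proof.
have H1 : C1_gradient (fun X => dotp (X.1 - Y.1) (X.1 - Y.1))
   (fun X => 2 *: (X.1 - Y.1)) (fun=> 0).
  apply: (C1_gradient_fst (fun x => is_diff_sqdist Y.1 x)) => x.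
  exact: (is_diff_continuous (is_diffZ 2 (is_diffB (is_diff_id x) (is_diff_cst Y.1 x)))).
have H2 := C1_gradientD C1_gradient_snd (C1_gradient_cst (- Y.2)).
have H3 := C1_gradientD H1 (C1_gradientM H2 H2); move: H3.
congr C1_gradient; apply/funext => X.
- by rewrite addr0 scaler0 !addr0.
- ring.
Qed.

End calculus.

(** * Semicontinuous functions and penalization *)

Section semicontinuity.
Context {R : realType} {T : topologicalType}.
Implicit Types (K N : set T) (f g : T -> R).

Lemma continuous_near_lt f z a : {for z, continuous f} -> f z < a ->
  \forall y \near z, f y < a.
Proof. by move=> fz fa; exact: (cvgr_lt (f z) fz a fa). Qed.

Lemma continuous_near_gt f z a : {for z, continuous f} -> a < f z ->
  \forall y \near z, a < f y.
Proof. by move=> fz fa; exact: (cvgr_gt (f z) fz a fa). Qed.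

Lemma nbhs_setI (x : T) K N : nbhs x K -> nbhs x N -> nbhs x (K `&` N).
Proof. exact: filterI. Qed.

(** [usc_on] over an arbitrary topological space: it is also applied to functions of a pair of
    points and to the penalty on [R * R]. *)
Definition usc_in K f := forall z, K z -> forall a, f z < a ->
  \forall y \near within K (nbhs z), f y < a.

Lemma usc_inS K K' f : K' `<=` K -> usc_in K f -> usc_in K' f.
Proof.
move=> KK' fK z /[dup] Kz /KK' K'z a fa; have := fK z K'z a fa.
by rewrite !near_withinE; apply: filterS => y H /KK'.
Qed.

Lemma usc_inD K f g : usc_in K f -> usc_in K g -> usc_in K (fun z => f z + g z).
Proof.
move=> fK gK z Kz a ab; pose e := (a - (f z + g z)) / 2.
have e0 : 0 < e by rewrite /e; lra.
have := fK z Kz (f z + e); rewrite ltrDl => /(_ e0) Hf.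
have := gK z Kz (g z + e); rewrite ltrDl => /(_ e0) Hg.
by apply: filterS2 Hf Hg => y; rewrite /e; lra.
Qed.

Lemma usc_inZ K f k : 0 <= k -> usc_in K f -> usc_in K (fun z => k * f z).
Proof.
rewrite le_eqVlt => /predU1P[<- _ z Kz a|k0 fK z Kz a].
  by rewrite mul0r => a0; near=> y; rewrite mul0r.
rewrite mulrC -ltr_pdivlMr// => /(fK z Kz); apply: filterS => y.
by rewrite ltr_pdivlMr// mulrC.
Unshelve. all: by end_near. Qed.

Lemma continuous_usc_in K f : (forall z, K z -> {for z, continuous f}) -> usc_in K f.
Proof.
move=> fc z /fc fz a fa; rewrite near_withinE.
by apply: filterS (continuous_near_lt fz fa) => y.
Qed.

(** Compactness acts as near-covering twice: along [+oo] for boundedness, then along [M^'-], where a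
    supremum [M] that is not attained would leave some [a < M] bounding [f] on [K]. *)
Lemma compact_usc_max K f : compact K -> K !=set0 -> usc_in K f ->
  exists2 z, K z & forall y, K y -> f y <= f z.
Proof.
move=> /compact_near_coveringP Kc [z0 Kz0] fK.
have bd : has_sup [set f z | z in K].
  split; first by exists (f z0), z0.
  have : \forall a \near +oo, K `<=` [set z | K z -> f z < a].
    apply: (Kc R +oo (fun a z => K z -> f z < a)) => z Kz.
    have Hf : f z < f z + 1 by rewrite ltrDl.
    have := fK z Kz _ Hf; rewrite near_withinE => H.
    exists ([set y | K y -> f y < f z + 1], [set a | f z + 1 < a]) => /=.
      by split=> //; exact: nbhs_pinfty_gt (num_real _).
    by move=> [y a] /= [/[swap] ? Hy] Ky; apply: lt_trans (Hy Ky) _.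
  move=> [M [_ HM]]; exists (M + 1) => _ [z Kz <-].
  by apply/ltW/(HM (M + 1)); rewrite ?ltrDl.
pose M := sup [set f z | z in K].
have [[z Kz Mz]|nM] := pselect (exists2 z, K z & M <= f z).
  exists z => // y Ky; apply: le_trans Mz.
  by apply: ub_le_sup; [case: bd|exists y].
have fM z : K z -> f z < M.
  by move=> Kz; rewrite ltNge; apply/negP => Mz; apply: nM; exists z.
have : \forall a \near M^'-, K `<=` [set z | K z -> f z < a].
  apply: (Kc R (M^'-) (fun a z => K z -> f z < a)) => z Kz.
  pose m := (f z + M) / 2.
  have fzm : f z < m by rewrite /m; have := fM z Kz; lra.
  have mM : m < M by rewrite /m; have := fM z Kz; lra.
  have := fK z Kz _ fzm; rewrite near_withinE => H.
  exists ([set y | K y -> f y < m], [set a | m < a]) => /=.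
    by split=> //; exact: nbhs_left_gt.
  by move=> [y a] /= [/[swap] ? Hy] Ky; apply: lt_trans (Hy Ky) _.
move=> Ha; have [a [HaK aM]] : exists a, K `<=` [set z | K z -> f z < a] /\ a < M.
  apply: (@filter_ex _ (M^'-)); apply: filterS2 Ha (nbhs_left_lt M) => a H1 H2.
  by split.
have : M <= a by apply: sup_le_ub; [case: bd|move=> _ [z Kz <-]; apply/ltW/HaK].
by rewrite leNgt aM.
Qed.

(** Each competitor is beaten by [z0] locally and eventually in [i]; by compactness one eventual set
    of indices serves all of [K] outside [N]. *)
Lemma argmax_near (I : Type) (F : set_system I) (Phi : I -> T -> R) K N z0 :
  Filter F -> compact K -> nbhs z0 N ->
  (forall z, K z -> z <> z0 ->
     \forall y \near z & i \near F, K y -> Phi i y < Phi i z0) ->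
  \forall i \near F, forall z, K z -> Phi i z0 <= Phi i z -> N z.
Proof.
move=> FF /compact_near_coveringP Kc Nz0 H.
have : \forall i \near F, K `<=` [set z | K z -> Phi i z0 <= Phi i z -> N z].
  apply: (Kc I F (fun i z => K z -> Phi i z0 <= Phi i z -> N z)) => z Kz.
  have [->|/eqP zz0] := eqVneq z z0.
    exists (N, setT) => /=; first by split=> //; exact: filterT.
    by move=> [y i] /= [].
  by apply: filterS (H z Kz zz0) => -[y i] /= Hy Ky; rewrite leNgt Hy.
by apply: filterS => i Hi z Kz; apply: (Hi z Kz Kz).
Qed.

(** Where [g > 0] a large [k] defeats [f], and on [g = 0] the point [z0] is the strict maximum. The
    conclusion covers every point at least as high as [z0], hence all maximizers. *)
Lemma penalization K f g z0 N (e : R) : compact K -> usc_in K f ->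
  usc_in K (fun z => - g z) -> (forall z, K z -> 0 <= g z) -> K z0 -> g z0 = 0 ->
  (forall z, K z -> g z = 0 -> z <> z0 -> f z < f z0) -> nbhs z0 N -> 0 < e ->
  \forall k \near +oo, forall z, K z -> f z0 <= f z - k * g z -> N z /\ k * g z < e.
Proof.
move=> Kc fK gK g0 Kz0 gz0 fz0 Nz0 e0.
(* On the second set, [f z0 <= f z - k * g z] gives [k * g z <= f z - f z0 < e]. *)
have Nf : nbhs z0 (N `&` [set z | K z -> f z < f z0 + e]).
  apply: filterI => //; have := fK z0 Kz0 (f z0 + e); rewrite ltrDl => /(_ e0).
  by rewrite near_withinE.
have := @argmax_near R +oo (fun k z => f z - k * g z) K _ z0 _ Kc Nf.
have Hn : forall z, K z -> z <> z0 -> \forall y \near z & k \near +oo,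
    K y -> f y - k * g y < f z0 - k * g z0.
  move=> z Kz zz0; rewrite gz0.
  have [gz|gz] := eqVneq (g z) 0.
    have := fK z Kz _ (fz0 z Kz gz zz0); rewrite near_withinE => H.
    exists ([set y | K y -> f y < f z0], [set k | 0 < k]) => /=.
      by split=> //; exact: nbhs_pinfty_gt (num_real _).
    move=> [y k] /= [Hy k0] Ky; rewrite mulr0 subr0.
    by have := mulr_ge0 (ltW k0) (g0 y Ky); have := Hy Ky; lra.
  have gp : 0 < g z by rewrite lt_def gz g0.
  have := gK z Kz (- (g z / 2)); rewrite ltrN2 ltr_pdivrMr// => /(_ ltac:(lra)).
  have := fK z Kz (f z + 1); rewrite ltrDl => /(_ ltr01).
  rewrite !near_withinE => H1 H2.
  (* Near [z], [f < f z + 1] and [g > g z / 2]; beyond this threshold [f - k * g] is below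
     [f z0]. *)
  pose k0 := Num.max 0 ((f z + 1 - f z0) / (g z / 2)).
  exists ([set y | K y -> f y < f z + 1 /\ - g y < - (g z / 2)], [set k | k0 < k]) => /=.
    split; last exact: nbhs_pinfty_gt (num_real _).
    by apply: filterS2 H1 H2 => y a b Ky; split; [exact: a|exact: b].
  move=> [y k] /= [Hy]; rewrite gt_max => /andP[k0' kk] Ky.
  have [Hy1 Hy2] := Hy Ky; rewrite mulr0 subr0.
  move: kk; rewrite ltr_pdivrMr; last lra.
  nra.
move=> /(_ _ Hn); move: (nbhs_pinfty_gt (num_real (0 : R))) => k0.
apply: filterS2 k0 => k /= k0 H z Kz fz.
have [|Nz Hz] := H z Kz; first by rewrite gz0 mulr0 subr0.
by split=> //; have := Hz Kz; lra.
Qed.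

End semicontinuity.

Lemma continuous_fst (U V : topologicalType) : continuous (fun z : U * V => z.1).
Proof. by move=> z; exact: cvg_fst. Qed.

Lemma continuous_snd (U V : topologicalType) : continuous (fun z : U * V => z.2).
Proof. by move=> z; exact: cvg_snd. Qed.

Lemma continuous_fst_comp (T U V : topologicalType) (h : T -> U * V) t :
  {for t, continuous h} -> {for t, continuous (fun t => (h t).1)}.
Proof.
by move=> ch; apply: (@continuous_comp _ _ _ h (fun z => z.1) t ch); exact: continuous_fst.
Qed.

Lemma continuous_snd_comp (T U V : topologicalType) (h : T -> U * V) t :
  {for t, continuous h} -> {for t, continuous (fun t => (h t).2)}.
Proof.
by move=> ch; apply: (@continuous_comp _ _ _ h (fun z => z.2) t ch); exact: continuous_snd.
Qed.

Lemma usc_in_comp {R : realType} {T T' : topologicalType} (K : set T) (K' : set T')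
    (f : T -> R) (pi : T' -> T) :
  continuous pi -> (forall z, K' z -> K (pi z)) -> usc_in K f ->
  usc_in K' (fun z => f (pi z)).
Proof.
move=> cpi piK fK z K'z a fa; have := fK _ (piK _ K'z) a fa.
rewrite !near_withinE => H.
have H' : \forall y \near z, K (pi y) -> f (pi y) < a by exact: (cpi z _ H).
by apply: filterS H' => y Hy K'y; apply: Hy; exact: piK.
Qed.

(** * The penalty of the normal coordinates *)

Section vertex_penalty.
Context {R : realType}.
Implicit Types (s t x h : R).

Definition sqp x : R := Num.max x 0 ^+ 2.

Lemma sqp_ge0 x : 0 <= sqp x. Proof. exact: sqr_ge0. Qed.

Lemma sqp_pos x : 0 <= x -> sqp x = x ^+ 2.
Proof. by move=> x0; rewrite /sqp max_l. Qed.

Lemma sqp_neg x : x <= 0 -> sqp x = 0.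
Proof. by move=> x0; rewrite /sqp max_r// expr0n. Qed.

Lemma sqp_le_sqr x : sqp x <= x ^+ 2.
Proof.
case: (lerP 0 x) => x0; first by rewrite sqp_pos.
by rewrite (sqp_neg (ltW x0)) sqr_ge0.
Qed.

Lemma sqp_eq0 x : sqp x = 0 -> x <= 0.
Proof. case: (lerP x 0) => // x0; rewrite sqp_pos ?ltW// => /eqP.
by rewrite sqrf_eq0 gt_eqF. Qed.

Lemma sqp_homo : {homo sqp : x y / x <= y}.
Proof.
move=> x y xy; case: (lerP 0 x) => x0; last by rewrite (sqp_neg (ltW x0)) sqp_ge0.
have y0 : 0 <= y by exact: le_trans xy.
by rewrite !sqp_pos//; nra.
Qed.

(** [sqp] is convex with a 2-Lipschitz derivative. This and the next bound enclose it between its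
    tangent and the tangent plus [h ^+ 2], which lets a quadratic replace it in test functions. *)
Lemma sqp_tangent_le x h : sqp x + 2 * Num.max x 0 * h <= sqp (x + h).
Proof.
case: (lerP 0 x) => x0.
  case: (lerP 0 (x + h)) => xh; first by rewrite !sqp_pos//; nra.
  by rewrite sqp_pos// sqp_neg; nra.
by rewrite (sqp_neg (ltW x0)) mulr0 mul0r addr0 sqp_ge0.
Qed.

Lemma sqp_le_tangent x h : sqp (x + h) <= sqp x + 2 * Num.max x 0 * h + h ^+ 2.
Proof.
case: (lerP 0 x) => x0.
  by apply: le_trans (sqp_le_sqr _) _; rewrite sqp_pos//; nra.
rewrite (sqp_neg (ltW x0)) mulr0 mul0r !add0r.
case: (lerP 0 (x + h)) => xh; first by rewrite sqp_pos//; nra.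
by rewrite (sqp_neg (ltW xh)) sqr_ge0.
Qed.

Lemma is_derive_quadratic (f : R -> R) x (l C : R) :
  (forall h, `|f (x + h) - f x - l * h| <= C * h ^+ 2) -> is_derive x 1 f l.
Proof.
move=> H; have cv : h^-1 *: ((f \o shift x) (h *: (1 : R)) - f x) @[h --> 0^'] --> l.
  apply/cvgrPdist_le => e e0; near=> h.
  have h0 : h != 0 by near: h; exact: nbhs_dnbhs_neq.
  have hp : 0 < `|h| by rewrite normr_gt0.
  have hs : `|h| <= e / (`|C| + 1).
    by near: h; apply: dnbhs0_le; rewrite divr_gt0// ltr_wpDl.
  have -> : l - h^-1 *: ((f \o shift x) (h *: 1) - f x) = - (h^-1 * (f (x + h) - f x - l * h)).
    rewrite /= /GRing.scale/= mulr1 (addrC h); field.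
    by [].
  rewrite normrN normrM normfV mulrC ler_pdivrMr//.
  apply: le_trans (H h) _; rewrite -(real_normK (num_real h)) expr2 mulrA ler_pM2r//.
  move: hs; rewrite ler_pdivlMr; last by rewrite ltr_wpDl.
  by have := ler_norm C; nra.
by apply: DeriveDef; [apply/cvg_ex; exists l|exact: cvg_lim cv].
Unshelve. all: by end_near. Qed.

Lemma is_derive_sqp x : is_derive x 1 sqp (2 * Num.max x 0).
Proof.
apply: (@is_derive_quadratic _ _ _ 1) => h.
have := sqp_tangent_le x h; have := sqp_le_tangent x h; rewrite ler_norml; nra.
Qed.

Lemma continuous_max0 : continuous (fun x : R => Num.max x 0).
Proof. by move=> x; apply: continuous_max; [exact: cvg_id|exact: cvg_cst]. Qed.

Lemma continuous_sqp : continuous sqp.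
Proof. by move=> x; apply: cvgM; exact: continuous_max0. Qed.

(* [c * gg s1 s2] penalizes [s1 <> s2] for [c] large; its slopes in [s1] and
   in [s2] nearly agree where [s1] and [s2] have the same sign, the slope in
   [s1] is [c] where the signs differ, and [gg 0] is differentiable.
   At [s1 = 0], [x / 0 = 0] makes [gp 0 s2 = s2 ^+ 2]. *)
Definition gp s t : R := sqp (t - s) + sqp (s - Num.max t 0) / s + sqp (- t).

Definition gg s t : R := if 0 <= s then gp s t else gp (- s) (- t).

Lemma gp_ge0 s t : 0 <= s -> 0 <= gp s t.
Proof. by move=> s0; rewrite !addr_ge0 ?divr_ge0 ?sqp_ge0. Qed.

Lemma gp0 t : gp 0 t = t ^+ 2.
Proof.
rewrite /gp subr0 invr0 mulr0 addr0; case: (lerP 0 t) => t0.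
  by rewrite sqp_pos// sqp_neg ?addr0// oppr_le0.
by rewrite sqp_neg ?ltW// sqp_pos ?add0r ?sqrrN// oppr_ge0 ltW.
Qed.

Lemma ggN s t : gg (- s) (- t) = gg s t.
Proof.
rewrite /gg oppr_ge0 !opprK; case: (ltgtP s 0) => // ->.
by rewrite oppr0 !gp0 sqrrN.
Qed.

Lemma gg0 t : gg 0 t = t ^+ 2.
Proof. by rewrite /gg lexx gp0. Qed.

Lemma gg_ge0 s t : 0 <= gg s t.
Proof. by rewrite /gg; case: (lerP 0 s) => s0; apply: gp_ge0 => //; rewrite oppr_ge0 ltW. Qed.

Lemma gp_diag s : 0 <= s -> gp s s = 0.
Proof.
move=> s0; rewrite /gp max_l// subrr (sqp_neg (lexx 0)) mul0r !add0r.
by rewrite sqp_neg// oppr_le0.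
Qed.

Lemma gg_diag s : gg s s = 0.
Proof.
rewrite /gg; case: (lerP 0 s) => s0; rewrite gp_diag//.
by rewrite oppr_ge0 ltW.
Qed.

Lemma gp_eq0 s t : 0 <= s -> gp s t = 0 -> s = t.
Proof.
rewrite le_eqVlt => /predU1P[<- /eqP|s0]; first by rewrite gp0 sqrf_eq0 => /eqP.
have a := sqp_ge0 (t - s); have b : 0 <= sqp (s - Num.max t 0) / s.
  by rewrite divr_ge0 ?sqp_ge0 ?ltW.
have c := sqp_ge0 (- t); rewrite /gp => H.
have /sqp_eq0 : sqp (t - s) = 0 by lra.
have /sqp_eq0 : sqp (- t) = 0 by lra.
have /eqP : sqp (s - Num.max t 0) / s = 0 by lra.
rewrite mulf_eq0 invr_eq0 (gt_eqF s0) orbF => /eqP/sqp_eq0.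
by rewrite oppr_le0 => + t0; rewrite max_l//; lra.
Qed.

Lemma gg_eq0 s t : gg s t = 0 -> s = t.
Proof.
rewrite /gg; case: (lerP 0 s) => s0; first exact: gp_eq0.
by have s0' : 0 <= - s by [rewrite oppr_ge0 ltW]; move=> /(gp_eq0 s0') /oppr_inj.
Qed.

(** A lower bound without the quotient by [s], continuous up to [s = 0] and equal to [gp 0 t] there:
    it gives the semicontinuity of [gg] across [s = 0]. *)
Lemma gp_ge s t : 0 <= s -> sqp (`|t| - s) <= gp s t.
Proof.
move=> s0; case: (lerP 0 t) => t0.
  by rewrite /gp ger0_norm// -addrA lerDl addr_ge0 ?divr_ge0 ?sqp_ge0.
apply: (@le_trans _ _ (sqp (- t))); last by rewrite lerDr addr_ge0 ?divr_ge0 ?sqp_ge0.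
by apply: sqp_homo; rewrite ltr0_norm// gerBl.
Qed.

Lemma gg_ge s t : sqp (`|t| - `|s|) <= gg s t.
Proof.
rewrite /gg; case: (lerP 0 s) => s0; first by rewrite (ger0_norm s0); exact: gp_ge.
by rewrite (ltr0_norm s0) -(normrN t); apply: gp_ge; rewrite oppr_ge0 ltW.
Qed.

(** With [y = gp_ratio s t], the quotient in [gp] is [s * y ^+ 2]; being homogeneous of degree one
    it has slope 1 in [s] for [t <= 0], however small [s > 0] is. *)
Definition gp_ratio s t : R := Num.max (s - Num.max t 0) 0 / s.

Lemma gp_ratio_itv s t : 0 < s -> 0 <= gp_ratio s t <= 1.
Proof.
move=> s0; rewrite /gp_ratio divr_ge0 ?(ltW s0) ?le_max ?lexx ?orbT//=.
rewrite ler_pdivrMr// mul1r ge_max (ltW s0) andbT gerBl.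
by rewrite le_max lexx orbT.
Qed.

(** For [s > 0] this is the derivative of [gp] in [s]; [gp_dt] is minus its derivative in [t], for
    [t > 0]. The opposite sign makes them comparable as slopes of [u] and of [v]. *)
Definition gp_ds s t : R := gp_ratio s t * (2 - gp_ratio s t) - 2 * Num.max (t - s) 0.

Definition gp_dt s t : R := 2 * gp_ratio s t - 2 * Num.max (t - s) 0.

Lemma gp_ds_nonpos s t : 0 < s -> t <= 0 -> gp_ds s t = 1.
Proof.
move=> s0 t0; rewrite /gp_ds /gp_ratio (max_r t0) subr0 (max_l (ltW s0)) divff ?gt_eqF//.
by rewrite max_r; lra.
Qed.

(** For [t <= s] the difference is [y ^+ 2] with [y = gp_ratio s t], and [y <= y * (2 - y)]; for
    [t > s] it vanishes. Hence once [c * gp_ds] is bounded above, [c] times the difference is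
    [O(1 / c)]. *)
Lemma gp_slopes s t : 0 < s -> 0 <= gp_dt s t - gp_ds s t <= Num.max (gp_ds s t) 0 ^+ 2.
Proof.
move=> s0; rewrite /gp_dt /gp_ds; have := gp_ratio_itv t s0.
set y := gp_ratio s t => /andP[y0 y1].
case: (lerP t s) => ts.
  rewrite (@max_r _ _ (t - s)) ?subr_le0// mulr0 !subr0.
  rewrite max_l; last by rewrite mulr_ge0//; lra.
  have -> : 2 * y - y * (2 - y) = y ^+ 2 by ring.
  rewrite sqr_ge0 [leRHS]exprMn /= ler_peMr ?sqr_ge0//; nra.
have -> : y = 0.
  by rewrite /y /gp_ratio (@max_r _ _ (s - _)) ?mul0r// subr_le0 le_max (ltW ts).
rewrite mul0r mulr0; apply/andP; split; first lra.
by apply: le_trans (sqr_ge0 _); lra.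
Qed.

Lemma gp_tangent_s s t s' : 0 < s -> s / 2 <= s' ->
  gp s' t <= gp s t + gp_ds s t * (s' - s) + (1 + 2 / s) * (s' - s) ^+ 2.
Proof.
move=> s0 ss'; have s'0 : 0 < s' by lra.
rewrite /gp /gp_ds /gp_ratio; set b := Num.max t 0; set x := Num.max (s - b) 0.
have b0 : 0 <= b by rewrite /b le_max lexx orbT.
have x0 : 0 <= x by rewrite /x le_max lexx orbT.
have xs : x <= s by rewrite /x ge_max (ltW s0) andbT gerBl.
pose h := s' - s.
have H1 := sqp_le_tangent (t - s) (- h).
have H2 := sqp_le_tangent (s - b) h.
have e1 : t - s + - h = t - s' by rewrite /h; ring.
have e2 : s - b + h = s' - b by rewrite /h; ring.
rewrite e1 in H1; rewrite e2 -/x in H2.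
have e3 : sqp (s - b) = x ^+ 2 by [].
rewrite e3 in H2 *.
have H3 : sqp (s' - b) / s' <= x ^+ 2 / s + x / s * (2 - x / s) * h + 2 / s * h ^+ 2.
  (* Exact remainder of the tangent bound; it is nonnegative because
     [2 * s * s' >= s ^+ 2 >= (s - x) ^+ 2], which is where [s / 2 <= s'] enters. *)
  have -> : x ^+ 2 / s + x / s * (2 - x / s) * h + 2 / s * h ^+ 2 =
     (x ^+ 2 + 2 * x * h + h ^+ 2) / s'
     + h ^+ 2 * (2 * s * s' - (s - x) ^+ 2) / (s ^+ 2 * s').
    by rewrite /h; field; rewrite !gt_eqF.
  apply: ler_wpDr.
    have k0 : 0 <= 2 * s * s' - (s - x) ^+ 2 by nra.
    by apply: divr_ge0; apply: mulr_ge0; rewrite ?sqr_ge0 ?(ltW s'0).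
  by rewrite ler_pM2r ?invr_gt0.
move: H1 H3; rewrite -/h; set P := x / s; set S := sqp (s' - b) / s'.
by set M := Num.max (t - s) 0; move=> H1 H3; lra.
Qed.

Lemma gp_tangent_t s t t' : 0 < s -> 0 < t -> 0 < t' ->
  gp s t' <= gp s t - gp_dt s t * (t' - t) + (1 + 1 / s) * (t' - t) ^+ 2.
Proof.
move=> s0 t0 t'0; rewrite /gp /gp_dt /gp_ratio (max_l (ltW t0)) (max_l (ltW t'0)).
rewrite (@sqp_neg (- t)) ?oppr_le0 ?(ltW t0)// (@sqp_neg (- t')) ?oppr_le0 ?(ltW t'0)// !addr0.
have := sqp_le_tangent (t - s) (t' - t); rewrite (_ : t - s + _ = t' - s); last by ring.
have := sqp_le_tangent (s - t) (t - t'); rewrite (_ : s - t + _ = s - t'); last by ring.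
set M := Num.max (t - s) 0; set x := Num.max (s - t) 0 => H1 H2.
have : sqp (s - t') / s <= (sqp (s - t) + 2 * x * (t - t') + (t - t') ^+ 2) / s.
  by rewrite ler_pM2r ?invr_gt0.
have -> : (sqp (s - t) + 2 * x * (t - t') + (t - t') ^+ 2) / s
  = sqp (s - t) / s - 2 * (x / s) * (t' - t) + 1 / s * (t' - t) ^+ 2.
  by field; rewrite gt_eqF.
set P := x / s; set S := sqp (s - t) / s; set S' := sqp (s - t') / s => H3.
lra.
Qed.

Lemma gg_small s t : 0 <= s <= t -> gg s t = (t - s) ^+ 2.
Proof.
move=> /andP[s0 st]; rewrite /gg s0 /gp sqp_pos ?subr_ge0//.
rewrite (@sqp_neg (- t)) ?oppr_le0 ?(le_trans s0)// sqp_neg ?mul0r ?addr0//.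
by rewrite subr_le0 le_max st.
Qed.

(** For [s > 0] the function [gp] is continuous, [s < 0] follows by the symmetry [ggN], and at
    [s = 0] the bound [gg_ge] replaces continuity. *)
Lemma gg_usc (K : set (R * R)) : usc_in K (fun z => - gg z.1 z.2).
Proof.
have c1 z : {for z, continuous (fun z : R * R => z.1)} by exact: cvg_fst.
have c2 z : {for z, continuous (fun z : R * R => z.2)} by exact: cvg_snd.
have gpc s t : 0 < s -> {for (s, t), continuous (fun z : R * R => gp z.1 z.2)}.
  move=> s0; rewrite /gp; apply: continuousD; first apply: continuousD.
  - apply: (@continuous_comp _ _ _ (fun z : R * R => z.2 - z.1) sqp); last exact: continuous_sqp.
    by apply: continuousB; [exact: c2|exact: c1].
  - apply: continuousM; last by apply: continuousV; [rewrite gt_eqF|exact: c1].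
    apply: (@continuous_comp _ _ _ (fun z : R * R => z.1 - Num.max z.2 0) sqp); last exact: continuous_sqp.
    apply: continuousB; first exact: c1.
    by apply: (@continuous_comp _ _ _ (fun z : R * R => z.2) (fun x => Num.max x 0)); [exact: c2|exact: continuous_max0].
  - apply: (@continuous_comp _ _ _ (fun z : R * R => - z.2) sqp); last exact: continuous_sqp.
    by apply: continuousN; exact: c2.
have pos s t a : 0 < s -> - gg s t < a -> \forall z \near (s, t), - gg z.1 z.2 < a.
  move=> s0; rewrite {1}/gg (ltW s0) => ga.
  have H1 := continuous_near_gt (c1 (s, t)) s0.
  have H2 := continuous_near_lt (continuousN (gpc s t s0)) ga.
  by apply: filterS2 H1 H2 => z z0; rewrite /gg (ltW z0).
move=> [s t] _ a /= ga; rewrite near_withinE.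
suff : \forall z \near (s, t), - gg z.1 z.2 < a by apply: filterS => z.
have [s0|s0|s0] := ltgtP s 0; last first.
- move: ga; rewrite s0 gg0 => ga.
  have c : {for (0, t), continuous (fun z : R * R => - sqp (`|z.2| - `|z.1|))}.
    apply: continuousN; apply: (@continuous_comp _ _ _ (fun z : R * R => `|z.2| - `|z.1|) sqp); last exact: continuous_sqp.
    apply: continuousB.
      by apply: (@continuous_comp _ _ _ (fun z : R * R => z.2) Num.norm); [exact: c2|exact: norm_continuous].
    by apply: (@continuous_comp _ _ _ (fun z : R * R => z.1) Num.norm); [exact: c1|exact: norm_continuous].
  have cc : - sqp (`|t : R| - `|0 : R|) < a by rewrite normr0 subr0 sqp_pos ?real_normK ?num_real.
  by apply: filterS (continuous_near_lt c cc) => z; apply: le_lt_trans; rewrite lerN2 gg_ge.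
- exact: pos.
- have s0' : 0 < - s by rewrite oppr_gt0.
  have := @pos (- s) (- t) a s0'; rewrite ggN => /(_ ga) H.
  have c : {for (s, t), continuous (fun z : R * R => (- z.1, - z.2))}.
    exact: (cvg_pair (continuousN (c1 (s, t))) (continuousN (c2 (s, t)))).
  have H' : \forall z \near (s, t), - gg (- z.1) (- z.2) < a by exact: (c _ H).
  by apply: filterS H' => z; rewrite ggN.
Qed.

End vertex_penalty.

(** * The comparison setting across the interface *)

Section local_comparison.
Context {R : realType} {n : nat}.
Local Notation E := 'rV[R]_n.+1.
Implicit Types (X Y : E * R) (p : E) (F : E -> R -> E -> R) (N : set (E * R)).

Definition pdist X Y : R := enorm (X.1 - Y.1) + `|X.2 - Y.2|.

Lemma pdist_ge0 X Y : 0 <= pdist X Y.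
Proof. by rewrite addr_ge0 ?enorm_ge0. Qed.

Lemma pdistC X Y : pdist X Y = pdist Y X.
Proof. by rewrite /pdist enormB distrC. Qed.

Lemma pdistxx X : pdist X X = 0.
Proof. by rewrite /pdist !subrr enorm0 normr0 addr0. Qed.

Lemma pdist_triang X Y Z : pdist X Z <= pdist X Y + pdist Y Z.
Proof.
rewrite /pdist addrACA lerD ?enorm_triang//.
by rewrite (_ : X.2 - Z.2 = (X.2 - Y.2) + (Y.2 - Z.2)) ?ler_normD// addrA subrK.
Qed.

Lemma enorm_le_pdist X Y : enorm (X.1 - Y.1) <= pdist X Y.
Proof. by rewrite lerDl. Qed.

Lemma norm_le_pdist X Y : `|X.2 - Y.2| <= pdist X Y.
Proof. by rewrite lerDr enorm_ge0. Qed.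

Lemma sqdE X Y : sqd X Y = enorm (X.1 - Y.1) ^+ 2 + `|X.2 - Y.2| ^+ 2.
Proof. by rewrite /sqd sqr_enorm real_normK// num_real. Qed.

Lemma sqd_ge0 X Y : 0 <= sqd X Y.
Proof. by rewrite sqdE addr_ge0 ?sqr_ge0. Qed.

Lemma sqd_eq0 X Y : sqd X Y = 0 -> X = Y.
Proof.
rewrite sqdE => /eqP; rewrite paddr_eq0 ?sqr_ge0// !sqrf_eq0 normr_eq0 subr_eq0.
move=> /andP[/eqP/enorm_eq0/eqP]; rewrite subr_eq0.
by case: X Y => x t [y s] /= /eqP -> /eqP ->.
Qed.

Lemma sqdxx X : sqd X X = 0.
Proof. by rewrite sqdE !subrr enorm0 normr0 expr0n addr0. Qed.

Lemma sqdC X Y : sqd X Y = sqd Y X.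
Proof. by rewrite !sqdE enormB distrC. Qed.

Lemma sqr_pdist_le X Y : pdist X Y ^+ 2 <= 2 * sqd X Y.
Proof.
rewrite sqdE /pdist; set x := enorm _; set y := `|_|.
have := sqr_ge0 (x - y); nra.
Qed.

(** The properties of one Hamiltonian on its own side [D] on which the comparison rests. The upper
    constants are absorbed in one [M], convexity appears as quasiconvexity along lines, and
    [ham_coer] is the form taken by (C4). *)
Record ham_on (D : set (E * R)) (nd : E -> E) (M del : R) (ml : R -> R) F : Prop := {
  ham_lip : forall X p p', D X ->
    F X.1 X.2 p <= F X.1 X.2 p' + M * enorm (p - p') ;
  ham_mod : forall X Y p, D X -> D Y ->
    F X.1 X.2 p <= F Y.1 Y.2 p + M * pdist X Y * enorm p + ml (pdist X Y) ;
  ham_qconv : forall X p m a b c y, D X -> a <= b <= c ->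
    F X.1 X.2 (p + a *: m) <= y -> F X.1 X.2 (p + c *: m) <= y ->
    F X.1 X.2 (p + b *: m) <= y ;
  ham_coer : forall X p q, D X ->
    del * `|q| <= F X.1 X.2 (p + q *: nd X.1) + M * (enorm p + 1)
}.

(* [d] is a defining function of the interface, [Fp] and [Fm] are the
   Hamiltonians of the sides [d > 0] and [d < 0]. In [set_tang] the tangential
   inequality is replaced by a normal slope common to both Hamiltonians, which
   [tangential_slope] provides. *)
Record setting N (ut v : E * R -> R) (kap M del : R) (ml : R -> R)
    (d : E -> R) (nd : E -> E) Fp Fm : Prop := {
  set_nbhs : forall X, N X -> nbhs X N ;
  set_del : 0 < del ;
  set_M : 0 <= M ;
  set_kap : 0 < kap ;
  set_usc : usc_in N ut ;
  set_lsc : usc_in N (fun X => - v X) ;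
  set_ml : forall e, 0 < e -> exists2 r : R, 0 < r & forall x, 0 <= x < r -> ml x <= e ;
  set_d : C1_gradient (fun X : E * R => d X.1) (fun X => nd X.1) (fun=> 0) ;
  set_nd_le : forall X, N X -> enorm (nd X.1) <= M ;
  set_nd_lip : forall X Y, N X -> N Y ->
    enorm (nd X.1 - nd Y.1) <= M * enorm (X.1 - Y.1) ;
  set_Fp : ham_on (N `&` [set X | 0 <= d X.1]) nd M del ml Fp ;
  set_Fm : ham_on (N `&` [set X | d X.1 <= 0]) nd M del ml Fm ;
  set_subp : forall phi G A X, C1_gradient phi G A -> N X -> 0 < d X.1 ->
    (\forall Y \near X, ut Y - phi Y <= ut X - phi X) ->
    A X + Fp X.1 X.2 (G X) <= - kap ;
  set_subm : forall phi G A X, C1_gradient phi G A -> N X -> d X.1 < 0 ->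
    (\forall Y \near X, ut Y - phi Y <= ut X - phi X) ->
    A X + Fm X.1 X.2 (G X) <= - kap ;
  set_sub0 : forall phi G A X, C1_gradient phi G A -> N X -> d X.1 = 0 ->
    (\forall Y \near X, ut Y - phi Y <= ut X - phi X) ->
    A X + Num.min (Fp X.1 X.2 (G X)) (Fm X.1 X.2 (G X)) <= - kap ;
  set_supp : forall phi G A X, C1_gradient phi G A -> N X -> 0 < d X.1 ->
    (\forall Y \near X, v X - phi X <= v Y - phi Y) ->
    0 <= A X + Fp X.1 X.2 (G X) ;
  set_supm : forall phi G A X, C1_gradient phi G A -> N X -> d X.1 < 0 ->
    (\forall Y \near X, v X - phi X <= v Y - phi Y) ->
    0 <= A X + Fm X.1 X.2 (G X) ;
  set_sup0 : forall phi G A X, C1_gradient phi G A -> N X -> d X.1 = 0 ->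
    (\forall Y \near X, v X - phi X <= v Y - phi Y) ->
    0 <= A X + Num.max (Fp X.1 X.2 (G X)) (Fm X.1 X.2 (G X)) ;
  set_tang : forall phi G A X, C1_gradient phi G A -> N X -> d X.1 = 0 ->
    (\forall Y \near X, d Y.1 = 0 -> ut Y - phi Y <= ut X - phi X) ->
    exists q, A X + Fp X.1 X.2 (G X + q *: nd X.1) <= - kap /\
              A X + Fm X.1 X.2 (G X + q *: nd X.1) <= - kap
}.

Lemma ham_on_flip D D' nd M del ml F : D = D' -> ham_on D nd M del ml F ->
  ham_on D' (fun x => - nd x) M del ml F.
Proof.
move=> <- [h1 h2 h3 h4]; split=> // X p q DX.
by have := h4 X p (- q) DX; rewrite normrN scaleNr scalerN.
Qed.

(** Reversing the sign of [d] exchanges the two sides, so that arguments on one side serve both; a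
    common slope [q] becomes [- q]. *)
Lemma setting_flip N ut v kap M del ml d nd Fp Fm :
  setting N ut v kap M del ml d nd Fp Fm ->
  setting N ut v kap M del ml (fun x => - d x) (fun x => - nd x) Fm Fp.
Proof.
case=> h1 h2 h2' h2'' h3 h4 h5 h6 h7 h8 h9 h10 h11 h12 h13 h14 h15 h16 h17; split=> //.
- by have := C1_gradientN h6; rewrite oppr0.
- by move=> X NX; rewrite enormN h7.
- by move=> X Y NX NY; rewrite -opprD enormN h8.
- by apply: ham_on_flip h10; congr (_ `&` _); apply/seteqP; split=> X /=; rewrite oppr_ge0.
- by apply: ham_on_flip h9; congr (_ `&` _); apply/seteqP; split=> X /=; rewrite oppr_le0.
- by move=> phi G A X hp NX; rewrite oppr_gt0; exact: h12.
- by move=> phi G A X hp NX; rewrite oppr_lt0; exact: h11.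
- by move=> phi G A X hp NX /eqP; rewrite oppr_eq0 => /eqP; rewrite minC; exact: h13.
- by move=> phi G A X hp NX; rewrite oppr_gt0; exact: h15.
- by move=> phi G A X hp NX; rewrite oppr_lt0; exact: h14.
- by move=> phi G A X hp NX /eqP; rewrite oppr_eq0 => /eqP; rewrite maxC; exact: h16.
- move=> phi G A X hp NX /eqP; rewrite oppr_eq0 => /eqP dX H.
  have [|q [q1 q2]] := h17 phi G A X hp NX dX.
    by apply: filterS H => Y HY dY; apply: HY; rewrite dY oppr0.
  by exists (- q); rewrite scalerN scaleNr opprK; split.
Qed.

(** At points with [d = s0] only the slope [al] shows in the gradient, while [C] absorbs the
    second-order error of a penalty that is bounded by its tangent up to a square. *)
Lemma C1_gradient_add_d (d : E -> R) (nd : E -> E) phi G A (al C s0 : R) :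
  C1_gradient (fun X : E * R => d X.1) (fun X => nd X.1) (fun=> 0) ->
  C1_gradient phi G A ->
  C1_gradient (fun Y => phi Y + (al * (d Y.1 - s0) + C * (d Y.1 - s0) ^+ 2))
    (fun Y => G Y + (al + 2 * C * (d Y.1 - s0)) *: nd Y.1) A.
Proof.
move=> hd hp.
have h1 := C1_gradientD hd (C1_gradient_cst (- s0)).
have h2 := C1_gradientZ C (C1_gradientM h1 h1).
have := C1_gradientD hp (C1_gradientD (C1_gradientZ al h1) h2).
congr C1_gradient; apply/funext => X.
  rewrite !addr0; congr (_ + _); rewrite -scalerDl scalerA -scalerDl.
  by congr (_ *: _); ring.
ring.
Qed.

(** [eta * B] bounds [|X1 - X2| |q1|] by coercivity. The three terms collect [a1], [a2] and the
    modulus; the change of momentum under [ham_lip]; and the change of point under [ham_mod]. *)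
Definition estimate_const (M del : R) : R :=
  let B := (3 * M + 2) / del in
  3 + M * (2 + M * B + M) + M * (2 + M * B).

Lemma estimate_const_gt0 M del : 0 <= M -> 0 < del -> 0 < estimate_const M del.
Proof.
move=> M0 d0; rewrite /estimate_const /=; set B := _ / del.
have B0 : 0 <= B by rewrite /B divr_ge0 ?ltW//; lra.
by nra.
Qed.

(** The slope [q1] may be large, but the subsolution inequality and coercivity bound it in terms of
    [|p|] and [|a|], so [|X1 - X2| |q1|] is small. This controls both the change of [nd] multiplied
    by [q1] and the variation of [F] between the points at the momentum of [X1]. *)
Lemma doubling_estimate D nd M del ml F N X1 X2 p e1 e2 (a a1 a2 q1 q2 kap eta : R) :
  ham_on D nd M del ml F -> 0 <= M -> 0 < del -> 0 <= kap ->
  D X1 -> D X2 -> D `<=` N ->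
  (forall X, N X -> enorm (nd X.1) <= M) ->
  (forall X Y, N X -> N Y -> enorm (nd X.1 - nd Y.1) <= M * enorm (X.1 - Y.1)) ->
  eta <= 1 ->
  pdist X1 X2 <= eta -> pdist X1 X2 * enorm p <= eta -> pdist X1 X2 * `|a| <= eta ->
  ml (pdist X1 X2) <= eta ->
  enorm e1 <= eta -> enorm e2 <= eta -> `|a1| <= eta -> `|a2| <= eta ->
  `|q1 - q2| <= eta ->
  a + a1 + F X1.1 X1.2 (p + e1 + q1 *: nd X1.1) <= - kap ->
  0 <= a + a2 + F X2.1 X2.2 (p + e2 + q2 *: nd X2.1) ->
  kap <= estimate_const M del * eta.
Proof.
move=> hF M0 d0 kap0 D1 D2 DN ndM ndL eta1 h1 h2 h3 h4 h5 h6 h7 h8 h9 hu hv.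
rewrite /estimate_const /=; set B := _ / del.
have r0 := pdist_ge0 X1 X2.
have eta0 : 0 <= eta by exact: le_trans h1.
have B0 : 0 <= B by rewrite /B divr_ge0 ?ltW//; lra.
have N1 := ndM _ (DN _ D1); have N2 := ndM _ (DN _ D2).
have rN := le_trans (ndL _ _ (DN _ D1) (DN _ D2)) (ler_wpM2l M0 (enorm_le_pdist X1 X2)).
set r := pdist X1 X2 in h1 h2 h3 h4 r0 rN *.
(* Coercivity gives [del |q1| <= M (|p| + 2) + |a| + 1]; multiplication by [r] makes the right side
   at most [(3 M + 2) eta]. *)
have hq1 : r * `|q1| <= eta * B.
  have := ham_coer hF (p + e1) q1 D1; have := enormD p e1.
  move: hu; set f := F _ _ _ => hu en co.
  have hc : del * `|q1| <= M * (enorm p + 2) + `|a| + 1.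
    move: h7; rewrite ler_norml => /andP[h7 h7'].
    have := ler_norm (- a); rewrite normrN.
    have : M * (enorm (p + e1) + 1) <= M * (enorm p + 2) by rewrite ler_wpM2l//; lra.
    lra.
  rewrite /B mulrA ler_pdivlMr//.
  have : r * (del * `|q1|) <= r * (M * (enorm p + 2) + `|a| + 1) by rewrite ler_wpM2l.
  have : M * (r * enorm p) <= M * eta by rewrite ler_wpM2l.
  have : M * r <= M * eta by rewrite ler_wpM2l.
  lra.
set p1 := p + e1 + q1 *: nd X1.1 in hu; set p2 := p + e2 + q2 *: nd X2.1 in hv.
have hp12 : enorm (p2 - p1) <= eta * (2 + M * B + M).
  have -> : p2 - p1 = e2 + (- e1) + (q1 *: (nd X2.1 - nd X1.1) + (q2 - q1) *: nd X2.1).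
    rewrite /p1 /p2; apply/rowP => i; rewrite !mxE; ring.
  apply: le_trans (enormD _ _) _.
  have e12 := enormD e2 (- e1); rewrite enormN in e12.
  have := enormD (q1 *: (nd X2.1 - nd X1.1)) ((q2 - q1) *: nd X2.1).
  rewrite !enormZ enormB => q12.
  have b1 : `|q1| * enorm (nd X1.1 - nd X2.1) <= M * (eta * B).
    apply: (@le_trans _ _ (`|q1| * (M * r))); first by rewrite ler_wpM2l.
    rewrite mulrCA ler_wpM2l//; lra.
  have b2 : `|q2 - q1| * enorm (nd X2.1) <= eta * M.
    by rewrite distrC; apply: ler_pM => //; exact: enorm_ge0.
  lra.
have hrp : r * enorm p1 <= eta * (2 + M * B).
  rewrite /p1; have := enormD (p + e1) (q1 *: nd X1.1); have := enormD p e1.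
  rewrite enormZ => s1 s2.
  have b1 : r * (`|q1| * enorm (nd X1.1)) <= eta * B * M.
    by rewrite mulrA; apply: ler_pM => //; [exact: mulr_ge0|exact: enorm_ge0].
  have b2 : r * enorm e1 <= eta.
    have e11 : enorm e1 <= 1 by exact: le_trans eta1.
    by have := ler_wpM2l r0 e11; lra.
  have : r * enorm (p + e1 + q1 *: nd X1.1) <= r * (enorm p + enorm e1 + `|q1| * enorm (nd X1.1)).
    by rewrite ler_wpM2l//; lra.
  lra.
have f1 := ham_lip hF p2 p1 D2.
have f2 := ham_mod hF p1 D2 D1; rewrite pdistC -/r in f2.
have m1 : M * enorm (p2 - p1) <= M * (eta * (2 + M * B + M)) by rewrite ler_wpM2l.
have m2 : M * (r * enorm p1) <= M * (eta * (2 + M * B)) by rewrite ler_wpM2l.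
move: h7 h8; rewrite !ler_norml => /andP[h7 h7'] /andP[h8 h8'].
lra.
Qed.

End local_comparison.

(** * One-sided subsolution inequalities at the interface *)

Section one_sided.
Context {R : realType} {n : nat}.
Local Notation E := 'rV[R]_n.+1.
Implicit Types (X Y : E * R) (N W : set (E * R)).

Lemma rV_compact_nbhs (x : E) (W : set E) : nbhs x W ->
  exists K, [/\ compact K, nbhs x K & K `<=` W].
Proof.
move=> /nbhs_closedballP[r rW]; exists (closed_ball x r%:num); split=> //.
  apply: bounded_closed_compact; last exact: closed_ball_closed.
  exists (`|x| + r%:num); split; first exact: num_real.
  move=> M MM y; rewrite closed_ballE// /closed_ball_ /= => xy.
  have := ler_normB x (x - y); rewrite subKr => H.
  by apply: le_trans (ltW MM); apply: le_trans H _; rewrite lerD2l.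
by apply/nbhs_closedballP; exists r.
Qed.

Lemma compact_nbhs X W : nbhs X W -> exists K, [/\ compact K, nbhs X K & K `<=` W].
Proof.
case: X => x t [[W1 W2] /= [xW1 tW2] WW].
have [K1 [cK1 nK1 K1W]] := rV_compact_nbhs xW1.
have /nbhs_closedballP[r rW] := tW2.
exists (K1 `*` closed_ball t r%:num); split.
- by apply: compact_setX => //; exact: closed_ballR_compact.
- by exists (K1, closed_ball t r%:num) => //=; split=> //; apply/nbhs_closedballP; exists r.
- by move=> [y s] [/= /K1W ? /rW ?]; apply: WW.
Qed.

Context {N : set (E * R)} {ut v : E * R -> R} {kap M del : R} {ml : R -> R}
  {d : E -> R} {nd : E -> E} {Fp Fm : E -> R -> E -> R}.
Hypothesis S : setting N ut v kap M del ml d nd Fp Fm.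

Lemma sub_d_p phi G A (al C : R) X : C1_gradient phi G A -> N X -> 0 < d X.1 ->
  (\forall Y \near X, ut Y - phi Y - (al * (d Y.1 - d X.1) + C * (d Y.1 - d X.1) ^+ 2)
     <= ut X - phi X) ->
  A X + Fp X.1 X.2 (G X + al *: nd X.1) <= - kap.
Proof.
move=> hp NX dX H.
have hp' := C1_gradient_add_d al C (d X.1) (set_d S) hp.
have := set_subp S hp' NX dX; rewrite subrr !mulr0 addr0; apply.
by apply: filterS H => Y; rewrite expr0n/= mulr0; lra.
Qed.

Lemma sub_d_0 phi G A (al C : R) X : C1_gradient phi G A -> N X -> d X.1 = 0 ->
  (\forall Y \near X, ut Y - phi Y - (al * (d Y.1 - d X.1) + C * (d Y.1 - d X.1) ^+ 2)
     <= ut X - phi X) ->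
  A X + Num.min (Fp X.1 X.2 (G X + al *: nd X.1)) (Fm X.1 X.2 (G X + al *: nd X.1)) <= - kap.
Proof.
move=> hp NX dX H.
have hp' := C1_gradient_add_d al C (d X.1) (set_d S) hp.
have := set_sub0 S hp' NX dX; rewrite subrr !mulr0 addr0; apply.
by apply: filterS H => Y; rewrite expr0n/= mulr0; lra.
Qed.

Lemma sup_d_p phi G A (al C : R) X : C1_gradient phi G A -> N X -> 0 < d X.1 ->
  (\forall Y \near X, v X - phi X <=
     v Y - phi Y - (al * (d Y.1 - d X.1) + C * (d Y.1 - d X.1) ^+ 2)) ->
  0 <= A X + Fp X.1 X.2 (G X + al *: nd X.1).
Proof.
move=> hp NX dX H.
have hp' := C1_gradient_add_d al C (d X.1) (set_d S) hp.
have := set_supp S hp' NX dX; rewrite subrr !mulr0 addr0; apply.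
by apply: filterS H => Y; rewrite expr0n/= mulr0; lra.
Qed.

Lemma sup_d_0 phi G A (al C : R) X : C1_gradient phi G A -> N X -> d X.1 = 0 ->
  (\forall Y \near X, v X - phi X <=
     v Y - phi Y - (al * (d Y.1 - d X.1) + C * (d Y.1 - d X.1) ^+ 2)) ->
  0 <= A X + Num.max (Fp X.1 X.2 (G X + al *: nd X.1)) (Fm X.1 X.2 (G X + al *: nd X.1)).
Proof.
move=> hp NX dX H.
have hp' := C1_gradient_add_d al C (d X.1) (set_d S) hp.
have := set_sup0 S hp' NX dX; rewrite subrr !mulr0 addr0; apply.
by apply: filterS H => Y; rewrite expr0n/= mulr0; lra.
Qed.

Lemma d_continuous X : {for X, continuous (fun Y : E * R => d Y.1)}.
Proof. by case: (set_d S) => h _ _; exact: is_diff_continuous (h X). Qed.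

Lemma nd_continuous X : {for X, continuous (fun Y : E * R => nd Y.1)}.
Proof. by case: (set_d S) => _ h _; exact: h. Qed.

Lemma pdist_continuous Z X : {for X, continuous (fun Y => pdist Y Z)}.
Proof.
have c1 : {for X, continuous (fun Y : E * R => Y.1 - Z.1)}.
  by apply: continuousB; [exact: cvg_fst|exact: cst_continuous].
have c2 : {for X, continuous (fun Y : E * R => Y.2 - Z.2)}.
  by apply: continuousB; [exact: cvg_snd|exact: cst_continuous].
apply: continuousD; first exact: cvg_enorm c1.
by apply: (@continuous_comp _ _ _ (fun Y : E * R => Y.2 - Z.2) Num.norm) => //; exact: norm_continuous.
Qed.

Lemma near_pdist X (e : R) : 0 < e -> \forall Y \near X, pdist Y X < e.
Proof.
by move=> e0; apply: (continuous_near_lt (@pdist_continuous X X)); rewrite pdistxx.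
Qed.

Lemma near_ml X (e : R) : 0 < e -> \forall Y \near X, ml (pdist X Y) <= e.
Proof.
move=> /(set_ml S)[r r0 H]; apply: filterS (near_pdist X r0) => Y Yr.
by apply: H; rewrite pdist_ge0 pdistC.
Qed.

Lemma continuous_enormB (G G' : E * R -> E) X : {for X, continuous G} ->
  {for X, continuous G'} -> {for X, continuous (fun Y => enorm (G Y - G' Y))}.
Proof. by move=> cG cG'; apply: cvg_enorm; exact: continuousB. Qed.

(* With [theta s = K c / 2 * sqp (1 / c - s)], whose slope is [<= - K] for
   [s <= 0] and nonpositive everywhere, coercivity keeps the maxima of
   [ut - phi - theta (d _)] off [d <= 0] when [K] is large. *)
Lemma one_sided_subsolution phi G A X th : C1_gradient phi G A -> N X -> d X.1 = 0 ->
  (\forall Y \near X, 0 <= d Y.1 -> ut Y - phi Y <= ut X - phi X) -> 0 < th ->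
  exists2 q, q <= 0 & A X + Fp X.1 X.2 (G X + q *: nd X.1) <= - kap + th.
Proof.
move=> hp NX dX0 Hmax th0.
have M0 := set_M S; have del0 := set_del S; have kap0 := set_kap S.
(* Adding [sqd _ X] makes the maximum at [X] strict without changing [G X] or [A X]. *)
have hp1 := C1_gradientD hp (C1_gradient_sqd X).
set phi1 := fun Y => phi Y + sqd Y X in hp1.
set G1 := fun Y => G Y + 2 *: (Y.1 - X.1) in hp1.
set A1 := fun Y => A Y + 2 * (Y.2 - X.2) in hp1.
have [_ cG1 cA1] := hp1.
have G1X : G1 X = G X by rewrite /G1 subrr scaler0 addr0.
have A1X : A1 X = A X by rewrite /A1 subrr mulr0 addr0.
have [K [cK nK KW]] := compact_nbhs (filterI (set_nbhs S NX) Hmax).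
have KX := nbhs_singleton nK.
(* [del * K0] exceeds, by at least one, what coercivity and a subsolution inequality near [X] allow
   for [del] times a slope. *)
pose K0 := (M * (enorm (G X) + 2) + `|A X| + 2) / del.
have K00 : 0 < K0.
  rewrite /K0 divr_gt0//; have := enorm_ge0 (G X); have := normr_ge0 (A X).
  have := mulr_ge0 M0 (addr_ge0 (enorm_ge0 (G X)) (ler0n R 2)); lra.
have near_G : \forall Y \near X, enorm (G1 Y - G1 X) < 1.
  apply: (@continuous_near_lt _ _ (fun Y => enorm (G1 Y - G1 X))).
    by apply: continuous_enormB; [exact: cG1|exact: cst_continuous].
  by rewrite subrr enorm0.
have near_A : \forall Y \near X, `|A1 Y - A1 X| < Num.min 1 (th / 4).
  apply: (@continuous_near_lt _ _ (fun Y => `|A1 Y - A1 X|)).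
    apply: (@continuous_comp _ _ _ (fun Y => A1 Y - A1 X) Num.norm); last exact: norm_continuous.
    by apply: continuousB; [exact: cA1|exact: cst_continuous].
  by rewrite subrr normr0 lt_min ltr01 divr_gt0.
have near_F : \forall Y \near X,
    M * (enorm (G1 X - G1 Y) + K0 * enorm (nd X.1 - nd Y.1)) < th / 4.
  apply: (@continuous_near_lt _ _ (fun Y => M * (enorm (G1 X - G1 Y) + K0 * enorm (nd X.1 - nd Y.1)))).
    apply: continuousM; first exact: cst_continuous.
    apply: continuousD; first by apply: continuous_enormB; [exact: cst_continuous|exact: cG1].
    apply: continuousM; first exact: cst_continuous.
    by apply: continuous_enormB; [exact: cst_continuous|exact: nd_continuous].
  by rewrite !subrr enorm0 mulr0 addr0 mulr0 divr_gt0.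
have near_P : \forall Y \near X, M * pdist Y X * (enorm (G X) + K0 * M) < th / 4.
  apply: (@continuous_near_lt _ _ (fun Y => M * pdist Y X * (enorm (G X) + K0 * M))).
    apply: continuousM; last exact: cst_continuous.
    by apply: continuousM; [exact: cst_continuous|exact: pdist_continuous].
  by rewrite pdistxx mulr0 mul0r divr_gt0.
have near_m : \forall Y \near X, ml (pdist X Y) <= th / 4 by apply: near_ml; rewrite divr_gt0.
have hN := nbhs_setI (nbhs_setI nK near_G)
  (nbhs_setI (nbhs_setI near_A near_F) (nbhs_setI near_P near_m)).
have hN' := nbhs_interior hN.
pose Phi (c : R) Y := ut Y - phi1 Y - K0 * c / 2 * sqp (1 / c - d Y.1).
have uscf : usc_in K (fun Y => ut Y - phi1 Y).
  apply: usc_inD; first by apply: usc_inS (set_usc S) => Y /KW[].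
  apply: continuous_usc_in => Y _; apply: continuousN.
  by case: hp1 => h _ _; exact: is_diff_continuous (h Y).
have PhiX c : 0 < c -> Phi c X = ut X - phi1 X - K0 / (2 * c).
  move=> c0; rewrite /Phi dX0 subr0 sqp_pos ?divr_ge0 ?(ltW c0)//; congr (_ - _).
  by field; rewrite gt_eqF.
(* A competitor with [d Y >= 0] loses by the strict maximum once the penalty [K0 / (2 c)] at [X] is
   small; one with [d Y < 0] loses by its own penalty, of order at least [c]. *)
have Hloc : forall Y, K Y -> Y <> X ->
    \forall Z \near Y & c \near +oo, K Z -> Phi c Z < Phi c X.
  move=> Y KY YX.
  have [dY|dY] := leP 0 (d Y.1).
    have fY : ut Y - phi1 Y < ut X - phi1 X.
      rewrite /phi1 sqdxx addr0; have [_ /(_ dY)] := KW _ KY.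
      have : 0 < sqd Y X by rewrite lt_def sqd_ge0 andbT; apply/eqP => /sqd_eq0.
      lra.
    pose m := (ut X - phi1 X + (ut Y - phi1 Y)) / 2.
    have fm : ut Y - phi1 Y < m by rewrite /m; lra.
    have := uscf Y KY _ fm; rewrite near_withinE => H.
    pose c0 := K0 / (ut X - phi1 X - m).
    exists ([set Z | K Z -> ut Z - phi1 Z < m], [set c | Num.max 0 c0 < c]) => /=.
      by split=> //; exact: nbhs_pinfty_gt (num_real _).
    move=> [Z c] /= [HZ]; rewrite gt_max => /andP[cp cc] KZ; rewrite PhiX//.
    have s0 : 0 <= K0 * c / 2 * sqp (1 / c - d Z.1).
      by rewrite mulr_ge0 ?sqp_ge0// divr_ge0// mulr_ge0 ?ltW.
    have : K0 / (2 * c) < ut X - phi1 X - m.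
      rewrite ltr_pdivrMr ?mulr_gt0//.
      have mp : 0 < ut X - phi1 X - m by rewrite /m; lra.
      move: cc; rewrite /c0 ltr_pdivrMr//; nra.
    have := HZ KZ; rewrite /Phi; lra.
  have f1 : ut Y - phi1 Y < ut Y - phi1 Y + 1 by rewrite ltrDl.
  have := uscf Y KY _ f1; rewrite near_withinE => H.
  have nd2 : \forall Z \near Y, d Z.1 < d Y.1 / 2.
    by apply: (continuous_near_lt (@d_continuous Y)); lra.
  pose B := ut Y - phi1 Y + 1 - (ut X - phi1 X) + K0.
  pose s := - d Y.1 / 2.
  have sp : 0 < s by rewrite /s; lra.
  pose c0 := 2 * `|B| / (K0 * s ^+ 2).
  exists ([set Z | (K Z -> ut Z - phi1 Z < ut Y - phi1 Y + 1) /\ d Z.1 < d Y.1 / 2],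
      [set c | Num.max 1 c0 < c]) => /=.
    by split; [exact: filterI|exact: nbhs_pinfty_gt (num_real _)].
  move=> [Z c] /= [[HZ dZ]]; rewrite gt_max => /andP[c1 cc] KZ.
  have cp : 0 < c by lra.
  rewrite PhiX// /Phi.
  have s2 : s ^+ 2 <= sqp (1 / c - d Z.1).
    rewrite -(sqp_pos (ltW sp)); apply: sqp_homo.
    have : 0 <= 1 / c by rewrite divr_ge0// ltW.
    by rewrite /s; lra.
  have : K0 / (2 * c) <= K0.
    by rewrite ler_pdivrMr ?mulr_gt0// ler_peMr ?ltW//; lra.
  have : `|B| < K0 * c / 2 * s ^+ 2.
    have Ks : 0 < K0 * s ^+ 2 by rewrite mulr_gt0// exprn_gt0.
    move: cc; rewrite /c0 (ltr_pdivrMr _ _ Ks).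
    by move: (s ^+ 2) => w; lra.
  have : K0 * c / 2 * s ^+ 2 <= K0 * c / 2 * sqp (1 / c - d Z.1).
    by rewrite ler_wpM2l// divr_ge0// mulr_ge0 ?ltW.
  have := ler_norm B; have := HZ KZ; rewrite /B; lra.
have := @argmax_near _ _ R +oo Phi K _ X _ cK hN' Hloc => /(_ _) Hc.
have [c [c0 {}Hc]] : exists c, 0 < c /\ forall z, K z -> Phi c X <= Phi c z -> _ :=
  filter_ex (filterI (nbhs_pinfty_gt (num_real (0 : R))) Hc).
have uscP : usc_in K (Phi c).
  apply: usc_inD => //; apply: continuous_usc_in => Y _; apply: continuousN.
  apply: continuousM; first exact: cst_continuous.
  apply: (@continuous_comp _ _ _ (fun Y : E * R => 1 / c - d Y.1) sqp); last exact: continuous_sqp.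
  by apply: continuousB; [exact: cst_continuous|exact: d_continuous].
have [Z KZ HZ] := compact_usc_max cK (ex_intro _ X KX) uscP.
have iZ := Hc Z KZ (HZ X KX).
have [[nKZ gZ] [[aZ fZ] [pZ mZ]]] := interior_subset iZ.
have [NZ _] := KW _ nKZ.
pose al := - (K0 * c * Num.max (1 / c - d Z.1) 0).
have Kc0 : 0 <= K0 * c by rewrite mulr_ge0// ltW.
have mx0 : 0 <= Num.max (1 / c - d Z.1) 0 by rewrite le_max lexx orbT.
have alE : al <= 0 by rewrite /al oppr_le0 mulr_ge0.
have testZ : \forall Y \near Z, ut Y - phi1 Y -
   (al * (d Y.1 - d Z.1) + K0 * c / 2 * (d Y.1 - d Z.1) ^+ 2) <= ut Z - phi1 Z.
  apply: filterS (iZ : nbhs Z _) => Y [[KY _] _].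
  have := HZ Y KY; rewrite /Phi /al.
  have := sqp_tangent_le (1 / c - d Z.1) (d Z.1 - d Y.1).
  have := sqp_le_tangent (1 / c - d Z.1) (d Z.1 - d Y.1).
  rewrite (_ : 1 / c - d Z.1 + _ = 1 / c - d Y.1); last by ring.
  set a := sqp _; set b := sqp _; set m := Num.max _ _ => H1 _ H2.
  have H3 := ler_wpM2l (ltW (divr_gt0 (mulr_gt0 K00 c0) (ltr0n R 2))) H1.
  lra.
have enZ : enorm (G1 Z) <= enorm (G X) + 1.
  have -> : G1 Z = (G1 Z - G1 X) + G X by rewrite G1X subrK.
  by have := enormD (G1 Z - G1 X) (G X); rewrite G1X in gZ *; lra.
move: aZ; rewrite lt_min => /andP[aZ aZ']; rewrite A1X in aZ aZ'.
(* At a maximizer with [d Z <= 0] the slope satisfies [|al| >= K0], which coercivity forbids; at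
   [d Z = 0] this applies to whichever Hamiltonian realizes the minimum. *)
have coer D' F : ham_on D' nd M del ml F -> D' Z -> d Z.1 <= 0 ->
    A1 Z + F Z.1 Z.2 (G1 Z + al *: nd Z.1) <= - kap -> False.
  move=> hF DZ dZ H.
  have := ham_coer hF (G1 Z) al DZ.
  have alK : K0 <= `|al|.
    rewrite /al normrN max_l; last first.
      by rewrite subr_ge0 (le_trans dZ)// divr_ge0// ltW.
    apply: le_trans (ler_norm _).
    have : K0 * c * (1 / c - d Z.1) = K0 - K0 * c * d Z.1 by field; rewrite gt_eqF.
    have : K0 * c * d Z.1 <= 0 by rewrite mulr_ge0_le0// mulr_ge0// ltW.
    lra.
  have : del * K0 <= del * `|al| by rewrite ler_wpM2l// ltW.
  rewrite /K0 mulrC divfK ?gt_eqF//.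
  have : M * (enorm (G1 Z) + 1) <= M * (enorm (G X) + 2) by rewrite ler_wpM2l//; lra.
  move: aZ; rewrite ltr_norml => /andP[aZ _].
  have := ler_norm (- A X); rewrite normrN; lra.
have [dZ|dZ|dZ] := ltgtP (d Z.1) 0; last first.
- exfalso; have := sub_d_0 hp1 NZ dZ testZ.
  rewrite minElt; case: ifP => _ H.
    apply: (coer _ _ (set_Fp S) _ _ H); last by rewrite dZ.
    by split=> //=; rewrite dZ.
  apply: (coer _ _ (set_Fm S) _ _ H); last by rewrite dZ.
  by split=> //=; rewrite dZ.
- have H := sub_d_p hp1 NZ dZ testZ.
  have DZ : (N `&` [set X | 0 <= d X.1]) Z by split=> //=; exact: ltW.
  have DX : (N `&` [set X | 0 <= d X.1]) X by split=> //=; rewrite dX0.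
  (* For [d Z > 0] the penalty slope is at most [K0 * c * (1 / c)]. The bound does not depend on
     [c], so moving the inequality from [Z] to [X] costs at most four errors of size [th / 4]. *)
  have alK : `|al| <= K0.
    rewrite /al normrN (ger0_norm (mulr_ge0 Kc0 mx0)).
    rewrite -mulrA ler_piMr ?(ltW K00)// -ler_pdivlMl// mulr1 ge_max div1r.
    by rewrite invr_ge0 (ltW c0) andbT; lra.
  exists al => //.
  have h1 := ham_mod (set_Fp S) (G X + al *: nd X.1) DX DZ.
  have h2 := ham_lip (set_Fp S) (G X + al *: nd X.1) (G1 Z + al *: nd Z.1) DZ.
  have e1 : enorm (G X + al *: nd X.1) <= enorm (G X) + K0 * M.
    apply: le_trans (enormD _ _) _; rewrite lerD2l enormZ.
    by apply: ler_pM => //; [exact: enorm_ge0|exact: (set_nd_le S NX)].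
  have e2 : enorm (G X + al *: nd X.1 - (G1 Z + al *: nd Z.1))
      <= enorm (G1 X - G1 Z) + K0 * enorm (nd X.1 - nd Z.1).
    have -> : G X + al *: nd X.1 - (G1 Z + al *: nd Z.1)
        = (G1 X - G1 Z) + al *: (nd X.1 - nd Z.1).
      by rewrite G1X; apply/rowP => i; rewrite !mxE; ring.
    apply: le_trans (enormD _ _) _; rewrite lerD2l enormZ.
    by rewrite ler_wpM2r ?enorm_ge0.
  have := ler_wpM2l M0 e2.
  have : M * pdist X Z * enorm (G X + al *: nd X.1) <= M * pdist Z X * (enorm (G X) + K0 * M).
    by rewrite pdistC ler_wpM2l// mulr_ge0// pdist_ge0.
  move: aZ'; rewrite ltr_norml => /andP[aZ' _]; lra.
- exfalso; have hp1' := hp1.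
  have := C1_gradient_add_d al (K0 * c / 2) (d Z.1) (set_d S) hp1 => hp2.
  have := set_subm S hp2 NZ dZ; rewrite subrr !mulr0 addr0.
  have tZ : \forall Y \near Z, ut Y - (phi1 Y + (al * (d Y.1 - d Z.1) + K0 * c / 2 * (d Y.1 - d Z.1) ^+ 2)) <= ut Z - (phi1 Z + (0 + K0 * c / 2 * 0 ^+ 2)).
    by apply: filterS testZ => Y; rewrite expr0n/= mulr0; lra.
  move=> /(_ tZ) H; apply: (coer _ _ (set_Fm S) _ _ H); last exact: ltW.
  by split=> //=; exact: ltW.
Qed.

End one_sided.

(** * Doubling of variables at the interface *)

Section doubling.
Context {R : realType} {n : nat}.
Local Notation E := 'rV[R]_n.+1.
Implicit Types (X Y : E * R) (N W : set (E * R)).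

(** * Contradiction at a maximum point of the doubled functional *)

Section maximum_point.
Context {N : set (E * R)} {ut v : E * R -> R} {kap M del : R} {ml : R -> R}
  {d : E -> R} {nd : E -> E} {Fp Fm : E -> R -> E -> R}.
Hypothesis S : setting N ut v kap M del ml d nd Fp Fm.
Variables (phi1 phi2 A1 A2 : E * R -> R) (G1 G2 : E * R -> E) (X1 X2 : E * R).
Variables (p e1 e2 : E) (a a1 a2 q c eta P0 : R).
Hypotheses (hp1 : C1_gradient phi1 G1 A1) (hp2 : C1_gradient phi2 G2 A2).
Hypotheses (NX1 : N X1) (NX2 : N X2) (c0 : 0 < c).
Hypothesis max1 : \forall Y \near X1, ut Y - phi1 Y - q * (d Y.1 - d X1.1)
  - c * (gg (d Y.1) (d X2.1) - gg (d X1.1) (d X2.1)) <= ut X1 - phi1 X1.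
Hypothesis max2 : \forall Y \near X2, v X2 - phi2 X2 <= v Y - phi2 Y
  - q * (d Y.1 - d X2.1) + c * (gg (d X1.1) (d Y.1) - gg (d X1.1) (d X2.1)).
Hypotheses (G1E : G1 X1 = p + e1) (A1E : A1 X1 = a + a1).
Hypotheses (G2E : G2 X2 = p + e2) (A2E : A2 X2 = a + a2).
Hypotheses (eta1 : eta <= 1) (eta_kap : estimate_const M del * eta < kap / 2).
Hypotheses (h1 : pdist X1 X2 <= eta) (h2 : pdist X1 X2 * enorm p <= eta)
  (h3 : pdist X1 X2 * `|a| <= eta) (h4 : ml (pdist X1 X2) <= eta)
  (h5 : enorm e1 <= eta) (h6 : enorm e2 <= eta)
  (h7 : `|a1| <= eta) (h8 : `|a2| <= eta).

Lemma maximum_point_estimate D F q1 q2 : ham_on D nd M del ml F ->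
  D X1 -> D X2 -> D `<=` N -> `|q1 - q2| <= eta ->
  a + a1 + F X1.1 X1.2 (p + e1 + q1 *: nd X1.1) <= - (kap / 2) ->
  0 <= a + a2 + F X2.1 X2.2 (p + e2 + q2 *: nd X2.1) -> False.
Proof.
move=> hF D1 D2 DN q12 hu hv; move: eta_kap; rewrite ltNge => /negP; apply.
have k2 : 0 <= kap / 2 by rewrite divr_ge0// ltW// (set_kap S).
exact: (doubling_estimate hF (set_M S) (set_del S) k2 D1 D2 DN (set_nd_le S)
  (set_nd_lip S) eta1 h1 h2 h3 h4 h5 h6 h7 h8 q12 hu hv).
Qed.

(** The penalty [gg 0 _] has zero slope at 0, so [v] has the slope [q], for a Hamiltonian that
    cannot be chosen; [u] satisfies its inequality with slope [q] for both. *)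
Lemma maximum_point_corner : d X1.1 = 0 -> d X2.1 = 0 ->
  a + a1 + Fp X1.1 X1.2 (p + e1 + q *: nd X1.1) <= - (kap / 2) ->
  a + a1 + Fm X1.1 X1.2 (p + e1 + q *: nd X1.1) <= - (kap / 2) -> False.
Proof.
move=> d1 d2 up um.
have q0 : `|q - q| <= eta by rewrite subrr normr0 (le_trans (pdist_ge0 X1 X2)).
have := @sup_d_0 _ _ _ _ _ _ _ _ _ _ _ _ _ S phi2 G2 A2 q (- c) X2 hp2 NX2 d2.
rewrite G2E A2E => /(_ _) H.
have {H} : 0 <= a + a2 + Num.max (Fp X2.1 X2.2 (p + e2 + q *: nd X2.1))
    (Fm X2.1 X2.2 (p + e2 + q *: nd X2.1)).
  by apply: H; apply: filterS max2 => Y; rewrite d1 d2 !gg0; lra.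
rewrite maxElt; case: ifP => _ vv.
  apply: (maximum_point_estimate (set_Fm S) _ _ _ q0 um vv); last exact: subIsetl.
    by split=> //=; rewrite d1.
  by split=> //=; rewrite d2.
apply: (maximum_point_estimate (set_Fp S) _ _ _ q0 up vv); last exact: subIsetl.
  by split=> //=; rewrite d1.
by split=> //=; rewrite d2.
Qed.

Hypotheses (pP : enorm p <= P0) (aP : `|a| <= P0).
(** Coercivity bound for the normal slope of [u] at [X1] when [|p|] and [|a|] are at most [P0]. The
    next two hypotheses exclude the slope [q + c] and make [(|q| + B0) ^+ 2 / c] at most [eta]. *)
Let B0 := (M * (P0 + 2) + P0 + 1) / del.
Hypotheses (c1 : `|q| + B0 < c) (c2 : (`|q| + B0) ^+ 2 <= eta * c).

Lemma maximum_point_side :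
  (d X1.1 = 0 -> a + a1 + Fp X1.1 X1.2 (p + e1 + q *: nd X1.1) <= - (kap / 2)) ->
  0 < d X1.1 \/ (d X1.1 = 0 /\ 0 < d X2.1) -> False.
Proof.
move=> ustar; have M0 := set_M S; have del0 := set_del S; have kap0 := set_kap S.
have eta0 : 0 <= eta by apply: le_trans h1; exact: pdist_ge0.
case=> [d1|[d1 d2]].
  set s1 := d X1.1 in d1 *; set s2 := d X2.1.
  have D1 : (N `&` [set X | 0 <= d X.1]) X1 by split=> //=; exact: ltW.
  have hu : a + a1 + Fp X1.1 X1.2 (p + e1 + (q + c * gp_ds s1 s2) *: nd X1.1) <= - kap.
    rewrite -G1E -A1E.
    apply: (@sub_d_p _ _ _ _ _ _ _ _ _ _ _ _ _ S phi1 G1 A1 _ (c * (1 + 2 / s1))) => //.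
    (* [gp_tangent_s] is stated for [d Y >= s1 / 2], which holds near [X1]. *)
    have s12 : s1 / 2 < d X1.1 by rewrite -/s1; lra.
    have ds := continuous_near_gt (d_continuous S (X := X1)) s12.
    apply: filterS2 max1 ds => Y; rewrite -/s1 -/s2 => H dY.
    have dY0 : 0 <= d Y.1 by lra.
    have := gp_tangent_s s2 d1 (ltW dY).
    move: H; rewrite /gg dY0 (ltW d1) => H H'.
    have := ler_wpM2l (ltW c0) H'; lra.
  have q1B : `|q + c * gp_ds s1 s2| <= B0.
    rewrite /B0 ler_pdivlMr// mulrC.
    have := ham_coer (set_Fp S) (p + e1) (q + c * gp_ds s1 s2) D1; rewrite -/s1.
    have := enormD p e1.
    have : M * (enorm (p + e1) + 1) <= M * (P0 + 2).
      by rewrite ler_wpM2l//; move: (enormD p e1) h5 pP eta1; lra.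
    move: h7 aP eta1 hu kap0; rewrite !ler_norml => /andP[? ?] /andP[? ?]; lra.
  (* With [X2] on the opposite side or on the interface, [gp_ds = 1] and the slope [q + c] violates
     [q1B]. *)
  have [d2|d2] := leP s2 0.
    move: q1B; rewrite gp_ds_nonpos// mulr1 ler_norml => /andP[_ H].
    by move: (ler_norm (- q)) c1; rewrite normrN; lra.
  have D2 : (N `&` [set X | 0 <= d X.1]) X2 by split=> //=; exact: ltW.
  have hv : 0 <= a + a2 + Fp X2.1 X2.2 (p + e2 + (q + c * gp_dt s1 s2) *: nd X2.1).
    rewrite -G2E -A2E.
    apply: (@sup_d_p _ _ _ _ _ _ _ _ _ _ _ _ _ S phi2 G2 A2 _ (- (c * (1 + 1 / s1)))) => //.
    have dt := continuous_near_gt (d_continuous S (X := X2)) d2.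
    apply: filterS2 max2 dt => Y; rewrite -/s1 -/s2 => H dY.
    have := gp_tangent_t d1 d2 dY.
    move: H; rewrite /gg (ltW d1) => H H'.
    have := ler_wpM2l (ltW c0) H'; lra.
  apply: (maximum_point_estimate (set_Fp S) D1 D2 _ _ _ hv); first exact: subIsetl.
    2: by apply: le_trans hu _; lra.
  have /andP[sl sl'] := gp_slopes s2 d1.
  have -> : q + c * gp_ds s1 s2 - (q + c * gp_dt s1 s2) = - (c * (gp_dt s1 s2 - gp_ds s1 s2)).
    by ring.
  rewrite normrN ger0_norm; last by rewrite mulr_ge0// ltW.
  set m := Num.max _ 0 in sl'.
  have m0 : 0 <= m by rewrite /m le_max lexx orbT.
  (* A consequence of [|q + c gp_ds| <= B0]; by [gp_slopes] the slopes of [u] and [v] then differ by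
     at most [(c m) ^+ 2 / c <= eta]. *)
  have cm : c * m <= `|q| + B0.
    have B0p : 0 <= B0 by exact: le_trans q1B.
    rewrite /m; case: (leP (gp_ds s1 s2) 0) => _; first by rewrite mulr0 addr_ge0.
    move: q1B; rewrite ler_norml => /andP[_ H].
    by have := ler_norm (- q); rewrite normrN; lra.
  apply: le_trans (ler_wpM2l (ltW c0) sl') _.
  rewrite -(ler_pM2l c0) (mulrC c eta); apply: le_trans c2.
  rewrite (_ : c * (c * m ^+ 2) = (c * m) ^+ 2); last by ring.
  by rewrite ler_pXn2r// nnegrE ?(le_trans _ cm)// mulr_ge0// ltW.
set s2 := d X2.1 in d2 *.
have D1 : (N `&` [set X | 0 <= d X.1]) X1 by split=> //=; rewrite d1.
have D2 : (N `&` [set X | 0 <= d X.1]) X2 by split=> //=; exact: ltW.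
have hv : 0 <= a + a2 + Fp X2.1 X2.2 (p + e2 + (q - 2 * c * s2) *: nd X2.1).
  rewrite -G2E -A2E; apply: (@sup_d_p _ _ _ _ _ _ _ _ _ _ _ _ _ S phi2 G2 A2 _ (- c)) => //.
  by apply: filterS max2 => Y; rewrite -/s2 d1 !gg0; lra.
(* The test function carries the slope of [v], namely [q - 2 c s2]. On [0 <= d Y < s2] the penalty
   is exactly [(s2 - d Y) ^+ 2], so [X1] is a maximum from the side [d >= 0]. *)
have hp3 := C1_gradient_add_d (q - 2 * c * s2) c 0 (set_d S) hp1.
have th0 : 0 < kap / 2 by rewrite divr_gt0.
have max1' : \forall Y \near X1, 0 <= d Y.1 ->
    ut Y - (phi1 Y + ((q - 2 * c * s2) * (d Y.1 - 0) + c * (d Y.1 - 0) ^+ 2))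
    <= ut X1 - (phi1 X1 + ((q - 2 * c * s2) * (d X1.1 - 0) + c * (d X1.1 - 0) ^+ 2)).
  have d12 : d X1.1 < s2 by rewrite d1.
  have ds := continuous_near_lt (d_continuous S (X := X1)) d12.
  apply: filterS2 max1 ds => Y; rewrite -/s2 d1 => H dY dY0.
  move: H; rewrite gg0 gg_small ?dY0 ?(ltW dY)//; lra.
have [q' q'0] := one_sided_subsolution S hp3 NX1 d1 max1' th0.
rewrite (_ : _ + q' *: _ = p + e1 + (q - 2 * c * s2 + q') *: nd X1.1); last first.
  by rewrite d1 subrr mulr0 addr0 G1E -addrA -scalerDl.
rewrite A1E => hq'.
apply: (@maximum_point_estimate _ _ (q - 2 * c * s2) _ (set_Fp S) D1 D2 _ _ _ hv).
- exact: subIsetl.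
- by rewrite subrr normr0.
(* The slope of [v] lies between the one-sided slope, lower by [- q' >= 0], and [q], higher by
   [2 c s2 >= 0]. Both are available for [u], and quasiconvexity gives the inequality in between. *)
have := @ham_qconv _ _ _ _ _ _ _ _ (set_Fp S) X1 (p + e1) (nd X1.1)
  (q - 2 * c * s2 + q') (q - 2 * c * s2) q (- (kap / 2) - (a + a1)) D1.
have cs : 0 <= 2 * c * s2 by rewrite !mulr_ge0// ltW.
have := ustar d1; move: hq'; set f1 := Fp _ _ _; set f2 := Fp _ _ _; set f3 := Fp _ _ _.
move=> H1 H2 /(_ _ _ _); have -> : q - 2 * c * s2 + q' <= q - 2 * c * s2 <= q.
  by apply/andP; split; lra.
move=> /(_ isT); have : f1 <= - (kap / 2) - (a + a1) by lra.
move=> -> /(_ isT); have : f2 <= - (kap / 2) - (a + a1) by lra.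
by move=> -> /(_ isT); lra.
Qed.

End maximum_point.

Lemma sqd_continuous (T : topologicalType) (f g : T -> E * R) t :
  {for t, continuous f} -> {for t, continuous g} ->
  {for t, continuous (fun t => sqd (f t) (g t))}.
Proof.
move=> cf cg.
have c1 := continuousB (continuous_fst_comp cf) (continuous_fst_comp cg).
have c2 := continuousB (continuous_snd_comp cf) (continuous_snd_comp cg).
apply: continuousD; first exact: (cvg_dotp c1 c1).
exact: (continuousM c2 c2).
Qed.

(** The constraint set [d X1 = d X2] is closed, so maxima on it exist; [sqd _ Xb] makes [Xb] the
    only limit point as [k] grows. For constant [d] the constraint is void and this is plain
    doubling. *)
Lemma doubling_maximizers (ut v : E * R -> R) (d : E * R -> R) K W Xb (e : R) :
  compact K -> nbhs Xb K -> usc_in K ut -> usc_in K (fun X => - v X) ->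
  continuous d -> (forall X, K X -> ut X - v X <= ut Xb - v Xb) ->
  nbhs Xb W -> 0 < e ->
  exists k X1 X2, [/\ 0 < k, [/\ K X1, K X2, W X1, W X2 & d X1 = d X2], k * sqd X1 X2 < e &
    forall Y1 Y2, K Y1 -> K Y2 -> d Y1 = d Y2 ->
      ut Y1 - v Y2 - k * sqd Y1 Y2 - sqd Y1 Xb <= ut X1 - v X2 - k * sqd X1 X2 - sqd X1 Xb].
Proof.
move=> cK nK uut uv cd Hmax nW e0.
have c1 := @continuous_fst (E * R)%type (E * R)%type.
have c2 := @continuous_snd (E * R)%type (E * R)%type.
pose Z := [set z : (E * R) * (E * R) | d z.1 - d z.2 = 0].
have clZ : closed Z.
  apply: (@closed_comp _ _ (fun z : (E * R) * (E * R) => d z.1 - d z.2) [set 0]).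
    move=> z _; apply: continuousB.
      exact: (@continuous_comp _ _ _ _ d z (c1 z) (cd z.1)).
    exact: (@continuous_comp _ _ _ _ d z (c2 z) (cd z.2)).
  exact: closed_eq.
pose K2 := (K `*` K) `&` Z.
have cK2 : compact K2 by apply: compact_closedI => //; exact: compact_setX.
pose f (z : (E * R) * (E * R)) := ut z.1 - v z.2 - sqd z.1 Xb.
pose g (z : (E * R) * (E * R)) := sqd z.1 z.2.
have KXb := nbhs_singleton nK.
have K2b : K2 (Xb, Xb) by split=> //; rewrite /Z /= subrr.
have uf : usc_in K2 f.
  apply: usc_inD; first apply: usc_inD.
  - by apply: usc_in_comp uut => // z [[]].
  - by apply: (@usc_in_comp _ _ _ K _ (fun X => - v X)) => // z [[]].
  - apply: continuous_usc_in => z _; apply: continuousN; apply: sqd_continuous; first exact: c1.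
    exact: cst_continuous.
have cg : continuous g by move=> z; apply: sqd_continuous; [exact: c1|exact: c2].
have ug : usc_in K2 (fun z => - g z).
  by apply: continuous_usc_in => z _; apply: continuousN; exact: cg.
have gb : g (Xb, Xb) = 0 by rewrite /g sqdxx.
have fb z : K2 z -> g z = 0 -> z <> (Xb, Xb) -> f z < f (Xb, Xb).
  case: z => X Y [[/= KX _] _] /sqd_eq0 /= <- XX; rewrite /f /= sqdxx.
  have : 0 < sqd X Xb.
    by rewrite lt_def sqd_ge0 andbT; apply/eqP => /sqd_eq0 XXb; apply: XX; rewrite XXb.
  by have := Hmax X KX; lra.
have nW2 : nbhs (Xb, Xb) (W `*` W) by exists (W, W).
have H := penalization cK2 uf ug (fun z _ => sqd_ge0 _ _) K2b gb fb nW2 e0.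
have [k [k0 Hk]] := filter_ex (filterI (nbhs_pinfty_gt (num_real (0 : R))) H).
have uk : usc_in K2 (fun z => f z - k * g z).
  apply: usc_inD => //; apply: continuous_usc_in => z _; apply: continuousN.
  by apply: continuousM; [exact: cst_continuous|exact: cg].
have [[X1 X2] K12 mx] := compact_usc_max cK2 (ex_intro _ _ K2b) uk.
have [|[W1 W2] ke] := Hk _ K12.
  by have := mx _ K2b; rewrite gb mulr0 subr0.
have [[/= K1 K2'] /eqP] := K12; rewrite subr_eq0 => /eqP d12.
exists k, X1, X2; split=> // Y1 Y2 KY1 KY2 dY.
have KY : K2 (Y1, Y2) by split=> //; rewrite /Z /= dY subrr.
by have := mx _ KY; rewrite /f /g /=; lra.
Qed.

(** Carries the inequalities with slope [q] from the constrained maximum to later maxima: the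
    momentum varies under [ham_lip], the point under [ham_mod]. *)
Lemma ham_near (T : topologicalType) D nd M del ml F (f : T -> E * R) (P : T -> E) t (e : R) :
  ham_on D nd M del ml F -> 0 <= M ->
  (forall e, 0 < e -> exists2 r : R, 0 < r & forall x, 0 <= x < r -> ml x <= e) ->
  {for t, continuous f} -> {for t, continuous P} -> D (f t) -> 0 < e ->
  \forall s \near t, D (f s) -> F (f s).1 (f s).2 (P s) <= F (f t).1 (f t).2 (P t) + e.
Proof.
move=> hF M0 hml cf cP Dt e0.
have e4 : 0 < e / 4 by rewrite divr_gt0.
have [r r0 hr] := hml _ e4.
have cd : {for t, continuous (fun s => pdist (f s) (f t))}.
  exact: (@continuous_comp _ _ _ f (fun Y => pdist Y (f t)) t cf (@pdist_continuous R n (f t) (f t))).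
have H1 : \forall s \near t, pdist (f s) (f t) < r.
  by apply: (continuous_near_lt cd); rewrite pdistxx.
have H2 : \forall s \near t, M * pdist (f s) (f t) * enorm (P t) < e / 4.
  apply: (@continuous_near_lt _ _ (fun s => M * pdist (f s) (f t) * enorm (P t))).
    apply: continuousM; last exact: cst_continuous.
    by apply: continuousM => //; exact: cst_continuous.
  by rewrite pdistxx mulr0 mul0r.
have H3 : \forall s \near t, M * enorm (P s - P t) < e / 4.
  apply: (@continuous_near_lt _ _ (fun s => M * enorm (P s - P t))).
    apply: continuousM; first exact: cst_continuous.
    have : {for t, continuous (fun s => P s - P t)} by apply: continuousB => //; exact: cst_continuous.
    exact: cvg_enorm.
  by rewrite subrr enorm0 mulr0.
apply: filterS3 H1 H2 H3 => s H1 H2 H3 Ds.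
have h1 := ham_lip hF (P s) (P t) Ds.
have h2 := ham_mod hF (P t) Ds Dt.
have h3 : ml (pdist (f s) (f t)) <= e / 4 by apply: hr; rewrite pdist_ge0.
lra.
Qed.

End doubling.

(** * Choice of the parameters and exclusion of a maximum *)

Section no_maximum.
Context {R : realType} {n : nat}.
Local Notation E := 'rV[R]_n.+1.
Implicit Types (X Y : E * R) (N W : set (E * R)).

(** The bounds by [eta / 16] give [|X1 - X2| <= eta / 8] and [k |X1 - X2| ^+ 2 <= eta / 8]. So [|p|]
    and [|a|] are at most [k eta / 4], which is taken for [P0], and their products with [|X1 - X2|]
    are at most [eta / 4]. *)
Lemma setting_doubling_step N ut v kap M del ml (d : E -> R) nd Fp Fm k eta
    (Xb B1 B2 X1 X2 : E * R) (q c : R) :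
  setting N ut v kap M del ml d nd Fp Fm ->
  let p := (2 * k) *: (X1.1 - X2.1) in
  let e1 := 2 *: (X1.1 - Xb.1) + 2 *: (X1.1 - B1.1) in
  let a := 2 * k * (X1.2 - X2.2) in
  let a1 := 2 * (X1.2 - Xb.2) + 2 * (X1.2 - B1.2) in
  let Phi Y1 Y2 := ut Y1 - v Y2 - k * sqd Y1 Y2 - sqd Y1 Xb - sqd Y1 B1 - sqd Y2 B2
    - q * (d Y1.1 - d Y2.1) - c * gg (d Y1.1) (d Y2.1) in
  N X1 -> N X2 -> 0 < k -> 0 < c -> 0 <= eta <= 1 ->
  (\forall Y \near X1, Phi Y X2 <= Phi X1 X2) ->
  (\forall Y \near X2, Phi X1 Y <= Phi X1 X2) ->
  estimate_const M del * eta < kap / 2 ->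
  pdist X1 Xb <= eta / 16 -> pdist X2 Xb <= eta / 16 ->
  pdist X1 B1 <= eta / 16 -> pdist X2 B2 <= eta / 16 -> k * sqd X1 X2 <= eta / 16 ->
  ml (pdist X1 X2) <= eta ->
  `|q| + (M * (k * eta / 4 + 2) + k * eta / 4 + 1) / del < c ->
  (`|q| + (M * (k * eta / 4 + 2) + k * eta / 4 + 1) / del) ^+ 2 <= eta * c ->
  (d X1.1 = 0 ->
     a + a1 + Fp X1.1 X1.2 (p + e1 + q *: nd X1.1) <= - (kap / 2) /\
     a + a1 + Fm X1.1 X1.2 (p + e1 + q *: nd X1.1) <= - (kap / 2)) ->
  False.
Proof.
move=> S p e1 a a1 Phi NX1 NX2 k0 c0 /andP[eta0 eta1] max1 max2 eta_kap.
move=> b1 b2 bb1 bb2 ks hm c1 c2 ustar.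
pose e2 := - (2 *: (X2.1 - B2.1)); pose a2 := - (2 * (X2.2 - B2.2)).
pose phi1 Y := k * sqd Y X2 + (sqd Y Xb + sqd Y B1).
pose phi2 Y := - (k * sqd Y X1 + sqd Y B2).
have hp1 := C1_gradientD (C1_gradientZ k (C1_gradient_sqd X2))
  (C1_gradientD (C1_gradient_sqd Xb) (C1_gradient_sqd B1)).
have hp2 := C1_gradientN (C1_gradientD (C1_gradientZ k (C1_gradient_sqd X1)) (C1_gradient_sqd B2)).
have max1' : \forall Y \near X1, ut Y - phi1 Y - q * (d Y.1 - d X1.1)
    - c * (gg (d Y.1) (d X2.1) - gg (d X1.1) (d X2.1)) <= ut X1 - phi1 X1.
  by apply: filterS max1 => Y; rewrite /Phi /phi1; clear; lra.
have max2' : \forall Y \near X2, v X2 - phi2 X2 <= v Y - phi2 Y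
    - q * (d Y.1 - d X2.1) + c * (gg (d X1.1) (d Y.1) - gg (d X1.1) (d X2.1)).
  by apply: filterS max2 => Y; rewrite /Phi /phi2 (sqdC X1 Y) (sqdC X1 X2); clear; lra.
have G1E : k *: (2 *: (X1.1 - X2.1)) + (2 *: (X1.1 - Xb.1) + 2 *: (X1.1 - B1.1)) = p + e1.
  by rewrite /p /e1 scalerA (mulrC k).
have A1E : k * (2 * (X1.2 - X2.2)) + (2 * (X1.2 - Xb.2) + 2 * (X1.2 - B1.2)) = a + a1.
  by rewrite /a /a1; ring.
have G2E : - (k *: (2 *: (X2.1 - X1.1)) + 2 *: (X2.1 - B2.1)) = p + e2.
  by rewrite /p /e2 opprD scalerA -scalerN opprB (mulrC k).
have A2E : - (k * (2 * (X2.2 - X1.2)) + 2 * (X2.2 - B2.2)) = a + a2.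
  by rewrite /a /a2; ring.
have r0 := pdist_ge0 X1 X2.
have rle : pdist X1 X2 <= eta / 8.
  by have := pdist_triang X1 Xb X2; rewrite (pdistC Xb); move: b1 b2; clear; lra.
have r2 : k * pdist X1 X2 ^+ 2 <= eta / 8.
  have := ler_wpM2l (ltW k0) (sqr_pdist_le X1 X2); move: ks; clear; lra.
have pE : enorm p <= 2 * k * pdist X1 X2.
  rewrite /p enormZ ger0_norm ?mulr_ge0 ?(ltW k0)//.
  by rewrite ler_wpM2l ?enorm_le_pdist// mulr_ge0// ltW.
have aE : `|a| <= 2 * k * pdist X1 X2.
  rewrite /a normrM ger0_norm ?mulr_ge0 ?(ltW k0)//.
  by rewrite ler_wpM2l ?norm_le_pdist// mulr_ge0// ltW.
have kr : 2 * k * pdist X1 X2 <= k * eta / 4.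
  by have := ler_wpM2l (ltW k0) rle; clear; lra.
have hr : pdist X1 X2 * (2 * k * pdist X1 X2) <= eta by move: r2 eta0; clear; lra.
have h1 : pdist X1 X2 <= eta by move: rle eta0; clear; lra.
have h2 : pdist X1 X2 * enorm p <= eta by apply: le_trans hr; rewrite ler_wpM2l.
have h3 : pdist X1 X2 * `|a| <= eta by apply: le_trans hr; rewrite ler_wpM2l.
have n2 : `|2 : R| = 2 by rewrite ger0_norm.
have h5 : enorm e1 <= eta.
  apply: le_trans (enormD _ _) _; rewrite !enormZ n2.
  by have := enorm_le_pdist X1 Xb; have := enorm_le_pdist X1 B1; move: b1 bb1 eta0; clear; lra.
have h6 : enorm e2 <= eta.
  by rewrite enormN enormZ n2; have := enorm_le_pdist X2 B2; move: bb2 eta0; clear; lra.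
have h7 : `|a1| <= eta.
  apply: le_trans (ler_normD _ _) _; rewrite !normrM n2.
  by have := norm_le_pdist X1 Xb; have := norm_le_pdist X1 B1; move: b1 bb1 eta0; clear; lra.
have h8 : `|a2| <= eta.
  by rewrite normrN normrM n2; have := norm_le_pdist X2 B2; move: bb2 eta0; clear; lra.
have pP := le_trans pE kr; have aP := le_trans aE kr.
have sideP := maximum_point_side S hp1 hp2 NX1 NX2 c0 max1' max2' G1E A1E G2E A2E
  eta1 eta_kap h1 h2 h3 hm h5 h6 h7 h8 pP aP c1 c2 (fun d0 => proj1 (ustar d0)).
have S' := setting_flip S.
(* The flipped setting with slope [- q]; the penalty is invariant by [ggN]. *)
have sideM : d X1.1 < 0 \/ (d X1.1 = 0 /\ d X2.1 < 0) -> False.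
  have m1 : \forall Y \near X1, ut Y - phi1 Y - (- q) * (- d Y.1 - - d X1.1)
      - c * (gg (- d Y.1) (- d X2.1) - gg (- d X1.1) (- d X2.1)) <= ut X1 - phi1 X1.
    by apply: filterS max1' => Y; rewrite !ggN; clear; lra.
  have m2 : \forall Y \near X2, v X2 - phi2 X2 <= v Y - phi2 Y
      - (- q) * (- d Y.1 - - d X2.1) + c * (gg (- d X1.1) (- d Y.1) - gg (- d X1.1) (- d X2.1)).
    by apply: filterS max2' => Y; rewrite !ggN; clear; lra.
  have u1 : - d X1.1 = 0 -> a + a1 + Fm X1.1 X1.2 (p + e1 + - q *: - nd X1.1) <= - (kap / 2).
    by move/eqP; rewrite oppr_eq0 scaleNr scalerN opprK => /eqP /ustar[].
  rewrite -normrN in c1 c2.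
  have := maximum_point_side S' hp1 hp2 NX1 NX2 c0 m1 m2 G1E A1E G2E A2E
    eta1 eta_kap h1 h2 h3 hm h5 h6 h7 h8 pP aP c1 c2 u1.
  move=> H [dn|[d0 dn]]; apply: H; first by left; rewrite oppr_gt0.
  by right; rewrite d0 oppr0 oppr_gt0.
have [dn|dp|d0] := ltgtP (d X1.1) 0; [by apply: sideM; left|by apply: sideP; left|].
have [dn|dp|d0'] := ltgtP (d X2.1) 0; [by apply: sideM; right|by apply: sideP; right|].
have [up um] := ustar d0.
exact: (maximum_point_corner S hp2 NX1 NX2 max2' G2E A2E eta1 eta_kap h1 h2 h3 hm h5 h6 h7 h8
  d0 d0' up um).
Qed.

Lemma setting_no_max N ut v kap M del ml (d : E -> R) nd Fp Fm Xb :
  setting N ut v kap M del ml d nd Fp Fm -> N Xb ->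
  (\forall X \near Xb, ut X - v X <= ut Xb - v Xb) -> False.
Proof.
move=> S NXb Hmax; have M0 := set_M S; have del0 := set_del S; have kap0 := set_kap S.
have [K [cK nK KW]] := compact_nbhs (nbhs_setI (set_nbhs S NXb) Hmax).
have C0 := estimate_const_gt0 M0 del0; set C := estimate_const M del in C0.
(* This makes [C * eta <= kap / 4], strictly below the half margin [kap / 2] kept for the final
   estimate. *)
pose eta := Num.min 1 (kap / (4 * C)).
have eta0 : 0 < eta by rewrite lt_min ltr01 divr_gt0// mulr_gt0.
have eta1 : eta <= 1 by rewrite ge_min lexx.
have eta_kap : C * eta < kap / 2.
  have : eta <= kap / (4 * C) by rewrite ge_min lexx orbT.
  rewrite ler_pdivlMr ?mulr_gt0//; lra.
have [r r0 hr] := set_ml S eta0.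
(* Points within [e'] of [Xb] are within [r / 2] of each other, hence in the range where
   [ml <= eta]. *)
pose e' := Num.min (eta / 16) (r / 4).
have e'0 : 0 < e' by rewrite lt_min !divr_gt0.
have e'eta : e' <= eta / 16 by rewrite ge_min lexx.
have e'r : e' <= r / 4 by rewrite ge_min lexx orbT.
have uK : usc_in K ut by apply: usc_inS (set_usc S) => X /KW[].
have vK : usc_in K (fun X => - v X) by apply: usc_inS (set_lsc S) => X /KW[].
pose W := interior K `&` [set Y | pdist Y Xb < e'].
have oW Y : W Y -> nbhs Y W.
  move=> [KY dY]; apply: filterI; first exact: nbhs_interior KY.
  exact: (continuous_near_lt (@pdist_continuous R n Xb Y) dY).
have nW : nbhs Xb W.
  by apply: filterI; [exact: nbhs_interior nK|exact: near_pdist].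
have dc := @d_continuous _ _ _ _ _ _ _ _ _ _ _ _ _ S.
have [k [B1 [B2 [k0 [KB1 KB2 WB1 WB2 dB] ke mx]]]] :=
  doubling_maximizers cK nK uK vK dc (fun X KX => (KW X KX).2) nW e'0.
have [NB1 NB2] : N B1 /\ N B2 by have [? _] := KW _ KB1; have [? _] := KW _ KB2.
pose P (z : (E * R) * (E * R)) := (2 * k) *: (z.1.1 - z.2.1)
  + (2 *: (z.1.1 - Xb.1) + 2 *: (z.1.1 - B1.1)).
pose Aq (z : (E * R) * (E * R)) := 2 * k * (z.1.2 - z.2.2)
  + (2 * (z.1.2 - Xb.2) + 2 * (z.1.2 - B1.2)).
(* If [d B1 = 0] then [d B2 = 0], so every pair [(Y, B2)] with [d Y = 0] and [Y] near [B1] is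
   admissible in the constrained problem. Thus [B1] is a local maximum on the interface and
   [set_tang] applies. *)
have [q hq] : exists q, d B1.1 = 0 ->
    Aq (B1, B2) + Fp B1.1 B1.2 (P (B1, B2) + q *: nd B1.1) <= - kap /\
    Aq (B1, B2) + Fm B1.1 B1.2 (P (B1, B2) + q *: nd B1.1) <= - kap.
  have [dB1|dB1] := eqVneq (d B1.1) 0; last by exists 0 => /eqP; rewrite (negbTE dB1).
  have hp := C1_gradientD (C1_gradientZ k (C1_gradient_sqd B2)) (C1_gradient_sqd Xb).
  have [|q [q1 q2]] := set_tang S hp NB1 dB1.
    have [iK _] := WB1; apply: filterS (iK : nbhs _ _) => Y KY dY.
    have := mx Y B2 KY KB2; rewrite dY -dB dB1 => /(_ erefl); lra.
  have PE : P (B1, B2) = k *: (2 *: (B1.1 - B2.1)) + 2 *: (B1.1 - Xb.1).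
    by rewrite /P /= subrr scaler0 addr0 scalerA (mulrC k).
  have AE : Aq (B1, B2) = k * (2 * (B1.2 - B2.2)) + 2 * (B1.2 - Xb.2).
    by rewrite /Aq /=; ring.
  by exists q => _; rewrite PE AE.
have c1 := @continuous_fst (E * R)%type (E * R)%type.
have c2 := @continuous_snd (E * R)%type (E * R)%type.
have c11 (z : (E * R) * (E * R)) : {for z, continuous (fun z : (E * R) * (E * R) => z.1.1)}.
  exact: (continuous_fst_comp (c1 z)).
have c12 (z : (E * R) * (E * R)) : {for z, continuous (fun z : (E * R) * (E * R) => z.1.2)}.
  exact: (continuous_snd_comp (c1 z)).
have c21 (z : (E * R) * (E * R)) : {for z, continuous (fun z : (E * R) * (E * R) => z.2.1)}.
  exact: (continuous_fst_comp (c2 z)).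
have c22 (z : (E * R) * (E * R)) : {for z, continuous (fun z : (E * R) * (E * R) => z.2.2)}.
  exact: (continuous_snd_comp (c2 z)).
have cnd (z : (E * R) * (E * R)) : {for z, continuous (fun z : (E * R) * (E * R) => nd z.1.1)}.
  exact: (@continuous_comp _ _ _ (fun z : (E * R) * (E * R) => z.1) (fun Y : E * R => nd Y.1) z (c1 z) (nd_continuous S (X := z.1))).
have cd1 (z : (E * R) * (E * R)) : {for z, continuous (fun z : (E * R) * (E * R) => d z.1.1)}.
  exact: (@continuous_comp _ _ _ (fun z : (E * R) * (E * R) => z.1) (fun Y : E * R => d Y.1) z (c1 z) (d_continuous S (X := z.1))).
have cd2 (z : (E * R) * (E * R)) : {for z, continuous (fun z : (E * R) * (E * R) => d z.2.1)}.
  exact: (@continuous_comp _ _ _ (fun z : (E * R) * (E * R) => z.2) (fun Y : E * R => d Y.1) z (c2 z) (d_continuous S (X := z.2))).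
have cP z : {for z, continuous (fun z => P z + q *: nd z.1.1)}.
  have cc (x : E) : {for z, continuous (fun _ : (E * R) * (E * R) => x)} by exact: cst_continuous.
  rewrite /P; apply: continuousD; last exact: (continuousZl_tmp (cnd z)).
  apply: continuousD; first exact: (continuousZl_tmp (continuousB (c11 z) (c21 z))).
  apply: continuousD; apply: continuousZl_tmp; apply: continuousB.
  - exact: c11.
  - exact: cc.
  - exact: c11.
  - exact: cc.
have cA z : {for z, continuous Aq}.
  have cc (x : R) : {for z, continuous (fun _ : (E * R) * (E * R) => x)} by exact: cst_continuous.
  rewrite /Aq; apply: continuousD.
    apply: continuousM; first exact: cc.
    by apply: continuousB; [exact: c12|exact: c22].
  apply: continuousD; apply: continuousM; first exact: cc.
  - by apply: continuousB; [exact: c12|exact: cc].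
  - exact: cc.
  - by apply: continuousB; [exact: c12|exact: cc].
pose good (z : (E * R) * (E * R)) := [/\ W z.1, W z.2, pdist z.1 B1 < e', pdist z.2 B2 < e' &
   k * sqd z.1 z.2 < e'].
pose ustar (z : (E * R) * (E * R)) := d z.1.1 = 0 ->
  Aq z + Fp z.1.1 z.1.2 (P z + q *: nd z.1.1) <= - (kap / 2) /\
  Aq z + Fm z.1.1 z.1.2 (P z + q *: nd z.1.1) <= - (kap / 2).
have nG : \forall z \near (B1, B2), good z.
  have g1 : \forall z \near (B1, B2), W z.1 by exact: (c1 (B1, B2) W (oW _ WB1)).
  have g2 : \forall z \near (B1, B2), W z.2 by exact: (c2 (B1, B2) W (oW _ WB2)).
  have g3 : \forall z \near (B1, B2), pdist z.1 B1 < e'.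
    exact: (c1 (B1, B2) [set Y | pdist Y B1 < e'] (near_pdist B1 e'0)).
  have g4 : \forall z \near (B1, B2), pdist z.2 B2 < e'.
    exact: (c2 (B1, B2) [set Y | pdist Y B2 < e'] (near_pdist B2 e'0)).
  have g5 : \forall z \near (B1, B2), k * sqd z.1 z.2 < e'.
    apply: (@continuous_near_lt _ _ (fun z : (E * R) * (E * R) => k * sqd z.1 z.2)) => //.
    apply: continuousM; first exact: cst_continuous.
    by apply: sqd_continuous; [exact: c1|exact: c2].
  have := nbhs_setI (nbhs_setI g1 g2) (nbhs_setI (nbhs_setI g3 g4) g5).
  by apply: filterS => z [[? ?] [[? ?] ?]].
(* Of the margin [kap], one quarter pays for the change of point and momentum in [Fp] and [Fm],
   another for [Aq]. If [d B1 <> 0], no point near [B1] lies on the interface. *)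
have nU : \forall z \near (B1, B2), W z.1 -> ustar z.
  have [dB1|dB1] := eqVneq (d B1.1) 0; last first.
    have cdn := continuous_comp (cd1 (B1, B2)) (@norm_continuous _ _ (d B1.1)).
    have dn : 0 < `|d B1.1| by rewrite normr_gt0.
    have := continuous_near_gt cdn dn.
    by apply: filterS => z /= + _ dz; rewrite dz normr0 ltxx.
  have [q1 q2] := hq dB1.
  have k4 : 0 < kap / 4 by rewrite divr_gt0.
  have DB1p : (N `&` [set X | 0 <= d X.1]) B1 by split=> //=; rewrite dB1.
  have DB1m : (N `&` [set X | d X.1 <= 0]) B1 by split=> //=; rewrite dB1.
  have u1 := ham_near (f := fun z : (E * R) * (E * R) => z.1) (t := (B1, B2)) (set_Fp S) M0 (set_ml S) (c1 _) (cP _) DB1p k4.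
  have u2 := ham_near (f := fun z : (E * R) * (E * R) => z.1) (t := (B1, B2)) (set_Fm S) M0 (set_ml S) (c1 _) (cP _) DB1m k4.
  have u3 : \forall z \near (B1, B2), Aq z < Aq (B1, B2) + kap / 4.
    by apply: (continuous_near_lt (cA _)); rewrite ltrDl.
  have := nbhs_setI (nbhs_setI u1 u2) u3.
  apply: filterS => z [[v1 v2] v3] [iK _] dz.
  have [Nz _] := KW _ (interior_subset iK).
  have := v1 (conj Nz _); have := v2 (conj Nz _).
  rewrite /= dz lexx => /(_ isT) w2 /(_ isT) w1.
  move: q1 q2 w1 w2 v3 => /=; clear; split; lra.
pose K2 := K `*` K.
have cK2 : compact K2 by exact: compact_setX.
have K2B : K2 (B1, B2) by split.
(* The distances to [B1] and [B2] make [(B1, B2)] the strict maximum among pairs with [d X1 = d X2],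
   on which the term in [q] vanishes. *)
pose f (z : (E * R) * (E * R)) := ut z.1 - v z.2 - k * sqd z.1 z.2 - sqd z.1 Xb
  - sqd z.1 B1 - sqd z.2 B2 - q * (d z.1.1 - d z.2.1).
pose g (z : (E * R) * (E * R)) := gg (d z.1.1) (d z.2.1).
have uf : usc_in K2 f.
  pose m (z : (E * R) * (E * R)) : R := k * sqd z.1 z.2 + (sqd z.1 Xb + (sqd z.1 B1
    + (sqd z.2 B2 + q * (d z.1.1 - d z.2.1)))).
  have cm z : {for z, continuous m}.
    rewrite /m; apply: continuousD.
      by apply: continuousM; [exact: cst_continuous|by apply: sqd_continuous; [exact: c1|exact: c2]].
    apply: continuousD; first by apply: sqd_continuous; [exact: c1|exact: cst_continuous].
    apply: continuousD; first by apply: sqd_continuous; [exact: c1|exact: cst_continuous].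
    apply: continuousD; first by apply: sqd_continuous; [exact: c2|exact: cst_continuous].
    apply: continuousM; first exact: cst_continuous.
    by apply: continuousB; [exact: cd1|exact: cd2].
  have -> : f = fun z => (ut z.1 + - v z.2) + - m z.
    by apply/funext => z; rewrite /f /m; ring.
  apply: usc_inD; first apply: usc_inD.
  - by apply: usc_in_comp uK => // z [].
  - by apply: (@usc_in_comp _ _ _ K _ (fun X => - v X)) => // z [].
  - by apply: continuous_usc_in => z _; exact: continuousN (cm z).
have ug : usc_in K2 (fun z => - g z).
  apply: (@usc_in_comp _ _ _ setT K2 (fun w : R * R => - gg w.1 w.2)
    (fun z : (E * R) * (E * R) => (d z.1.1, d z.2.1))) => //; last exact: gg_usc.
  by move=> z; exact: (cvg_pair (cd1 z) (cd2 z)).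
have gB : g (B1, B2) = 0 by rewrite /g /= dB gg_diag.
have fB z : K2 z -> g z = 0 -> z <> (B1, B2) -> f z < f (B1, B2).
  case: z => Y1 Y2 [/= KY1 KY2] /gg_eq0 /= dY YB.
  have := mx Y1 Y2 KY1 KY2 dY; rewrite /f /= dY dB !subrr !sqdxx mulr0 !subr0.
  have : 0 < sqd Y1 B1 + sqd Y2 B2.
    rewrite lt_def addr_ge0 ?sqd_ge0// andbT paddr_eq0 ?sqd_ge0//.
    apply/negP => /andP[/eqP/sqd_eq0 E1 /eqP/sqd_eq0 E2].
    by apply: YB; rewrite E1 E2.
  by clear; lra.
have nN : nbhs (B1, B2) [set z | good z /\ (W z.1 -> ustar z)] by exact: nbhs_setI nG nU.
have Hc := penalization cK2 uf ug (fun z _ => gg_ge0 _ _) K2B gB fB nN ltr01.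
(* [c > L] and [c > L ^+ 2 / eta] are the two lower bounds asked by [setting_doubling_step]; they
   involve only [k], [q] and [eta], already fixed. *)
set L := `|q| + (M * (k * eta / 4 + 2) + k * eta / 4 + 1) / del.
have [c [[[[cp cL] cL2] _] {}Hc]] := filter_ex (filterI (filterI (filterI (filterI
  (nbhs_pinfty_gt (num_real (0 : R))) (nbhs_pinfty_gt (num_real L)))
  (nbhs_pinfty_gt (num_real (L ^+ 2 / eta)))) (nbhs_pinfty_gt (num_real (0 : R)))) Hc).
have uc : usc_in K2 (fun z => f z + c * (- g z)).
  by apply: usc_inD => //; apply: usc_inZ => //; exact: ltW.
have [[X1 X2] K12 mxc] := compact_usc_max cK2 (ex_intro _ _ K2B) uc.
have [|[[W1 W2 g3 g4 g5] us] _] := Hc _ K12.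
  by have := mxc _ K2B; rewrite gB oppr0 mulr0 addr0 mulrN.
have {}us := us W1.
have [[/= K1 K2'] [i1 _] [i2 _]] := And3 K12 W1 W2.
have [[NX1 _] [NX2 _]] := conj (KW _ K1) (KW _ K2').
apply: (@setting_doubling_step _ _ _ _ _ _ _ _ _ _ _ k eta Xb B1 B2 X1 X2 q c S) => //.
- by rewrite (ltW eta0) eta1.
- apply: filterS (i1 : nbhs _ _) => Y KY.
  by have := mxc (Y, X2) (conj KY K2'); rewrite /f /g /= !mulrN.
- apply: filterS (i2 : nbhs _ _) => Y KY.
  by have := mxc (X1, Y) (conj K1 KY); rewrite /f /g /= !mulrN.
- by case: W1 => _ /=; move: e'eta; clear; lra.
- by case: W2 => _ /=; move: e'eta; clear; lra.
- by move: g3 e'eta => /=; clear; lra.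
- by move: g4 e'eta => /=; clear; lra.
- by move: g5 e'eta => /=; clear; lra.
- apply: hr; rewrite pdist_ge0 /=; have := pdist_triang X1 Xb X2.
  rewrite (pdistC Xb); case: W1 W2 => _ /= w1 [_ /= w2].
  by move: w1 w2 e'r r0; clear; lra.
- by move: cL2; rewrite ltr_pdivrMr// mulrC => /ltW.
Qed.

End no_maximum.

(** * Maxima away from the interface *)

Section interior_maximum.
Context {R : realType} {n : nat}.
Local Notation E := 'rV[R]_n.+1.
Implicit Types (X Y : E * R) (N : set (E * R)) (F : E -> R -> E -> R).

(** No normal slope enters away from the interface: up to a small term the momentum is
    [2 k (X1 - X2)], so its product with [|X1 - X2|] is small by the doubling alone. *)
Lemma interior_no_max N ut v kap M (ml : R -> R) F Xb :
  (forall X, N X -> nbhs X N) -> 0 <= M -> 0 < kap ->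
  usc_in N ut -> usc_in N (fun X => - v X) ->
  (forall e, 0 < e -> exists2 r : R, 0 < r & forall x, 0 <= x < r -> ml x <= e) ->
  (forall X p p', N X -> F X.1 X.2 p <= F X.1 X.2 p' + M * enorm (p - p')) ->
  (forall X Y p, N X -> N Y ->
    F X.1 X.2 p <= F Y.1 Y.2 p + M * pdist X Y * enorm p + ml (pdist X Y)) ->
  (forall phi G A X, C1_gradient phi G A -> N X ->
    (\forall Y \near X, ut Y - phi Y <= ut X - phi X) -> A X + F X.1 X.2 (G X) <= - kap) ->
  (forall phi G A X, C1_gradient phi G A -> N X ->
    (\forall Y \near X, v X - phi X <= v Y - phi Y) -> 0 <= A X + F X.1 X.2 (G X)) ->
  N Xb -> (\forall X \near Xb, ut X - v X <= ut Xb - v Xb) -> False.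
Proof.
move=> oN M0 kap0 uu uv hml hlip hmod hsub hsup NXb Hmax.
have [K [cK nK KW]] := compact_nbhs (nbhs_setI (oN _ NXb) Hmax).
(* The total error is at most [(6 M + 2) e' + eta] with [e' <= eta / 16], below
   [kap = 4 (M + 1) eta]. *)
pose eta := kap / (4 * (M + 1)).
have M1 : 0 < 4 * (M + 1) by rewrite mulr_gt0// ltr_wpDl.
have eta0 : 0 < eta by rewrite divr_gt0.
have eta_kap : eta * (4 * (M + 1)) = kap by rewrite /eta divfK// gt_eqF.
have [r r0 hr] := hml _ eta0.
pose e' := Num.min (eta / 16) (r / 4).
have e'0 : 0 < e' by rewrite lt_min !divr_gt0.
have e'eta : e' <= eta / 16 by rewrite ge_min lexx.
have e'r : e' <= r / 4 by rewrite ge_min lexx orbT.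
have uK : usc_in K ut by apply: usc_inS uu => X /KW[].
have vK : usc_in K (fun X => - v X) by apply: usc_inS uv => X /KW[].
have nW : nbhs Xb (interior K `&` [set Y | pdist Y Xb < e']).
  by apply: filterI; [exact: nbhs_interior nK|exact: near_pdist].
have dc : continuous (fun _ : E * R => 0 : R) by move=> X; exact: cst_continuous.
have [k [X1 [X2 [k0 [K1 K2 [i1 W1] [i2 W2] _] ke mx]]]] :=
  doubling_maximizers cK nK uK vK dc (fun X KX => (KW X KX).2) nW e'0.
have [[NX1 _] [NX2 _]] := conj (KW _ K1) (KW _ K2).
have hp1 := C1_gradientD (C1_gradientZ k (C1_gradient_sqd X2)) (C1_gradient_sqd Xb).
have hp2 := C1_gradientN (C1_gradientZ k (C1_gradient_sqd X1)).
have := hsub _ _ _ X1 hp1 NX1 => /(_ _) hu.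
have {hu} : k * (2 * (X1.2 - X2.2)) + 2 * (X1.2 - Xb.2) +
    F X1.1 X1.2 (k *: (2 *: (X1.1 - X2.1)) + 2 *: (X1.1 - Xb.1)) <= - kap.
  apply: hu; apply: filterS (i1 : nbhs _ _) => Y KY.
  by have := mx Y X2 KY K2 erefl; clear; lra.
have := hsup _ _ _ X2 hp2 NX2 => /(_ _) hv.
have {hv} : 0 <= - (k * (2 * (X2.2 - X1.2))) +
    F X2.1 X2.2 (- (k *: (2 *: (X2.1 - X1.1)))).
  apply: hv; apply: filterS (i2 : nbhs _ _) => Y KY.
  by have := mx X1 Y K1 KY erefl; rewrite (sqdC Y X1) (sqdC X2 X1); clear; lra.
have -> : - (k *: (2 *: (X2.1 - X1.1))) = k *: (2 *: (X1.1 - X2.1)) by rewrite -!scalerN opprB.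
set p := k *: _ => hv hu.
have r0' := pdist_ge0 X1 X2.
have rle : pdist X1 X2 <= 2 * e'.
  have := pdist_triang X1 Xb X2; rewrite (pdistC Xb); move: W1 W2 => /=; clear; lra.
have r2 : k * pdist X1 X2 ^+ 2 <= 2 * e'.
  by have := ler_wpM2l (ltW k0) (sqr_pdist_le X1 X2); move: ke; clear; lra.
have n2 : `|2 : R| = 2 by rewrite ger0_norm.
have pE : enorm p <= 2 * k * pdist X1 X2.
  rewrite /p !enormZ n2 ger0_norm ?(ltW k0)// mulrA (mulrC k).
  by rewrite ler_wpM2l ?enorm_le_pdist// mulr_ge0// ltW.
have h1 := hlip X1 p (p + 2 *: (X1.1 - Xb.1)) NX1.
have h2 := hmod X2 X1 p NX2 NX1; rewrite pdistC in h2.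
have h3 : M * enorm (p - (p + 2 *: (X1.1 - Xb.1))) <= M * (2 * e').
  rewrite ler_wpM2l// opprD addrA subrr sub0r enormN enormZ n2.
  by have := enorm_le_pdist X1 Xb; move: W1 => /=; clear; lra.
have h4 : M * (pdist X1 X2 * enorm p) <= M * (4 * e').
  by rewrite ler_wpM2l//; have := ler_wpM2l r0' pE; move: r2; clear; lra.
have h5 : ml (pdist X1 X2) <= eta.
  by apply: hr; rewrite r0' /=; move: rle e'r r0; clear; lra.
have h6 : M * e' <= M * (eta / 16) by rewrite ler_wpM2l.
have h7 : - (2 * (X1.2 - Xb.2)) <= 2 * e'.
  have := norm_le_pdist X1 Xb; have := ler_norm (- (X1.2 - Xb.2)).
  by rewrite normrN; move: W1 => /=; clear; lra.
have h8 : 0 <= M * eta by rewrite mulr_ge0// ltW.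
move: hu hv h1 h2 h3 h4 h5 h6 h7 h8 e'eta eta_kap eta0; clear.
set f1 := F _ _ _; set f2 := F _ _ _; set f3 := F _ _ _.
lra.
Qed.

End interior_maximum.

(** * Hamiltonians and the tangential slope *)

Section hamiltonians.
Context {R : realType} {n : nat}.
Local Notation E := 'rV[R]_n.+1.

Lemma sup_le_of_ub (S : set R) y : S !=set0 -> (forall x, S x -> x <= y) -> sup S <= y.
Proof. by move=> S0 Sy; apply: sup_le_ub => // x; exact: Sy. Qed.

Section one_hamiltonian.
Context {A : metricType R} {Om : set E} {T : R} {b : E -> R -> A -> E} {l : E -> R -> A -> R}
  {Mb Lb Ml : R} {ml : R -> R}.
Hypothesis hC1 : control_C1 Om T b Mb Lb.
Hypothesis hC2 : control_C2 Om T l Ml ml.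
Hypothesis A0 : [set: A] !=set0.
Implicit Types (x y p : E) (t s : R).

Lemma dotp_control_le x t (al : A) p : closure Om x -> t \in `[0, T] ->
  `|dotp (b x t al) p| <= Mb * enorm p.
Proof.
move=> Ox tT; apply: le_trans (dotp_abs _ _) _.
by rewrite ler_wpM2r ?enorm_ge0//; exact: (C1_bounded hC1).
Qed.

Lemma hamiltonian_set_bound x t (al : A) p : closure Om x -> t \in `[0, T] ->
  `|- dotp (b x t al) p - l x t al| <= Mb * enorm p + Ml.
Proof.
move=> Ox tT; apply: le_trans (ler_normB _ _) _; rewrite normrN lerD//.
  exact: dotp_control_le.
exact: (C2_bounded hC2).
Qed.

Lemma hamiltonian_ge x t p al : closure Om x -> t \in `[0, T] ->
  - dotp (b x t al) p - l x t al <= hamiltonian b l x t p.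
Proof.
move=> Ox tT; apply: ub_le_sup; last by exists al.
exists (Mb * enorm p + Ml) => _ [be _ <-].
by apply: le_trans (ler_norm _) _; exact: hamiltonian_set_bound.
Qed.

Lemma hamiltonian_le x t p h : (forall al, - dotp (b x t al) p - l x t al <= h) ->
  hamiltonian b l x t p <= h.
Proof.
move=> H; apply: sup_le_of_ub => [|_ [al _ <-]]; last exact: H.
by have [al _] := A0; exists (- dotp (b x t al) p - l x t al), al.
Qed.

Lemma hamiltonian_lip x t p p' : closure Om x -> t \in `[0, T] ->
  hamiltonian b l x t p <= hamiltonian b l x t p' + Mb * enorm (p - p').
Proof.
move=> Ox tT; apply: hamiltonian_le => al.
have := hamiltonian_ge p' al Ox tT.
have := dotp_control_le al (p - p') Ox tT; rewrite dotpBr ler_norml => /andP[+ _].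
lra.
Qed.

Lemma hamiltonian_mod x y t s p : closure Om x -> t \in `[0, T] ->
  closure Om y -> s \in `[0, T] ->
  hamiltonian b l x t p <= hamiltonian b l y s p
    + `|Lb| * (enorm (x - y) + `|t - s|) * enorm p + ml (enorm (x - y) + `|t - s|).
Proof.
move=> Ox tT Oy sT; apply: hamiltonian_le => al.
have := hamiltonian_ge p al Oy sT.
have := C2_modulus_bound hC2 al Ox Oy tT sT; rewrite ler_norml => /andP[+ _].
have := C1_lipschitz hC1 al Ox Oy tT sT.
set r := enorm (x - y) + `|t - s| => hb hl.
have r0 : 0 <= r by rewrite addr_ge0 ?enorm_ge0.
have : `|dotp (b x t al - b y s al) p| <= `|Lb| * r * enorm p.
  apply: le_trans (dotp_abs _ _) _; rewrite ler_wpM2r ?enorm_ge0//.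
  by apply: le_trans hb _; rewrite ler_wpM2r// ler_norm.
rewrite dotpBl ler_norml => /andP[+ _]; lra.
Qed.

(** Each control contributes an affine function of the slope; the sign of its growth decides which
    endpoint dominates the middle value. *)
Lemma hamiltonian_qconv x t p m a0 b0 c0 h : closure Om x -> t \in `[0, T] ->
  a0 <= b0 <= c0 -> hamiltonian b l x t (p + a0 *: m) <= h ->
  hamiltonian b l x t (p + c0 *: m) <= h -> hamiltonian b l x t (p + b0 *: m) <= h.
Proof.
move=> Ox tT /andP[ab bc] ha hc; apply: hamiltonian_le => al.
have := le_trans (hamiltonian_ge (p + a0 *: m) al Ox tT) ha.
have := le_trans (hamiltonian_ge (p + c0 *: m) al Ox tT) hc.
rewrite !dotpDr !dotpZr; set k := dotp _ m.
have [k0|k0] := leP 0 k.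
  by have := ler_wpM2r k0 ab; lra.
have := ler_wnM2r (ltW k0) bc; lra.
Qed.

(** The sign of [q] selects the control pushing along [m] or against it; the rest of the momentum
    and the running cost take at most [Mb |p| + Ml]. *)
Lemma hamiltonian_coer x t p m del q : closure Om x -> t \in `[0, T] ->
  (exists al, del <= dotp (b x t al) m) -> (exists al, dotp (b x t al) m <= - del) ->
  del * `|q| <= hamiltonian b l x t (p + q *: m) + (Mb * enorm p + Ml).
Proof.
move=> Ox tT [al hal] [be hbe].
have [q0|q0] := leP 0 q.
  rewrite ger0_norm//; have := hamiltonian_ge (p + q *: m) be Ox tT.
  have := hamiltonian_set_bound be p Ox tT; rewrite ler_norml => /andP[+ _].
  by rewrite dotpDr dotpZr; have := ler_wpM2l q0 hbe; lra.
rewrite ltr0_norm//; have := hamiltonian_ge (p + q *: m) al Ox tT.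
have := hamiltonian_set_bound al p Ox tT; rewrite ler_norml => /andP[+ _].
by rewrite dotpDr dotpZr; have := ler_wnM2l (ltW q0) hal; lra.
Qed.

Lemma hamiltonian_ham_on (D : set (E * R)) nd M del :
  (forall X, D X -> closure Om X.1 /\ X.2 \in `[0, T]) ->
  Mb <= M -> `|Lb| <= M -> Ml <= M ->
  (forall X, D X -> (exists al, del <= dotp (b X.1 X.2 al) (nd X.1)) /\
                    (exists al, dotp (b X.1 X.2 al) (nd X.1) <= - del)) ->
  ham_on D nd M del ml (hamiltonian b l).
Proof.
move=> DO MbM LbM MlM Dc; split.
- move=> X p p' /DO[OX TX]; apply: le_trans (hamiltonian_lip p p' OX TX) _.
  by rewrite lerD2l ler_wpM2r ?enorm_ge0.
- move=> X Y p /DO[OX TX] /DO[OY TY]; apply: le_trans (hamiltonian_mod p OX TX OY TY) _.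
  by rewrite lerD2r lerD2l ler_wpM2r ?enorm_ge0// ler_wpM2r// pdist_ge0.
- by move=> X p m a0 b0 c0 h /DO[OX TX]; exact: hamiltonian_qconv.
- move=> X p q /[dup] /Dc[c1 c2] /DO[OX TX].
  apply: le_trans (hamiltonian_coer p q OX TX c1 c2) _.
  rewrite lerD2l mulrDr mulr1 lerD// ler_wpM2r ?enorm_ge0//.
Qed.

End one_hamiltonian.

(* The line through [(0, h)] with slope [q] separates [K] from the points of
   the axis [k.1 = 0] above [h]. *)
Lemma supporting_slope (K : set (R * R)) (h : R) :
  (forall k k', K k -> K k' -> 0 < k.1 -> k'.1 < 0 ->
     k.2 * (- k'.1) + k'.2 * k.1 <= h * (k.1 - k'.1)) ->
  (forall k, K k -> k.1 = 0 -> k.2 <= h) ->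
  (exists2 k, K k & 0 < k.1) -> (exists2 k, K k & k.1 < 0) ->
  exists q, forall k, K k -> k.2 - q * k.1 <= h.
Proof.
move=> Hpn H0 [kp Kp kp0] [kn Kn kn0].
pose P := [set (k.2 - h) / k.1 | k in K `&` [set k : R * R | 0 < k.1]].
have P0 : P !=set0 by exists ((kp.2 - h) / kp.1), kp.
have Pub k' : K k' -> k'.1 < 0 -> ubound P ((k'.2 - h) / k'.1).
  move=> Kk' k'0 _ [k [Kk /= k0] <-].
  rewrite ler_pdivrMr// mulrAC ler_ndivlMr//.
  have := Hpn _ _ Kk Kk' k0 k'0; lra.
exists (sup P) => k Kk; have [k0|k0|k0] := ltgtP k.1 0.
- have : sup P <= (k.2 - h) / k.1 by apply: sup_le_ub => //; exact: Pub.
  by rewrite ler_ndivlMr//; lra.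
- have : (k.2 - h) / k.1 <= sup P.
    apply: ub_le_sup; first by exists ((kn.2 - h) / kn.1); exact: Pub.
    by exists k.
  by rewrite ler_pdivrMr//; lra.
- by rewrite k0 mulr0 subr0; exact: H0.
Qed.

Lemma BL_set_conv (A : Type) (b : E -> R -> A -> E) (l : E -> R -> A -> R) z s (al be : A) (lam : R) :
  convex_set (BL_set b l z s) -> 0 <= lam <= 1 ->
  exists ga, b z s ga = lam *: b z s al + (1 - lam) *: b z s be /\
             l z s ga = lam * l z s al + (1 - lam) * l z s be.
Proof.
move=> cv /andP[l0 l1].
have := cv (b z s al, l z s al) (b z s be, l z s be) (Itv01 l0 l1).
rewrite !inE => /(_ _ _)[||ga _ H]; [by exists al|by exists be|].
by exists ga; case: H => -> ->.
Qed.

(** * Common normal slope from the tangential Hamiltonian *)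

Section tangential.
Context {A1 A2 : metricType R} {Om1 Om2 : set E} {T : R}
  {b1 : E -> R -> A1 -> E} {b2 : E -> R -> A2 -> E}
  {l1 : E -> R -> A1 -> R} {l2 : E -> R -> A2 -> R} {Mb Lb Ml : R} {ml : R -> R}.
Hypotheses (hb1 : control_C1 Om1 T b1 Mb Lb) (hb2 : control_C1 Om2 T b2 Mb Lb).
Hypotheses (hl1 : control_C2 Om1 T l1 Ml ml) (hl2 : control_C2 Om2 T l2 Ml ml).
Hypotheses (hc1 : control_C3 Om1 T b1 l1) (hc2 : control_C3 Om2 T b2 l2).
Hypotheses (A10 : [set: A1] !=set0) (A20 : [set: A2] !=set0).
Variables (n1 : E -> E) (z : E) (s : R) (g : E).
Hypotheses (z1 : closure Om1 z) (z2 : closure Om2 z) (sT : s \in `[0, T]).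

Let HT := tangential_hamiltonian b1 b2 l1 l2 n1 z s g.

Lemma tangential_hamiltonian_ge a : A0_set b1 b2 n1 z s a ->
  - dotp (bH b1 b2 z s a) g - lH l1 l2 z s a <= HT.
Proof.
move=> Aa; apply: ub_le_sup; last by exists a.
exists (Mb * enorm g + Ml) => _ [[[al be] mu] [/= mu01 _] <-].
move: mu01; rewrite in_itv /= => /andP[mu0 mu1].
have h1 := hamiltonian_set_bound hb1 hl1 al g z1 sT.
have h2 := hamiltonian_set_bound hb2 hl2 be g z2 sT.
move: h1 h2; rewrite !ler_norml => /andP[_ h1] /andP[_ h2].
rewrite /bH /lH /= dotpDl !dotpZl.
have := ler_wpM2l mu0 h1; have mu1' : 0 <= 1 - mu by rewrite subr_ge0.
have := ler_wpM2l mu1' h2; lra.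
Qed.

(** Each control of either side gives a point of the plane: its normal speed and its value at the
    momentum [g]. Convex combinations with zero normal speed are bounded by [HT], and the line given
    by [supporting_slope] above all these points has the desired slope. *)
Lemma tangential_slope :
  (exists al, 0 < dotp (b1 z s al) (n1 z)) -> (exists al, dotp (b1 z s al) (n1 z) < 0) ->
  exists q, hamiltonian b1 l1 z s (g + q *: n1 z) <= HT /\
            hamiltonian b2 l2 z s (g + q *: n1 z) <= HT.
Proof.
move=> [alp hp] [aln hn]; have [be0 _] := A20; have [al0 _] := A10.
pose k1 al := (dotp (b1 z s al) (n1 z), - dotp (b1 z s al) g - l1 z s al).
pose k2 be := (dotp (b2 z s be) (n1 z), - dotp (b2 z s be) g - l2 z s be).
pose K := [set k1 al | al in [set: A1]] `|` [set k2 be | be in [set: A2]].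
have [c1 c2] := ((hc1 z1 sT).2, (hc2 z2 sT).2).
have mix al be lam : 0 <= lam <= 1 -> lam * (k1 al).1 + (1 - lam) * (k2 be).1 = 0 ->
    lam * (k1 al).2 + (1 - lam) * (k2 be).2 <= HT.
  move=> l01 l0; have := @tangential_hamiltonian_ge ((al, be), lam).
  rewrite /A0_set /bH /lH /= dotpDl !dotpZl in_itv /= => /(_ (conj l01 l0)).
  by rewrite dotpDl !dotpZl; lra.
(* A single control of zero normal speed is a mixture of weight 1 with an arbitrary control of the
   other side. *)
have one1 al : (k1 al).1 = 0 -> (k1 al).2 <= HT.
  by move=> k0; have := mix al be0 1; rewrite ler01 lexx k0 subrr !mul0r !mul1r !addr0 => H; exact: H.
have one2 be : (k2 be).1 = 0 -> (k2 be).2 <= HT.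
  by move=> k0; have := mix al0 be 0; rewrite ler01 lexx k0 subr0 !mul0r !mul1r !add0r => H; exact: H.
have weight (x y : R) : 0 < x -> y < 0 -> 0 <= - y / (x - y) <= 1.
  move=> x0 y0; have xy : 0 < x - y by lra.
  by rewrite divr_ge0 ?ler_pdivrMr//; lra.
(* [A0_set] mixes one control of each side; two controls of the same side are first replaced by a
   single one, using (C3). *)
have conv1 (al be : A1) lam : 0 <= lam <= 1 -> lam * (k1 al).1 + (1 - lam) * (k1 be).1 = 0 ->
    lam * (k1 al).2 + (1 - lam) * (k1 be).2 <= HT.
  move=> l01 l0; have [ga [gb gl]] := BL_set_conv al be c1 l01.
  have := one1 ga; rewrite /= gb gl !dotpDl !dotpZl => /(_ l0); rewrite /=; lra.
have conv2 (al be : A2) lam : 0 <= lam <= 1 -> lam * (k2 al).1 + (1 - lam) * (k2 be).1 = 0 ->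
    lam * (k2 al).2 + (1 - lam) * (k2 be).2 <= HT.
  move=> l01 l0; have [ga [gb gl]] := BL_set_conv al be c2 l01.
  have := one2 ga; rewrite /= gb gl !dotpDl !dotpZl => /(_ l0); rewrite /=; lra.
have [||||q Hq] := @supporting_slope K HT.
- move=> k k' Kk Kk' k0 k'0.
  (* The weight that cancels the normal speed. *)
  pose lam := - k'.1 / (k.1 - k'.1).
  have kk : 0 < k.1 - k'.1 by lra.
  have l01 : 0 <= lam <= 1 by exact: weight.
  have lz : lam * k.1 + (1 - lam) * k'.1 = 0.
    by rewrite /lam; field; rewrite gt_eqF.
  have lz' : (1 - lam) * k'.1 + (1 - (1 - lam)) * k.1 = 0 by rewrite -[RHS]lz; ring.
  have l01' : 0 <= 1 - lam <= 1 by move: l01 => /andP[? ?]; apply/andP; split; lra.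
  have : lam * k.2 + (1 - lam) * k'.2 <= HT.
    case: Kk Kk' => [[al _ ka]|[al _ ka]] [[be _ kb]|[be _ kb]].
    + by move: lz; rewrite -ka -kb; exact: conv1.
    + by move: lz; rewrite -ka -kb; exact: mix.
    + move: lz'; rewrite -ka -kb => lz'; have := mix _ _ _ l01' lz'; lra.
    + by move: lz; rewrite -ka -kb; exact: conv2.
  have -> : lam * k.2 + (1 - lam) * k'.2 = (k.2 * (- k'.1) + k'.2 * k.1) / (k.1 - k'.1).
    by rewrite /lam; field; rewrite gt_eqF.
  by rewrite ler_pdivrMr.
- by move=> k [[al _ <-]|[al _ <-]]; [exact: one1|exact: one2].
- by exists (k1 alp) => //; left; exists alp.
- by exists (k1 aln) => //; left; exists aln.
exists q; split; apply: hamiltonian_le => // al; rewrite dotpDr dotpZr.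
- have /Hq : K (k1 al) by left; exists al.
  by rewrite /=; lra.
- have /Hq : K (k2 al) by right; exists al.
  by rewrite /=; lra.
Qed.

End tangential.
End hamiltonians.

(** * Cutoff and gradient of the signed distance *)

Section cutoff.
Context {R : realType}.

Lemma is_diff_near_eq (V W : normedModType R) (f g df : V -> W) (x : V) :
  (\forall y \near x, f y = g y) -> is_diff x f df -> is_diff x g df.
Proof.
move=> fg dfx; have fx : differentiable f x by exact: ex_diff.
have E : g \o shift x = cst (g x) + 'd f x +o_ 0 id.
  have := diff_locally fx => /eqaddoP H; apply/eqaddoP => e e0.
  have Hfg : \forall h \near (0 : V), f (h + x) = g (h + x).
    have c : {for 0, continuous (shift x : V -> V)}.
      by apply: continuousD; [exact: cvg_id|exact: cst_continuous].
    have := c (fun y => f y = g y); rewrite /shift /= add0r; exact.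
  have gx := nbhs_singleton fg.
  by apply: filterS2 (H e e0) Hfg => h; rewrite !fctE /= gx => + <-.
have D : 'd g x = 'd f x :> (V -> W).
  by apply: diff_unique => //; exact: diff_continuous.
apply: DiffDef; last by rewrite D diff_val.
by apply/diff_locallyP; rewrite D; split=> //; exact: diff_continuous.
Qed.

Definition step (t : R) : R := 1 - sqp (1 - sqp t).

Definition step_deriv (t : R) : R := 2 * Num.max (1 - sqp t) 0 * (2 * Num.max t 0).

Lemma step_le0 t : t <= 0 -> step t = 0.
Proof. by move=> t0; rewrite /step (sqp_neg t0) subr0 sqp_pos// expr1n subrr. Qed.

Lemma step_ge1 t : 1 <= t -> step t = 1.
Proof.
move=> t1; have t0 : 0 <= t by lra.
by rewrite /step (@sqp_neg _ (1 - _)) ?subr0// sqp_pos// subr_le0; nra.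
Qed.

Lemma step_deriv_le0 t : t <= 0 -> step_deriv t = 0.
Proof. by move=> t0; rewrite /step_deriv (max_r t0) !mulr0. Qed.

Lemma step_deriv_ge1 t : 1 <= t -> step_deriv t = 0.
Proof.
move=> t1; have t0 : 0 <= t by lra.
rewrite /step_deriv (@max_r _ _ (1 - _)) ?mulr0 ?mul0r//.
by rewrite sqp_pos// subr_le0; nra.
Qed.

Lemma is_derive_step (t : R) : is_derive t 1 step (step_deriv t).
Proof.
have d1 := is_derive_sqp t; have d2 := is_derive_sqp (1 - sqp t).
have d3 : is_derive t 1 (fun t => 1 - sqp t) (0 - 2 * Num.max t 0).
  exact: (is_deriveB (is_derive_cst (1 : R) t 1) d1).
have d4 := @is_derive1_comp R sqp (fun t => 1 - sqp t) t _ _ d2 d3.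
have -> : step_deriv t = 0 - 2 * Num.max (1 - sqp t) 0 * (0 - 2 * Num.max t 0).
  by rewrite /step_deriv; ring.
exact: (is_deriveB (is_derive_cst (1 : R) t 1) d4).
Qed.

Lemma continuous_step_deriv : continuous step_deriv.
Proof.
move=> t; have c1 := @continuous_sqp R t; have c2 := @continuous_max0 R t.
have cc (a : R) : {for t, continuous (fun _ : R => a)} by exact: cst_continuous.
have c3 : {for t, continuous (fun t : R => Num.max (1 - sqp t) 0)}.
  exact: (@continuous_comp _ _ _ (fun t : R => 1 - sqp t) (fun x : R => Num.max x 0) t
    (continuousB (cc 1) c1) (@continuous_max0 R _)).
exact: (continuousM (continuousM (cc 2) c3) (continuousM (cc 2) c2)).
Qed.

Context {n : nat}.
Local Notation E := 'rV[R]_n.+1.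
Implicit Types (x y : E) (d : E -> R).

(** The transition takes place for [|x - c|] between [rho] and [sqrt 2 * rho]; the squared distance
    keeps the function differentiable at [c]. *)
Definition cut (c : E) (rho : R) x : R := step (2 - rho ^- 2 * dotp (x - c) (x - c)).

Definition cut_grad (c : E) (rho : R) x : E :=
  (step_deriv (2 - rho ^- 2 * dotp (x - c) (x - c)) * (- rho ^- 2 * 2)) *: (x - c).

Lemma is_diff_cut c rho x : is_diff x (cut c rho) (dotp (cut_grad c rho x)).
Proof.
have d1 := is_diffB (is_diff_cst (2 : R) x) (is_diffZ (rho ^- 2) (is_diff_sqdist c x)).
have d2 := is_derive_is_diff (is_derive_step (2 - rho ^- 2 * dotp (x - c) (x - c))).
have := is_diff_comp d1 d2; apply: is_diff_ext => // v.
rewrite /= !fctE /GRing.scale/= /cut_grad !dotpZl sub0r; ring.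
Qed.

Lemma continuous_cut_grad c rho : continuous (cut_grad c rho).
Proof.
move=> x; have d1 := is_diffB (is_diff_id x) (is_diff_cst c x).
have d2 := is_diffB (is_diff_cst (2 : R) x) (is_diffZ (rho ^- 2) (is_diff_sqdist c x)).
apply: (@continuousZ _ _ _ (fun x : E => step_deriv (2 - rho ^- 2 * dotp (x - c) (x - c)) * (- rho ^- 2 * 2))
  (fun x : E => x - c)); last exact: (is_diff_continuous d1).
apply: continuousM; last exact: cst_continuous.
apply: (@continuous_comp _ _ _ (fun x : E => 2 - rho ^- 2 * dotp (x - c) (x - c)) step_deriv).
  exact: (is_diff_continuous d2).
exact: continuous_step_deriv.
Qed.

Lemma cut_in c rho x : 0 < rho -> dotp (x - c) (x - c) <= rho ^+ 2 ->
  cut c rho x = 1 /\ cut_grad c rho x = 0.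
Proof.
move=> rho0 xc; have t1 : 1 <= 2 - rho ^- 2 * dotp (x - c) (x - c).
  have : rho ^- 2 * dotp (x - c) (x - c) <= 1.
    by rewrite mulrC ler_pdivrMr ?exprn_gt0// mul1r.
  lra.
by rewrite /cut step_ge1// /cut_grad step_deriv_ge1// mul0r scale0r.
Qed.

Lemma cut_out c rho x : 0 < rho -> 2 * rho ^+ 2 <= dotp (x - c) (x - c) ->
  cut c rho x = 0 /\ cut_grad c rho x = 0.
Proof.
move=> rho0 xc; have t1 : 2 - rho ^- 2 * dotp (x - c) (x - c) <= 0.
  have : 2 <= rho ^- 2 * dotp (x - c) (x - c).
    by rewrite mulrC ler_pdivlMr ?exprn_gt0.
  lra.
by rewrite /cut step_le0// /cut_grad step_deriv_le0// mul0r scale0r.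
Qed.

(** [C1_gradient] requires functions on the whole space, whereas the signed distance is regular near
    the interface. The gap between [2 rho^2], beyond which [cut] vanishes, and [3 rho^2], the range
    of the hypothesis, makes the product vanish around every remaining point. *)
Lemma cutoff_C1 (d : E -> R) (g : E -> E) c rho : 0 < rho ->
  (forall x, dotp (x - c) (x - c) < 3 * rho ^+ 2 ->
     is_diff x d (dotp (g x)) /\ {for x, continuous g}) ->
  exists d' g', [/\ forall x, is_diff x d' (dotp (g' x)), continuous g' &
    forall x, dotp (x - c) (x - c) <= rho ^+ 2 -> d' x = d x /\ g' x = g x].
Proof.
move=> rho0 H; pose d' x := cut c rho x * d x.
pose g' x := cut c rho x *: g x + d x *: cut_grad c rho x; exists d', g'.
have loc x : 3 * rho ^+ 2 <= dotp (x - c) (x - c) ->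
    \forall y \near x, cut c rho y = 0 /\ cut_grad c rho y = 0.
  move=> xc; have : 2 * rho ^+ 2 < dotp (x - c) (x - c).
    by have r2 : 0 < rho ^+ 2 by [rewrite exprn_gt0]; lra.
  move=> /(continuous_near_gt (is_diff_continuous (is_diff_sqdist c x))).
  by apply: filterS => y /ltW; exact: cut_out.
split=> x; first 2 last.
  move=> xc; have [c1 c2] := cut_in rho0 xc.
  by rewrite /d' /g' c1 c2 mul1r scale1r scaler0 addr0.
all: have [xc|xc] := ltP (dotp (x - c) (x - c)) (3 * rho ^+ 2).
- have [dd _] := H x xc; have := is_diffM (is_diff_cut c rho x) dd.
  apply: is_diff_ext => // v; by rewrite /g' dotpDl (dotpZl (cut c rho x)) (dotpZl (d x)).
- have [g1 g2] := nbhs_singleton (loc x xc).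
  rewrite /g' g1 g2 scale0r scaler0 addr0.
  have : is_diff x (cst 0 : E -> R) (dotp 0).
    by have := is_diff_cst (0 : R) x; apply: is_diff_ext => // v; rewrite dotp0l.
  apply: is_diff_near_eq; apply: filterS (loc x xc) => y [y1 _].
  by rewrite /d' y1 mul0r.
- have [dd cg] := H x xc.
  have c1 := continuousZ (is_diff_continuous (is_diff_cut c rho x)) cg.
  have c2 := continuousZ (is_diff_continuous dd) (@continuous_cut_grad c rho x).
  exact: (continuousD c1 c2).
- have e0 : \forall y \near x, g' y = 0.
    by apply: filterS (loc x xc) => y [y1 y2]; rewrite /g' y1 y2 scale0r scaler0 addr0.
  rewrite /continuous_at (nbhs_singleton e0).
  move=> W /nbhs_singleton W0; suff : \forall y \near x, W (g' y) by [].
  by apply: filterS e0 => y ->.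
Qed.

End cutoff.

Lemma is_diff_eps (R : realType) (V W : normedModType R) (f df : V -> W) (x : V) (e : R) : is_diff x f df ->
  0 < e -> \forall y \near x, `|f y - f x - df (y - x)| <= e * `|y - x|.
Proof.
move=> dfx e0; have fx : differentiable f x by exact: ex_diff.
have := diff_locally fx => /eqaddoP/(_ e e0) H.
have c : {for x, continuous (fun y => y - x)}.
  by apply: continuousB; [exact: cvg_id|exact: cst_continuous].
have := c (fun h => `|(f \o shift x - (cst (f x) + 'd f x)) h| <= e * `|h|).
rewrite subrr => /(_ H); rewrite /= => {}H.
have {}H : \forall y \near x, `|(f \o shift x - (cst (f x) + 'd f x)) (y - x)| <= e * `|y - x|.
  exact: H.
apply: filterS H => y; rewrite !fctE /= subrK opprD addrA.
by rewrite diff_val.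
Qed.

Lemma is_diff_unique (R : realType) (V W : normedModType R) (f df df' : V -> W) (x : V) :
  is_diff x f df -> is_diff x f df' -> df = df'.
Proof. by move=> [_ <-] [_ <-]. Qed.

Lemma continuous_of_dist (R : realType) (V : topologicalType) (W : normedModType R) (f : V -> W) (x : V) :
  (forall e, 0 < e -> \forall y \near x, `|f x - f y| < e) -> {for x, continuous f}.
Proof. by move=> H; apply/cvgrPdist_lt => e e0; exact: H. Qed.

(** * Gradients of [W2oo] functions *)

Section gradients.
Context {R : realType} {n : nat}.
Local Notation E := 'rV[R]_n.+1.
Implicit Types (x y z : E) (U : set E) (f : E -> R).

Lemma enorm_le_norm x : enorm x <= n.+1%:R * `|x|.
Proof.
rewrite -(@ler_pXn2r _ 2)// ?nnegrE ?enorm_ge0 ?mulr_ge0//.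
rewrite sqr_enorm exprMn /dotp.
apply: (@le_trans _ _ (\sum_(i < n.+1) `|x| ^+ 2)).
  apply: ler_sum => i _; rewrite -expr2 -(real_normK (num_real (x 0 i))).
  by rewrite ler_pXn2r ?nnegrE// /Num.norm/= mx_normrE; exact: (le_bigmax _ (fun k => `|x k.1 k.2|) (0, i)).
rewrite sumr_const card_ord -[leLHS]mulr_natl ler_wpM2r ?sqr_ge0//.
by rewrite -natrX ler_nat expnS expn1 leq_pmulr.
Qed.

Lemma enorm_nbhs x e : 0 < e -> nbhs x [set y | enorm (y - x) < e].
Proof.
move=> e0; have c : {for x, continuous (fun y => enorm (y - x))}.
  have d := is_diffB (is_diff_id x) (is_diff_cst x x).
  exact: (cvg_enorm (is_diff_continuous d)).
by apply: (continuous_near_lt c); rewrite subrr enorm0.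
Qed.

Lemma nbhs_enorm x (W : set E) : nbhs x W ->
  exists2 e : R, 0 < e & forall y, enorm (y - x) < e -> W y.
Proof.
move=> /nbhs_ballP[e e0 eW]; exists e => // y yx; apply: eW.
by rewrite -ball_normE /= distrC; apply: le_lt_trans yx; exact: norm_le_enorm.
Qed.

Lemma is_diff_dotp_grad f x : differentiable f x -> is_diff x f (dotp (grad f x)).
Proof.
move=> fx; apply: DiffDef => //; apply/funext => v.
rewrite {1}(row_sum_delta v) linear_sum /dotp; apply: eq_bigr => i _.
by rewrite linearZ /= mxE deriveE// mulrC.
Qed.

(** [W2oo] provides Lipschitz bounds one direction at a time; those along the coordinate directions
    are gathered on a common neighbourhood and converted to the Euclidean norm. *)
Lemma W2oo_gradient U f x : open U -> W2oo U f -> U x ->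
  [/\ is_diff x f (dotp (grad f x)), {for x, continuous (grad f)} &
   exists k, exists2 B, nbhs x B & forall y z, B y -> B z ->
     enorm (grad f y - grad f z) <= k * enorm (y - z)].
Proof.
move=> oU [fd _ fL] Ux.
have [k [B Bx HB]] : exists k, exists2 B, nbhs x B & forall y z, B y -> B z ->
    enorm (grad f y - grad f z) <= k * enorm (y - z).
  have Hi (i : 'I_n.+1) : exists kB : R * set E, nbhs x kB.2 /\
      forall y z, kB.2 y -> kB.2 z ->
      `|'D_(delta_mx 0 i) f y - 'D_(delta_mx 0 i) f z| <= kB.1 * `|y - z|.
    have [_ [k Hk]] := fL (delta_mx 0 i); have [B nB kB] := Hk x Ux.
    by exists (k, B); split=> // y z By Bz; exact: (kB (y, z)).
  have [kB HkB] := choice Hi.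
  exists (n.+1%:R * \sum_i `|(kB i).1|), [set y | forall i, (kB i).2 y].
    exact: (@filter_forall _ _ (fun i => (kB i).2) (nbhs x) _ (fun i => (HkB i).1)).
  move=> y z By Bz; apply: le_trans (enorm_le_norm _) _.
  rewrite -mulrA ler_wpM2l//; rewrite {1}/Num.norm /= mx_normrE.
  apply: bigmax_le => [|[a i] _]; first by rewrite mulr_ge0 ?enorm_ge0// sumr_ge0.
  rewrite !mxE; apply: le_trans ((HkB i).2 y z (By i) (Bz i)) _.
  apply: (@le_trans _ _ (`|(kB i).1| * enorm (y - z))).
    apply: (@le_trans _ _ (`|(kB i).1| * `|y - z|)); first by rewrite ler_wpM2r ?ler_norm.
    by rewrite ler_wpM2l// norm_le_enorm.
  rewrite ler_wpM2r ?enorm_ge0// (bigD1 i)//= lerDl sumr_ge0//.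
split; [exact: is_diff_dotp_grad (fd x Ux)| |by exists k, B].
apply: continuous_of_dist => e e0.
have k1 : 0 < `|k| + 1 by rewrite ltr_wpDl.
have xB := nbhs_singleton Bx.
have nx := enorm_nbhs x (divr_gt0 e0 k1).
apply: filterS2 Bx nx => y By; rewrite /= ltr_pdivlMr// => yx.
apply: le_lt_trans (norm_le_enorm _) _.
apply: le_lt_trans (HB _ _ xB By) _.
apply: le_lt_trans yx; rewrite enormB mulrC ler_wpM2l ?enorm_ge0//.
by have := ler_norm k; lra.
Qed.

End gradients.

(** * Normals and tangential gradients *)

Section hypersurface.
Context {R : realType} {n : nat}.
Local Notation E := 'rV[R]_n.+1.
Context {Om1 Om2 H : set E}.
Hypothesis hg : geometry Om1 Om2 H.
Implicit Types (x y z tau : E).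

Lemma geometry_HOm1 z : H z -> ~ Om1 z.
Proof.
rewrite (geo_bdry1 hg) => -[_ ni] Oz; apply: ni.
by rewrite /interior; move: (geo_open1 hg); rewrite openE => /(_ _ Oz).
Qed.

Lemma geometry_HOm2 z : H z -> ~ Om2 z.
Proof.
rewrite (geo_bdry2 hg) => -[_ ni] Oz; apply: ni.
by rewrite /interior; move: (geo_open2 hg); rewrite openE => /(_ _ Oz).
Qed.

Lemma geometry_disj z : Om1 z -> ~ Om2 z.
Proof. by move=> O1 O2; have : (Om1 `&` Om2) z by []; rewrite (geo_disj hg). Qed.

Lemma geometry_cover z : [\/ Om1 z, Om2 z | H z].
Proof.
have : setT z by []; rewrite -(geo_cover hg) => -[[?|?]|?].
- exact: Or31.
- exact: Or32.
- exact: Or33.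
Qed.

Lemma geometry_closure1 z : H z -> closure Om1 z.
Proof. by rewrite (geo_bdry1 hg) => -[]. Qed.

Lemma geometry_closure2 z : H z -> closure Om2 z.
Proof. by rewrite (geo_bdry2 hg) => -[]. Qed.

Lemma geometry_closedH : closed H.
Proof.
rewrite (geo_bdry1 hg) /bdry setDE; apply: closedI; first exact: closed_closure.
by apply: open_closedC; exact: open_interior.
Qed.

Lemma edist_set_ge0 z : 0 <= edist_set H z.
Proof.
have [[y Hy]|H0] := pselect (H !=set0).
  by apply: lb_le_inf => [|_ [w _ <-]]; [exists (enorm (z - y)), y|exact: enorm_ge0].
rewrite /edist_set (_ : [set enorm (z - y) | y in H] = set0) ?inf0//.
by apply/seteqP; split=> [w [y Hy _]|//]; apply: H0; exists y.
Qed.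

Lemma edist_set_le z y : H y -> edist_set H z <= enorm (z - y).
Proof.
move=> Hy; apply: ge_inf; last by exists y.
by exists 0 => _ [w _ <-]; exact: enorm_ge0.
Qed.

Lemma edist_set_approx z e : H !=set0 -> 0 < e ->
  exists2 y, H y & enorm (z - y) < edist_set H z + e.
Proof.
move=> [y0 Hy0] e0; have hi : has_inf [set enorm (z - y) | y in H].
  split; first by exists (enorm (z - y0)), y0.
  by exists 0 => _ [w _ <-]; exact: enorm_ge0.
by have [_ [y Hy <-] lt] := inf_adherent e0 hi; exists y.
Qed.

Lemma edist_set_eq0 z : H z -> edist_set H z = 0.
Proof.
move=> Hz; apply/eqP; rewrite eq_le edist_set_ge0 andbT.
by apply: le_trans (edist_set_le z Hz) _; rewrite subrr enorm0.
Qed.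

Lemma edist_set_gt0 z : H !=set0 -> ~ H z -> 0 < edist_set H z.
Proof.
move=> [y0 Hy0] Hz; have : nbhs z (~` H).
  by move: (closed_openC geometry_closedH); rewrite openE => /(_ _ Hz).
move=> /nbhs_enorm[e e0 eH]; apply: (lt_le_trans e0).
apply: lb_le_inf => [|_ [y Hy <-]]; first by exists (enorm (z - y0)), y0.
by rewrite leNgt; apply/negP => yz; apply: (eH y) => //; rewrite enormB.
Qed.

Local Notation sd := (signed_dist Om1 H).

Lemma signed_dist_sign z : H !=set0 ->
  [/\ Om1 z -> sd z < 0, Om2 z -> 0 < sd z & H z -> sd z = 0].
Proof.
move=> H0; rewrite /signed_dist; split.
- move=> O1; rewrite mem_set// oppr_lt0 edist_set_gt0//.
  by move=> /geometry_HOm1.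
- move=> O2; rewrite memNset => [|/geometry_disj//].
  by rewrite edist_set_gt0// => /geometry_HOm2.
- move=> Hz; rewrite memNset; last exact: geometry_HOm1.
  exact: edist_set_eq0.
Qed.

Lemma signed_dist_lt0 z : H !=set0 -> sd z < 0 -> Om1 z.
Proof.
move=> H0; have [_ s2 s3] := signed_dist_sign z H0.
by case: (geometry_cover z) => // [/s2|/s3 ->]; [move=> /ltW|]; rewrite ?ltxx// leNgt => /negbTE ->.
Qed.

Lemma signed_dist_gt0 z : H !=set0 -> 0 < sd z -> Om2 z.
Proof.
move=> H0; have [s1 _ s3] := signed_dist_sign z H0.
by case: (geometry_cover z) => // [/s1|/s3 ->]; [move=> /ltW|]; rewrite ?ltxx// leNgt => /negbTE ->.
Qed.

Lemma signed_dist_eq0 z : H !=set0 -> sd z = 0 -> H z.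
Proof.
move=> H0 z0; have [s1 s2 _] := signed_dist_sign z H0.
by case: (geometry_cover z) => // [/s1|/s2]; rewrite z0 ltxx.
Qed.

(** * Tangent hyperplane and normal in the flattening chart *)

Section normal.
Context {x0 : E} {r : R} {Psi : E -> E}.
Hypothesis hPsi : W2oo_diffeo (eball x0 r) Psi.
Hypothesis flat : Psi @` (H `&` eball x0 r)
  = [set y : E | y 0 ord_max = 0] `&` Psi @` eball x0 r.

Lemma eball_open : open (eball x0 r).
Proof.
rewrite openE => z zr; rewrite /interior.
have e0 : 0 < r - enorm (z - x0) by rewrite subr_gt0.
apply: filterS (enorm_nbhs z e0) => y /= yz.
by apply: le_lt_trans (enorm_triang y z x0) _; rewrite /eball /=; lra.
Qed.

(** The curve is the image under [Phi] of the line [Psi z + s w] in the flat hyperplane, [w] being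
    the image of [tau] under the differential of [Psi]; as [Phi] inverts [Psi] near [z], its
    derivative is [tau]. *)
Lemma tangent_curve_of_flat z tau : H z -> eball x0 r z ->
  ('d Psi z tau) 0 ord_max = 0 -> tangent_space H z tau.
Proof.
move=> Hz zr w0; have [oP [Pd _ _] [Phi [PhiK [Phid _ _]]]] := hPsi.
set w := 'd Psi z tau in w0.
have dP : is_diff z Psi ('d Psi z) by apply: differentiableP; exact: Pd.
have PPz : (Psi @` eball x0 r) (Psi z) by exists z.
have dPhi : is_diff (Psi z) Phi ('d Phi (Psi z)) by apply: differentiableP; exact: Phid.
have dc := is_diff_comp dP dPhi.
have PhiPsi : 'd Phi (Psi z) w = tau.
  have nz : \forall y \near z, (Phi \o Psi) y = id y.
    have : nbhs z (eball x0 r) by move: eball_open; rewrite openE => /(_ _ zr).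
    by apply: filterS => y yr /=; exact: PhiK.
  have i1 := is_diff_near_eq nz dc.
  by have /(congr1 (fun f => f tau)) := is_diff_unique i1 (is_diff_id z).
pose line (s : R) := Psi z + s *: w.
have dl : is_diff (0 : R) line (fun s => s *: w).
  have := is_diffD (is_diff_cst (Psi z) (0 : R)) (is_diff_scalel (0 : R) w).
  by apply: is_diff_ext => // s; rewrite !fctE /= add0r.
have l0 : line 0 = Psi z by rewrite /line scale0r addr0.
exists (Phi \o line); split.
- by rewrite /= l0 PhiK.
- have dPhi' : is_diff (line 0) Phi ('d Phi (Psi z)) by rewrite l0.
  have d0 := is_diff_comp dl dPhi'.
  have df : differentiable (Phi \o line) (0 : R) by exact: ex_diff.
  apply: DeriveDef; first exact: diff_derivable.
  by rewrite deriveE// diff_val /= scale1r.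
- have cl : {for 0, continuous line} by exact: is_diff_continuous dl.
  have nP : nbhs (line 0) (Psi @` eball x0 r).
    by rewrite l0; move: oP; rewrite openE => /(_ _ PPz).
  have nl : \forall s \near (0 : R), (Psi @` eball x0 r) (line s) by exact: (cl _ nP).
  apply: filterS nl => s Ps.
  have : (Psi @` (H `&` eball x0 r)) (line s).
    rewrite flat; split=> //=; rewrite /line !mxE w0 mulr0 addr0.
    have : (Psi @` (H `&` eball x0 r)) (Psi z) by exists z.
    by rewrite flat => -[].
  by move=> [y [Hy yr] ly]; rewrite /= -ly PhiK.
Qed.

(** [m] is the gradient of the last coordinate of [Psi]. That coordinate vanishes on [H], so the
    expansion measures how far [H] is from its tangent hyperplane. *)
Lemma flat_gradient z : eball x0 r z ->
  exists2 m, forall tau, ('d Psi z tau) 0 ord_max = dotp m tau &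
   forall e, 0 < e -> \forall y \near z,
     `|(Psi y) 0 ord_max - (Psi z) 0 ord_max - dotp m (y - z)| <= e * enorm (y - z).
Proof.
move=> zr; have [_ [Pd _ _] _] := hPsi.
have dP : is_diff z Psi ('d Psi z) by apply: differentiableP; exact: Pd.
have dl : is_diff (Psi z) (fun y : E => y 0 ord_max) (fun y => y 0 ord_max).
  by apply: is_diff_lin => [a u v|]; [rewrite !mxE|exact: coord_continuous].
have dc := is_diff_comp dP dl.
have df : differentiable ((fun y : E => y 0 ord_max) \o Psi) z by exact: ex_diff.
have dg := is_diff_dotp_grad df.
have dE := is_diff_unique dc dg.
exists (grad ((fun y : E => y 0 ord_max) \o Psi) z).
  by move=> tau; have /(congr1 (fun f => f tau)) := dE.
move=> e e0; apply: filterS (is_diff_eps dg e0) => y /= H1.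
by apply: le_trans H1 _; rewrite ler_wpM2l ?norm_le_enorm// ltW.
Qed.

Section normal_vector.
Variables (z nu : E).
Hypotheses (Hz : H z) (zr : eball x0 r z).
Hypotheses (nu1 : enorm nu = 1)
  (nuT : forall tau, tangent_space H z tau -> dotp nu tau = 0).

(** The kernel of [m] is tangent, so [nu] is orthogonal to it and is a multiple of [m], with nonzero
    factor since [nu] is a unit vector. Orthogonality to [nu] then means being in that kernel. *)
Lemma tangent_space_orth tau : dotp nu tau = 0 -> tangent_space H z tau.
Proof.
move=> nt; have [m mE _] := flat_gradient zr.
apply: tangent_curve_of_flat => //; rewrite mE.
have ker t : dotp m t = 0 -> dotp nu t = 0.
  by move=> mt; apply: nuT; apply: tangent_curve_of_flat => //; rewrite mE.
have [mm|mm] := eqVneq (dotp m m) 0; first by rewrite (dotp_eq0 mm) dotp0l.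
pose c := dotp nu m / dotp m m.
have nuE : nu = c *: m.
  apply/eqP; rewrite -subr_eq0; apply/eqP/dotp_eq0.
  have mk : dotp m (nu - c *: m) = 0.
    by rewrite dotpBr dotpZr /c divfK// dotpC subrr.
  by rewrite dotpBl dotpZl mk mulr0 subr0; exact: ker.
have c0 : c != 0.
  apply/eqP => c0; move: nu1; rewrite nuE c0 scale0r enorm0 => /eqP.
  by rewrite eq_sym oner_eq0.
by move: nt; rewrite nuE dotpZl => /eqP; rewrite mulf_eq0 (negbTE c0) => /eqP.
Qed.

Lemma tangential_gradient_proj (f : E -> R) g : is_diff z f (dotp g) ->
  tangential_gradient H f z (g - dotp g nu *: nu).
Proof.
move=> df; split.
  apply: tangent_space_orth; rewrite dotpBr dotpZr dotpC.
  by rewrite -(sqr_enorm nu) nu1 expr1n mulr1 subrr.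
move=> gamma tau [g0 [dg1 dg2] gH].
have tt : tangent_space H z tau by exists gamma; split=> //; apply: DeriveDef.
have dgm : is_diff (0 : R) gamma ('d gamma (0 : R)).
  by apply: differentiableP; exact/derivable1_diffP.
have df' : is_diff (gamma 0) f (dotp g) by rewrite g0.
have dc := is_diff_comp dgm df'.
have dfd : differentiable (f \o gamma) (0 : R) by exact: ex_diff.
apply: DeriveDef; first exact: diff_derivable.
rewrite deriveE// diff_val /= -deriveE; last exact/derivable1_diffP.
by rewrite dg2 dotpBl dotpZl (nuT tt) mulr0 subr0.
Qed.

(** The part of [g] orthogonal to [nu] is tangent, hence orthogonal to [g] and to itself. Applied to
    the gradient of the signed distance and to [n2]. *)
Lemma normal_unique g : (forall tau, tangent_space H z tau -> dotp g tau = 0) ->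
  g = dotp g nu *: nu.
Proof.
move=> gT; apply/eqP; rewrite -subr_eq0; apply/eqP/dotp_eq0.
have nt : dotp nu (g - dotp g nu *: nu) = 0.
  by rewrite dotpBr dotpZr -(sqr_enorm nu) nu1 expr1n mulr1 dotpC subrr.
by rewrite dotpBl dotpZl nt mulr0 subr0; apply: gT; exact: tangent_space_orth.
Qed.

Hypothesis out : \forall s \near 0^'+, Om1 (z - s *: nu) /\ ~ closure Om1 (z + s *: nu).

(* [g] does not vanish: otherwise [edist_set H (z - s *: nu)] would be [o(s)],
   but [H] stays [o(s)]-close to its tangent hyperplane at [z]. *)
Lemma signed_dist_normal g : is_diff z sd (dotp g) ->
  exists2 lam, 0 < lam & g = lam *: nu.
Proof.
move=> dg; have H0 : H !=set0 by exists z.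
have [_ _ sz] := signed_dist_sign z H0; have {}sz := sz Hz.
have gE : g = dotp g nu *: nu.
  apply: normal_unique => tau [gamma [g0 [dg1 dg2] gH]].
  have dgm : is_diff (0 : R) gamma ('d gamma (0 : R)).
    by apply: differentiableP; exact/derivable1_diffP.
  have df' : is_diff (gamma 0) sd (dotp g) by rewrite g0.
  have dc := is_diff_comp dgm df'.
  have n0 : \forall s \near (0 : R), (sd \o gamma) s = cst 0 s.
    by apply: filterS gH => s Hs; have [_ _] := signed_dist_sign (gamma s) H0; exact.
  have dc' := is_diff_near_eq n0 dc.
  have /(congr1 (fun f => f 1)) /= := is_diff_unique dc' (is_diff_cst (0 : R) (0 : R)).
  rewrite -deriveE; last exact/derivable1_diffP.
  by rewrite dg2.
set lam := dotp g nu in gE *; exists lam => //.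
have [m mE meps] := flat_gradient zr.
(* Otherwise [nu] would be tangent, hence orthogonal to itself. *)
have mnu : dotp m nu != 0.
  apply/eqP => mn; have : tangent_space H z nu by apply: tangent_curve_of_flat; rewrite ?mE.
  by move=> /nuT; rewrite -sqr_enorm nu1 expr1n => /eqP; rewrite oner_eq0.
rewrite ltNge; apply/negP => lam0.
pose a := `|dotp m nu|; have a0 : 0 < a by rewrite normr_gt0.
pose M := enorm m; have M0 : 0 <= M by exact: enorm_ge0.
(* Chosen so that [e (2 M + 3) <= a / 2]; the final estimate is [a <= e (2 M + 3)]. *)
pose e := Num.min 1 (a / (2 * (2 * M + 3))).
have D0 : 0 < 2 * (2 * M + 3) by lra.
have e0 : 0 < e by rewrite lt_min ltr01 divr_gt0.
have e1 : e <= 1 by rewrite ge_min lexx.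
have ea : e * (2 * (2 * M + 3)) <= a.
  by rewrite -ler_pdivlMr// ge_min lexx orbT.
have [d1 d1p Hd1] := nbhs_enorm (meps e e0).
have [d2 d2p Hd2] := nbhs_enorm (is_diff_eps dg e0).
have [d3 d3p Hd3] : exists2 d3 : R, 0 < d3 & forall y, enorm (y - z) < d3 -> eball x0 r y.
  by apply: nbhs_enorm; move: eball_open; rewrite openE => /(_ _ zr).
pose D := Num.min d1 (Num.min d2 d3).
have Dp : 0 < D by rewrite !lt_min d1p d2p.
have Dd1 : D <= d1 by rewrite ge_min lexx.
have Dd2 : D <= d2 by rewrite !ge_min lexx orbT.
have Dd3 : D <= d3 by rewrite !ge_min lexx !orbT.
clearbody D.
have [s [[s0 sD] [zO _]]] : exists s, (0 < s /\ s < D / 4) /\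
    (Om1 (z - s *: nu) /\ ~ closure Om1 (z + s *: nu)).
  apply: (@filter_ex _ (0^'+)); apply: filterI out.
  by apply: filterI; [exact: nbhs_right_gt|apply: nbhs_right_lt; rewrite divr_gt0].
pose x := z - s *: nu.
have xz : enorm (x - z) = s.
  by rewrite /x addrC addKr enormN enormZ nu1 mulr1 gtr0_norm.
have xd2 : enorm (x - z) < d2.
  by rewrite xz; lra.
have := Hd2 x xd2; rewrite sz subr0.
rewrite (_ : dotp g (x - z) = - (lam * s)); last first.
  by rewrite /x addrC addKr dotpNr dotpZr gE dotpZl -sqr_enorm nu1 expr1n mulr1 mulrC.
rewrite /signed_dist mem_set// => H1.
(* In [Om1] the signed distance is minus the distance, so the expansion bounds the distance by
   [(lam + e) s]; [lam <= 0] enters here, which excludes negative [lam] together with zero. *)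
have edx : edist_set H x <= e * s.
  have : `|x - z| <= s by rewrite -xz norm_le_enorm.
  move=> /(ler_wpM2l (ltW e0)) H2; have := le_trans H1 H2.
  rewrite ler_norml => /andP[+ _]; have := mulr_le0_ge0 lam0 (ltW s0); lra.
have es0 : 0 < e * s by rewrite mulr_gt0.
have [y Hy yx] := edist_set_approx x H0 es0.
have yxs : enorm (y - x) <= 2 * (e * s) by rewrite enormB mulr_natl mulr2n (le_trans (ltW yx))// lerD2r.
have yz : enorm (y - z) <= 3 * s.
  have := enorm_triang y x z; rewrite xz; have := ler_wpM2r (ltW s0) e1; lra.
have yd1 : enorm (y - z) < d1 by lra.
have yr : eball x0 r y by apply: Hd3; lra.
have Psi0 w : H w -> eball x0 r w -> (Psi w) 0 ord_max = 0.
  move=> Hw wr; have : (Psi @` (H `&` eball x0 r)) (Psi w) by exists w.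
  by rewrite flat => -[].
have := Hd1 y yd1; rewrite !Psi0// subrr sub0r normrN.
have -> : dotp m (y - z) = dotp m (y - x) - s * dotp m nu.
  by rewrite /x !dotpBr dotpZr; ring.
move=> H3; have H4 : `|s * dotp m nu| <= e * enorm (y - z) + M * (2 * (e * s)).
  have -> : s * dotp m nu = dotp m (y - x) - (dotp m (y - x) - s * dotp m nu) by ring.
  apply: le_trans (ler_normB _ _) _; rewrite addrC lerD//.
  by apply: le_trans (dotp_abs _ _) _; rewrite ler_wpM2l.
rewrite normrM gtr0_norm// -/a in H4.
have H5 := ler_wpM2l (ltW e0) yz.
have : s * a <= s * (e * (2 * M + 3)) by lra.
by rewrite ler_pM2l//; nra.
Qed.

End normal_vector.
End normal.
End hypersurface.

(** * Local maxima of the difference *)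

Section test_function_rules.
Context {R : realType} {n : nat}.
Local Notation E := 'rV[R]_n.+1.
Implicit Types (X Y : E * R) (Q D : set (E * R)) (F : E -> R -> E -> R).

Context {tau tau' : E * R -> R}.
Hypothesis htau : C1_gradient tau (fun=> 0) tau'.

(** [tau] has zero space gradient; moved into the test function, it leaves the momentum unchanged
    and turns the inequality for [u] into one for [u - tau] with margin [tau']. *)
Lemma visc_sub_gradient Q D F u phi G A X : visc_sub Q D F u ->
  C1_gradient phi G A -> Q X -> D X ->
  (\forall Y \near X, u Y - tau Y - phi Y <= u X - tau X - phi X) ->
  A X + F X.1 X.2 (G X) <= - tau' X.
Proof.
move=> hu hphi QX DX H; have hp := C1_gradientD hphi htau.
have := hu _ (@C1_gradient_C1_on _ _ _ _ _ Q hp) X DX.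
rewrite (C1_gradient_Dt X hp) (C1_gradient_Dx X hp) addr0.
have loc : local_max_in Q (fun q => u q - (phi q + tau q)) X.
  split=> //; rewrite near_withinE; apply: filterS H => Y H _.
  by move: H; clear; lra.
by move=> /(_ loc); clear; lra.
Qed.

Lemma visc_super_gradient Q D F v phi G A X : visc_super Q D F v ->
  C1_gradient phi G A -> Q X -> D X ->
  (\forall Y \near X, v X - phi X <= v Y - phi Y) ->
  0 <= A X + F X.1 X.2 (G X).
Proof.
move=> hv hp QX DX H.
have := hv _ (@C1_gradient_C1_on _ _ _ _ _ Q hp) X DX.
rewrite (C1_gradient_Dt X hp) (C1_gradient_Dx X hp); apply.
by split=> //; rewrite near_withinE; apply: filterS H => Y H _.
Qed.

Lemma usc_in_subtau S (u : E * R -> R) : usc_on S u -> usc_in S (fun X => u X - tau X).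
Proof.
move=> hu; apply: (usc_inD hu); apply: continuous_usc_in => X _.
by have [d _ _] := C1_gradientN htau; exact: is_diff_continuous (d X).
Qed.

Lemma lsc_on_usc_in S (v : E * R -> R) : lsc_on S v -> usc_in S (fun X => - v X).
Proof.
move=> hv X SX a; rewrite ltrNl => /(hv X SX); apply: filterS => Y.
by rewrite ltrNl.
Qed.

Lemma modulus_small (ml : R -> R) : modulus ml -> forall e, 0 < e ->
  exists2 r : R, 0 < r & forall x, 0 <= x < r -> ml x <= e.
Proof.
move=> [m0 _ ml0] e e0.
have : \forall x \near 0^'+, ml x < e by exact: (cvgr_lt 0 ml0 e e0).
move=> [d /= d0 H]; exists d => // x /andP[].
rewrite le_eqVlt => /predU1P[<- _|x0 xd]; first by rewrite m0 ltW.
by apply/ltW/H => //=; rewrite sub0r normrN gtr0_norm.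
Qed.

Lemma no_max_away_from_interface (A : metricType R) (Om : set E) (T Mb Lb Ml : R) b l ml
    Q u v eta Xb :
  @control_C1 _ _ A Om T b Mb Lb -> control_C2 Om T l Ml ml -> [set: A] !=set0 ->
  open Om -> open Q -> (forall X, Q X -> X.2 \in `]0, T[) ->
  visc_sub Q (Om `*` `]0, T[) (hamiltonian b l) u ->
  visc_super Q (Om `*` `]0, T[) (hamiltonian b l) v ->
  usc_on (closure Q) u -> lsc_on (closure Q) v -> 0 < eta -> (forall X, eta <= tau' X) ->
  Q Xb -> Om Xb.1 ->
  (\forall X \near Xb, u X - tau X - v X <= u Xb - tau Xb - v Xb) -> False.
Proof.
move=> hC1 hC2 A0 oO oQ QT hu hv uu vv eta0 tau'_eta Qb Ob.
pose N := Q `&` [set X | Om X.1].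
have oN : open N.
  by apply: openI => //; apply: (open_comp (f := fst)) => // X _; exact: continuous_fst.
have NQ : N `<=` closure Q by move=> X [QX _]; exact: subset_closure.
have NO X : N X -> closure Om X.1 /\ X.2 \in `[0, T].
  move=> [QX OX]; split; first exact: subset_closure.
  by have := QT X QX; rewrite !in_itv/= => /andP[/ltW -> /ltW ->].
have ND X : N X -> (Om `*` `]0, T[) X by move=> [/QT QX OX]; split.
apply: (@interior_no_max _ _ N _ v eta (Num.max `|Lb| `|Mb|) ml (hamiltonian b l)) => //.
- exact: usc_inS NQ (usc_in_subtau uu).
- exact: usc_inS NQ (lsc_on_usc_in vv).
- exact: modulus_small (C2_modulus hC2).
- move=> X p p' /NO[OX TX]; apply: le_trans (hamiltonian_lip hC1 hC2 A0 p p' OX TX) _.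
  by rewrite lerD2l ler_wpM2r ?enorm_ge0// le_max ler_norm orbT.
- move=> X Y p /NO[OX TX] /NO[OY TY].
  apply: le_trans (hamiltonian_mod hC1 hC2 A0 p OX TX OY TY) _.
  rewrite lerD2r lerD2l ler_wpM2r ?enorm_ge0// ler_wpM2r ?pdist_ge0//.
  by rewrite le_max lexx.
- move=> phi G A' X hp NX H; apply: (@le_trans _ _ (- tau' X)); last by rewrite lerN2.
  by apply: (visc_sub_gradient hu hp NX.1) => //; exact: ND.
- move=> phi G A' X hp NX H.
  by apply: (visc_super_gradient hv hp NX.1) => //; exact: ND.
Qed.

End test_function_rules.

(** * Verification of the setting near an interface point *)

Section interface_maximum.
Context {R : realType} {n : nat}.
Local Notation E := 'rV[R]_n.+1.
Implicit Types (X Y : E * R) (Q : set (E * R)).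
Context {Om1 Om2 H : set E}.
Hypothesis hg : geometry Om1 Om2 H.

Local Notation sd := (signed_dist Om1 H).

Lemma local_defining_function x0 r z : H z -> eball x0 r z ->
  exists d nd (e k : R), [/\ forall x, is_diff x d (dotp (nd x)), continuous nd, 0 < e,
    forall x, enorm (x - z) < e -> eball x0 r x /\ d x = sd x &
    forall x y, enorm (x - z) < e -> enorm (y - z) < e ->
      enorm (nd x - nd y) <= k * enorm (x - y)].
Proof.
move=> Hz zr; have [U [oU HU] W] := geo_W2oo hg.
have [_ _ [k [B nB LB]]] := W2oo_gradient oU W (HU z Hz).
have nU : nbhs z U by move: oU; rewrite openE => /(_ _ (HU z Hz)).
have nr : nbhs z (eball x0 r) by move: (@eball_open _ _ x0 r); rewrite openE => /(_ _ zr).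
have [e0 e00 He0] := nbhs_enorm (nbhs_setI (nbhs_setI nU nB) nr).
(* [3 rho ^+ 2 < e0 ^+ 2], so the range required by [cutoff_C1] stays in the ball where the signed
   distance is regular. *)
pose rho := e0 / 2; have rho0 : 0 < rho by rewrite divr_gt0.
have small x : dotp (x - z) (x - z) < 3 * rho ^+ 2 ->
    is_diff x sd (dotp (grad sd x)) /\ {for x, continuous (grad sd)}.
  rewrite -sqr_enorm => xz; have [|[Ux _] _] := He0 x.
    rewrite -(ltr_pXn2r (_ : (0 < 2)%N)) ?nnegrE ?enorm_ge0 ?(ltW e00)//.
    by apply: lt_trans xz _; rewrite /rho; nra.
  by have [] := W2oo_gradient oU W Ux.
have [d [nd [dd cd dE]]] := cutoff_C1 rho0 small.
have inn x : enorm (x - z) < rho -> d x = sd x /\ nd x = grad sd x.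
  move=> xz; apply: dE => //; rewrite -sqr_enorm.
  by rewrite ler_pXn2r ?nnegrE ?enorm_ge0 ?(ltW rho0)// ltW.
have re0 : rho < e0 by rewrite /rho; lra.
exists d, nd, rho, k; split=> //.
- move=> x xz; have [-> _] := inn x xz; split=> //.
  by have [] := He0 x (lt_trans xz re0).
- move=> x y xz yz; have [_ ->] := inn x xz; have [_ ->] := inn y yz; apply: LB.
    by have [[]] := He0 x (lt_trans xz re0).
  by have [[]] := He0 y (lt_trans yz re0).
Qed.

(** (C4) speaks of points of the interface; this continuity, uniform in control and time, carries
    the normal speeds to nearby points, with [nd] in place of the normal. *)
Lemma normal_speed_near (A : metricType R) (Om : set E) (T Mb Lb : R) (b : E -> R -> A -> E)
    (nd : E -> E) z (e k del : R) :
  control_C1 Om T b Mb Lb -> closure Om z -> 0 < e -> 0 < del ->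
  (forall x, enorm (x - z) < e -> enorm (nd x - nd z) <= k * enorm (x - z)) ->
  exists2 e', 0 < e' & forall x t al, enorm (x - z) < e' -> closure Om x -> t \in `[0, T] ->
    `|dotp (b x t al) (nd x) - dotp (b z t al) (nd z)| <= del.
Proof.
move=> hC1 zO e0 del0 hk.
pose N := enorm (nd z) + `|k|; have N0 : 0 <= N by rewrite addr_ge0 ?enorm_ge0.
pose C := `|Lb| * N + `|Mb| * `|k| + 1.
have C0 : 0 < C by rewrite /C ltr_wpDl// addr_ge0// mulr_ge0.
exists (Num.min e (Num.min 1 (del / C))); first by rewrite !lt_min e0 ltr01 divr_gt0.
move=> x t al; rewrite !lt_min => /and3P[xe x1]; rewrite ltr_pdivlMr// => xC Ox tT.
have s0 := enorm_ge0 (x - z); have hkx := hk x xe.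
have hk' : enorm (nd x - nd z) <= `|k| * enorm (x - z).
  by apply: le_trans hkx _; rewrite ler_wpM2r// ler_norm.
have ndx : enorm (nd x) <= N.
  have := enormD (nd x - nd z) (nd z); rewrite subrK /N.
  have := ler_wpM2l (normr_ge0 k) (ltW x1); lra.
have -> : dotp (b x t al) (nd x) - dotp (b z t al) (nd z) =
    dotp (b x t al - b z t al) (nd x) + dotp (b z t al) (nd x - nd z).
  by rewrite dotpBl dotpBr; ring.
apply: le_trans (ler_normD _ _) _.
have h1 : `|dotp (b x t al - b z t al) (nd x)| <= `|Lb| * enorm (x - z) * N.
  apply: le_trans (dotp_abs _ _) _; apply: ler_pM; rewrite ?enorm_ge0//.
  apply: le_trans (C1_lipschitz hC1 al Ox zO tT tT) _.
  by rewrite subrr normr0 addr0 ler_wpM2r// ler_norm.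
have h2 : `|dotp (b z t al) (nd x - nd z)| <= `|Mb| * (`|k| * enorm (x - z)).
  apply: le_trans (dotp_abs _ _) _; apply: ler_pM; rewrite ?enorm_ge0//.
  exact: le_trans (C1_bounded hC1 al zO tT) (ler_norm _).
by move: xC; rewrite /C; move: h1 h2 s0; clear; lra.
Qed.

Context {x0 : E} {r : R} {Psi : E -> E} {n1 n2 : E -> E}.
Hypothesis hPsi : W2oo_diffeo (eball x0 r) Psi.
Hypothesis flat : Psi @` (H `&` eball x0 r)
  = [set y : E | y 0 ord_max = 0] `&` Psi @` eball x0 r.
Hypothesis hn1 : forall z, H z -> outward_unit_normal H Om1 z (n1 z).
Hypothesis hn2 : forall z, H z -> outward_unit_normal H Om2 z (n2 z).

(** [n2 = c n1] with [c ^+ 2 = 1], and the interval is symmetric, so either sign of [c] gives the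
    same condition. *)
Lemma control_C4_transfer (A : Type) (T delta : R) (b : E -> R -> A -> E) z s :
  control_C4 H T b n2 delta -> 0 < delta -> H z -> eball x0 r z -> s \in `[0, T] ->
  `[- delta, delta] `<=` [set dotp (b z s a) (n1 z) | a in [set: A]].
Proof.
move=> hb del0 Hz zr sT y yd.
have [n11 n1T _] := hn1 Hz; have [n21 n2T _] := hn2 Hz.
have nE := normal_unique hPsi flat Hz zr n11 n1T n2T.
set c := dotp (n2 z) (n1 z) in nE.
have c2 : c * c = 1.
  have : enorm (n2 z) ^+ 2 = 1 by rewrite n21 expr1n.
  by rewrite sqr_enorm nE dotpZl dotpZr -sqr_enorm n11 expr1n mulr1.
have cyd : (c * y) \in `[- delta, delta].
  have : (c - 1) * (c + 1) = 0 by rewrite mulrBl mulrDr c2; ring.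
  move=> /eqP; rewrite mulf_eq0 => /orP[/eqP c1|/eqP c1].
    by rewrite (_ : c = 1) ?mul1r//; lra.
  rewrite (_ : c = -1); last lra.
  by move: yd; rewrite /= !in_itv/= => /andP[y1 y2]; apply/andP; split; lra.
have [al _ ab] := hb z s Hz sT _ cyd; exists al => //.
by rewrite -[RHS]mul1r -c2 -mulrA -ab nE dotpZr mulrA c2 mul1r.
Qed.

Context {T Mb Lb Ml delta : R} {ml : R -> R} {A1 A2 : metricType R}
  {b1 : E -> R -> A1 -> E} {b2 : E -> R -> A2 -> E}
  {l1 : E -> R -> A1 -> R} {l2 : E -> R -> A2 -> R}.
Hypotheses (hb1 : control_C1 Om1 T b1 Mb Lb) (hb2 : control_C1 Om2 T b2 Mb Lb).
Hypotheses (hl1 : control_C2 Om1 T l1 Ml ml) (hl2 : control_C2 Om2 T l2 Ml ml).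
Hypotheses (hc1 : control_C3 Om1 T b1 l1) (hc2 : control_C3 Om2 T b2 l2).
Hypotheses (delta0 : 0 < delta).
Hypotheses (hd1 : control_C4 H T b1 n1 delta) (hd2 : control_C4 H T b2 n2 delta).
Hypotheses (A10 : [set: A1] !=set0) (A20 : [set: A2] !=set0).

Lemma transversality (A : Type) (b : E -> R -> A -> E) z s lam :
  `[- delta, delta] `<=` [set dotp (b z s a) (n1 z) | a in [set: A]] ->
  (exists al, dotp (b z s al) (lam *: n1 z) = lam * delta) /\
  (exists al, dotp (b z s al) (lam *: n1 z) = - (lam * delta)).
Proof.
move=> hb; have dd : - delta <= delta by move: delta0; lra.
split.
  have [|al _ ab] := hb delta; first by rewrite /= in_itv/= dd lexx.
  by exists al; rewrite dotpZr ab.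
have [|al _ ab] := hb (- delta); first by rewrite /= in_itv/= dd lexx.
by exists al; rewrite dotpZr ab mulrN.
Qed.

Let H1 := hamiltonian b1 l1.
Let H2 := hamiltonian b2 l2.
Let HT := tangential_hamiltonian b1 b2 l1 l2 n1.

Context {tau tau' : E * R -> R} {Q : set (E * R)} {u v : E * R -> R} {eta : R}.
Hypothesis htau : C1_gradient tau (fun=> 0) tau'.
Hypotheses (oQ : open Q) (QT : forall X, Q X -> X.2 \in `]0, T[).
Hypotheses (hu : subsolution_Hminus Om1 Om2 H T H1 H2 HT Q u)
  (hv : supersolution_Hminus Om1 Om2 H T H1 H2 Q v).
Hypotheses (eta0 : 0 < eta) (tau'_eta : forall X, eta <= tau' X).

(** [tangential_slope] starts from the tangential part [g] of [G X]; the removed normal part and the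
    factor [lam] between [nd] and [n1] are absorbed in the slope. *)
Lemma tangential_rule phi G A X nd lam : C1_gradient phi G A -> Q X -> H X.1 ->
  eball x0 r X.1 -> lam != 0 -> nd = lam *: n1 X.1 ->
  (\forall Y \near X, Q Y -> H Y.1 -> u Y - tau Y - phi Y <= u X - tau X - phi X) ->
  exists q, A X + H2 X.1 X.2 (G X + q *: nd) <= - eta /\
            A X + H1 X.1 X.2 (G X + q *: nd) <= - eta.
Proof.
move=> hphi QX HX Xr lam0 ndE Hmax.
have hp := C1_gradientD hphi htau; have XT := QT QX.
have XT' : X.2 \in `[0, T] by move: XT; rewrite !in_itv/= => /andP[/ltW -> /ltW ->].
have [n11 n1T _] := hn1 HX; have ds := C1_gradient_slice X hp.
have tg := tangential_gradient_proj hPsi flat HX Xr n11 n1T ds.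
have loc : local_max_in (Q `&` (H `*` `]0, T[)) (fun q => u q - (phi q + tau q)) X.
  split=> //; rewrite near_withinE; apply: filterS Hmax => Y HY [QY [HY1 _]].
  by have := HY QY HY1; lra.
have hC : C1_on_sub (H `*` `[0, T]) (fun q => phi q + tau q).
  move=> p _; exists setT, (fun q => phi q + tau q); split=> //; first exact: openT.
  exact: C1_gradient_C1_on hp.
have := sub_HT hu hC loc tg; rewrite (C1_gradient_Dt X hp) addr0.
set g := G X - _ => hle.
have [p1 p2] := transversality 1 (hd1 HX XT').
rewrite scale1r mul1r in p1 p2.
have {}p1 : exists al, 0 < dotp (b1 X.1 X.2 al) (n1 X.1).
  by have [al e] := p1; exists al; rewrite e; exact: delta0.
have {}p2 : exists al, dotp (b1 X.1 X.2 al) (n1 X.1) < 0.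
  by have [al e] := p2; exists al; rewrite e oppr_lt0; exact: delta0.
have [q [q1 q2]] := tangential_slope hb1 hb2 hl1 hl2 hc1 hc2 A10 A20 g
  (geometry_closure1 hg HX) (geometry_closure2 hg HX) XT' p1 p2.
exists ((q - dotp (G X) (n1 X.1)) / lam).
have -> : G X + ((q - dotp (G X) (n1 X.1)) / lam) *: nd = g + q *: n1 X.1.
  rewrite /g ndE scalerA divfK// -addrA -scaleNr -scalerDl.
  by rewrite (addrC (- _)).
by have := tau'_eta X; rewrite /H1 /H2 /HT in hle *; move: q1 q2 hle; split; lra.
Qed.

Lemma interface_no_max Xb : Q Xb -> H Xb.1 -> eball x0 r Xb.1 ->
  (\forall X \near Xb, u X - tau X - v X <= u Xb - tau Xb - v Xb) -> False.
Proof.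
move=> Qb Hb rb Hmax; have bT' : Xb.2 \in `[0, T].
  by have := QT Qb; rewrite !in_itv/= => /andP[/ltW -> /ltW ->].
have H0 : H !=set0 by exists Xb.1.
have [d [nd [e [k [dd cd e0 dE kL]]]]] := local_defining_function Hb rb.
have near_sd z : enorm (z - Xb.1) < e -> is_diff z sd (dotp (nd z)).
  move=> ze; apply: (is_diff_near_eq _ (dd z)).
  have ez : 0 < e - enorm (z - Xb.1) by rewrite subr_gt0.
  apply: filterS (enorm_nbhs z ez) => y /= yz; have [] := dE y => //.
  by have := enorm_triang y z Xb.1; move: yz; lra.
have normal z : H z -> enorm (z - Xb.1) < e -> exists2 lam, 0 < lam & nd z = lam *: n1 z.
  move=> Hz ze; have [zr _] := dE z ze; have [n11 n1T out] := hn1 Hz.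
  exact: (signed_dist_normal hg hPsi flat Hz zr n11 n1T out (near_sd z ze)).
have xx : enorm (Xb.1 - Xb.1) < e by rewrite subrr enorm0.
have [lam lam0 ndb] := normal _ Hb xx.
(* The speeds along [nd] reach [lam * delta] in both directions at [Xb]; half of it remains at
   nearby points. *)
pose del := lam * delta / 2.
have del0' : 0 < del by rewrite divr_gt0// mulr_gt0//; exact: delta0.
have ndL z : enorm (z - Xb.1) < e -> enorm (nd z - nd Xb.1) <= k * enorm (z - Xb.1).
  by move=> ze; exact: kL.
have [e1 e10 He1] := normal_speed_near hb1 (geometry_closure1 hg Hb) e0 del0' ndL.
have [e2 e20 He2] := normal_speed_near hb2 (geometry_closure2 hg Hb) e0 del0' ndL.
(* The bound by 1 gives [|nd X| <= |k| + |nd Xb|]. *)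
pose e' := Num.min 1 (Num.min e (Num.min e1 e2)).
have e'0 : 0 < e' by rewrite !lt_min ltr01 e0 e10 e20.
have e'P z : enorm (z - Xb.1) < e' -> [/\ enorm (z - Xb.1) < 1, enorm (z - Xb.1) < e,
    enorm (z - Xb.1) < e1 & enorm (z - Xb.1) < e2].
  by rewrite !lt_min => /and4P[].
clearbody e'.
pose N := Q `&` [set X | enorm (X.1 - Xb.1) < e'].
have oN : open N.
  apply: openI => //; apply: (@open_comp _ _ fst [set y | enorm (y - Xb.1) < e']).
    by move=> X _; exact: continuous_fst.
  exact: eball_open.
pose M : R := `|Mb| + `|Lb| + `|Ml| + `|k| + enorm (nd Xb.1).
have [M1 M2 M3 M4 M5] : [/\ `|Mb| <= M, `|Lb| <= M, `|Ml| <= M, `|k| <= M &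
    `|k| + enorm (nd Xb.1) <= M].
  have := enorm_ge0 (nd Xb.1); have := normr_ge0 Mb; have := normr_ge0 Lb.
  have := normr_ge0 Ml; have := normr_ge0 k; rewrite /M; split; lra.
clearbody M; have M0 : 0 <= M by exact: le_trans (normr_ge0 _) M1.
have NT X : N X -> X.2 \in `]0, T[ by move=> [QX _]; exact: QT.
have NT' X : N X -> X.2 \in `[0, T].
  by move=> /NT; rewrite !in_itv/= => /andP[/ltW -> /ltW ->].
have NdE X : N X -> d X.1 = sd X.1 by move=> [_ /e'P[_ /dE[]]].
have Nr X : N X -> eball x0 r X.1 by move=> [_ /e'P[_ /dE[]]].
have NO1 X : N X -> d X.1 < 0 -> Om1 X.1.
  by move=> NX; rewrite NdE// => dX; exact: (signed_dist_lt0 hg H0 dX).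
have NO2 X : N X -> 0 < d X.1 -> Om2 X.1.
  by move=> NX; rewrite NdE// => dX; exact: (signed_dist_gt0 hg H0 dX).
have NH X : N X -> d X.1 = 0 -> H X.1.
  by move=> NX; rewrite NdE// => dX; exact: (signed_dist_eq0 hg H0 dX).
have NQ : N `<=` closure Q by move=> X [QX _]; exact: subset_closure.
have trans (A : Type) (b : E -> R -> A -> E) X : X.2 \in `[0, T] ->
    `[- delta, delta] `<=` [set dotp (b Xb.1 X.2 a) (n1 Xb.1) | a in [set: A]] ->
    (forall al, `|dotp (b X.1 X.2 al) (nd X.1) - dotp (b Xb.1 X.2 al) (nd Xb.1)| <= del) ->
    (exists al, del <= dotp (b X.1 X.2 al) (nd X.1)) /\
    (exists al, dotp (b X.1 X.2 al) (nd X.1) <= - del).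
  move=> XT hb hbX; have [] := transversality lam hb; rewrite -ndb => -[al h1] [be h2].
  split; [exists al|exists be].
    by have := hbX al; rewrite h1 ler_norml => /andP[+ _]; rewrite /del; lra.
  by have := hbX be; rewrite h2 ler_norml => /andP[_ +]; rewrite /del; lra.
(* The signed distance is positive in [Om2], so [H2] belongs to the side [d > 0] and [H1] to
   [d < 0]. *)
apply: (@setting_no_max _ _ N (fun X => u X - tau X) v eta M del ml d nd H2 H1 Xb) => //.
split=> //.
- exact: usc_inS NQ (usc_in_subtau htau (sub_usc hu)).
- exact: usc_inS NQ (lsc_on_usc_in (super_lsc hv)).
- exact: modulus_small (C2_modulus hl1).
- exact: C1_gradient_fst.
- move=> X [_ /e'P[X1 Xe _ _]]; apply: le_trans M5.
  have := enormD (nd X.1 - nd Xb.1) (nd Xb.1); rewrite subrK => /le_trans; apply.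
  rewrite lerD2r; apply: le_trans (ndL _ Xe) _.
  apply: (@le_trans _ _ (`|k| * enorm (X.1 - Xb.1))).
    by rewrite ler_wpM2r ?enorm_ge0// ler_norm.
  by rewrite ler_piMr// ltW.
- move=> X Y [_ /e'P[_ Xe _ _]] [_ /e'P[_ Ye _ _]]; apply: le_trans (kL _ _ Xe Ye) _.
  by rewrite ler_wpM2r ?enorm_ge0// (le_trans (ler_norm _)).
- apply: (hamiltonian_ham_on hb2 hl2) => //.
  + move=> X [NX]; rewrite /= le_eqVlt => /predU1P[/esym/(NH _ NX) HX|/(NO2 _ NX) OX].
      by split; [exact: (geometry_closure2 hg)|exact: NT'].
    by split; [exact: subset_closure|exact: NT'].
  + exact: le_trans (ler_norm _) M1.
  + exact: le_trans (ler_norm _) M3.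
  + move=> X [NX dX]; apply: trans; first exact: NT'.
      exact: control_C4_transfer hd2 _ Hb rb (NT' _ NX).
    move=> al; apply: He2; [by case: NX => _ /e'P[]| |exact: NT'].
    move: dX; rewrite /= le_eqVlt => /predU1P[/esym/(NH _ NX)|/(NO2 _ NX)].
      exact: (geometry_closure2 hg).
    exact: subset_closure.
- apply: (hamiltonian_ham_on hb1 hl1) => //.
  + move=> X [NX]; rewrite /= le_eqVlt => /predU1P[/(NH _ NX) HX|/(NO1 _ NX) OX].
      by split; [exact: (geometry_closure1 hg)|exact: NT'].
    by split; [exact: subset_closure|exact: NT'].
  + exact: le_trans (ler_norm _) M1.
  + exact: le_trans (ler_norm _) M3.
  + move=> X [NX dX]; apply: trans; first exact: NT'.
      exact: hd1 Hb (NT' _ NX).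
    move=> al; apply: He1; [by case: NX => _ /e'P[]| |exact: NT'].
    move: dX; rewrite /= le_eqVlt => /predU1P[/(NH _ NX)|/(NO1 _ NX)].
      exact: (geometry_closure1 hg).
    exact: subset_closure.
- move=> phi G A X hp NX dX Hm; apply: (@le_trans _ _ (- tau' X)); last by rewrite lerN2.
  apply: (visc_sub_gradient htau (sub_Om2 hu) hp NX.1) => //.
  by split; [exact: NO2|exact: NT].
- move=> phi G A X hp NX dX Hm; apply: (@le_trans _ _ (- tau' X)); last by rewrite lerN2.
  apply: (visc_sub_gradient htau (sub_Om1 hu) hp NX.1) => //.
  by split; [exact: NO1|exact: NT].
- move=> phi G A X hp NX dX Hm; apply: (@le_trans _ _ (- tau' X)); last by rewrite lerN2.
  rewrite minC; apply: (visc_sub_gradient htau (sub_H hu) hp NX.1) => //.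
  by split; [exact: NH|exact: NT].
- move=> phi G A X hp NX dX Hm; apply: (visc_super_gradient (super_Om2 hv) hp NX.1) => //.
  by split; [exact: NO2|exact: NT].
- move=> phi G A X hp NX dX Hm; apply: (visc_super_gradient (super_Om1 hv) hp NX.1) => //.
  by split; [exact: NO1|exact: NT].
- move=> phi G A X hp NX dX Hm; rewrite maxC.
  apply: (visc_super_gradient (super_H hv) hp NX.1) => //.
  by split; [exact: NH|exact: NT].
- move=> phi G A X hp NX dX Hm; have HX := NH X NX dX.
  have [_ /e'P[_ Xe _ _]] := NX; have [lamX lamX0 ndX] := normal _ HX Xe.
  apply: (tangential_rule hp NX.1 HX (Nr X NX) _ ndX); first by rewrite gt_eqF.
  have nN : nbhs X N by move: oN; rewrite openE => /(_ _ NX).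
  apply: filterS2 nN Hm => Y NY HY QY HY1; apply: HY.
  by rewrite NdE//; have [_ _] := signed_dist_sign hg Y.1 H0; exact.
by split=> //=; rewrite subrr enorm0.
Qed.

End interface_maximum.

(** * Maximum principle on the cylinder *)

Lemma open_setX (U V : topologicalType) (A : set U) (B : set V) :
  open A -> open B -> open (A `*` B).
Proof.
move=> oA oB; rewrite openE => -[x y] [Ax By]; exists (A, B) => //.
by split; exact: open_nbhs_nbhs.
Qed.

Section parabolic_cylinder.
Context {R : realType} {n : nat}.
Local Notation E := 'rV[R]_n.+1.
Implicit Types (X Y : E * R).
Variables (x0 : E) (r t0 h : R).
Hypotheses (r0 : 0 < r) (h0 : 0 < h).

Local Notation Q := (Qcyl x0 r t0 h).

Lemma Qcyl_open : open Q.
Proof. by apply: open_setX; [exact: eball_open|exact: interval_open]. Qed.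

Lemma compact_closed_eball : compact [set x : E | enorm (x - x0) <= r].
Proof.
apply: bounded_closed_compact.
  exists (enorm x0 + r); split; first exact: num_real.
  move=> M rM x /= xr; apply: le_trans (norm_le_enorm _) _.
  by have := enormD (x - x0) x0; rewrite subrK; move: r0 => _; lra.
rewrite (_ : [set _ | _] = ~` [set x | r < enorm (x - x0)]); last first.
  by apply/seteqP; split=> x /=; rewrite leNgt => /negP.
apply: open_closedC; rewrite openE => x /= xr.
have xr' : 0 < enorm (x - x0) - r by rewrite subr_gt0.
apply: filterS (enorm_nbhs x xr') => y /= yx.
by have := enorm_triang x y x0; rewrite (enormB x y); move: r0 => _; lra.
Qed.

(** Contraction towards the centre [(x0, t0 - h / 2)] brings [X] into the open cylinder. *)
Lemma closure_Qcyl X : enorm (X.1 - x0) <= r -> t0 - h <= X.2 <= t0 -> closure Q X.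
Proof.
move=> Xr /andP[t1 t2] B nB; pose m := t0 - h / 2.
pose Y (s : R) : E * R := (X.1 + s *: (x0 - X.1), X.2 + s * (m - X.2)).
have d1 := is_diffD (is_diff_cst X.1 (0 : R)) (is_diff_scalel (0 : R) (x0 - X.1)).
have d2 := is_diffD (is_diff_cst X.2 (0 : R)) (is_diff_scalel (0 : R) (m - X.2 : R^o)).
have cY : {for 0, continuous Y} := is_diff_continuous (is_diff_pair d1 d2).
have Y0 : Y 0 = X by rewrite /Y scale0r mul0r !addr0 -surjective_pairing.
have nY : \forall s \near (0 : R), B (Y s) by apply: (cY B); rewrite Y0.
have nY' : \forall s \near 0^'+, B (Y s) by exact: cvg_within nY.
have [s [BY [s0 s1]]] : exists s, B (Y s) /\ (0 < s /\ s < 1).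
  apply: (@filter_ex _ (0^'+)); apply: filterI nY' _.
  by apply: filterI; [exact: nbhs_right_gt|exact: nbhs_right_lt].
exists (Y s); split=> //; split.
  rewrite /eball /= (_ : _ - x0 = (1 - s) *: (X.1 - x0)); last first.
    by apply/rowP => i; rewrite !mxE; ring.
  rewrite enormZ gtr0_norm ?subr_gt0//.
  have s1' : 0 <= 1 - s by rewrite subr_ge0 ltW.
  by have := ler_wpM2l s1' Xr; have := mulr_gt0 s0 r0; lra.
rewrite /Y /= in_itv /=; have := mulr_gt0 s0 h0; rewrite /m => sh.
have s1' : 0 <= 1 - s by rewrite subr_ge0 ltW.
by apply/andP; split; have := ler_wpM2l s1' t1; have := ler_wpM2l s1' t2; lra.
Qed.

Lemma bdry_eball x : enorm (x - x0) = r -> bdry (eball x0 r) x.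
Proof.
move=> xr; split; last by move=> /interior_subset; rewrite /eball /= xr ltxx.
have := @closure_Qcyl (x, t0); rewrite /= xr => /(_ (lexx _)).
have -> : t0 - h <= t0 <= t0 by rewrite lexx andbT lerBlDr lerDl ltW.
move=> /(_ isT) H B nB.
have [|[y t] [[yr _] [By _]]] := H (B `*` setT); last by exists y.
by exists (B, setT) => //; split=> //; exact: filterT.
Qed.

Section maximum_principle.
Context {u v : E * R -> R}.
Hypotheses (bu : [bounded u p | p in closure Q]) (bv : [bounded v p | p in closure Q]).
Hypotheses (uu : usc_on (closure Q) u) (vv : lsc_on (closure Q) v).
Hypothesis no_max : forall tau tau' eta X, C1_gradient tau (fun=> 0) tau' -> 0 < eta ->
  (forall X, eta <= tau' X) -> Q X ->
  (\forall Y \near X, u Y - tau Y - v Y <= u X - tau X - v X) -> False.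

(** The top of the cylinder is outside the parabolic boundary, so a maximum there must be prevented
    by [tau]. Its linear part gives the strict margin [eta]; the other part vanishes up to the time
    of [p] and dominates [u - v] at a time [t' < t0]. *)
Lemma penalized_maximum_principle m p : 0 <= m ->
  (forall X, parabolic_bdry x0 r t0 h X -> u X - v X <= m) -> Q p -> u p - v p <= m.
Proof.
move=> m0 hP Qp; rewrite leNgt; apply/negP => mp.
have [p1 p2] : enorm (p.1 - x0) < r /\ t0 - h < p.2 < t0.
  by case: Qp; rewrite /= in_itv.
have [C C0 [uC vC]] : exists2 C : R, 0 <= C & (forall X, closure Q X -> `|u X| <= C) /\
    (forall X, closure Q X -> `|v X| <= C).
  have [Cu [_ Hu]] := bu; have [Cv [_ Hv]] := bv.
  exists (Num.max 0 (Num.max (Cu + 1) (Cv + 1))); first by rewrite le_max lexx.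
  split=> X XQ; [apply: (Hu (Num.max 0 (Num.max (Cu + 1) (Cv + 1))))|
    apply: (Hv (Num.max 0 (Num.max (Cu + 1) (Cv + 1))))] => //;
    by rewrite !lt_max !ltrDl ltr01 !orbT.
pose ga := u p - v p - m; have ga0 : 0 < ga by rewrite subr_gt0.
(* At [p] the linear part is at most [eta h = ga / 2], so the penalized value stays above [m]. *)
pose eta := ga / (2 * h); have eta0 : 0 < eta by rewrite divr_gt0// mulr_gt0.
pose t' := (p.2 + t0) / 2.
have [pt tt] : p.2 < t' /\ t' < t0.
  by case/andP: p2 => _ p2; rewrite /t'; split; move: p2; lra.
(* At [t'] the penalty is at least [2 C + 1] while [u - v <= 2 C]; the value there is negative,
   hence below [m >= 0]. *)
pose L : R := (2 * C + 1) / (t' - p.2) ^+ 2.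
have L0 : 0 < L by rewrite divr_gt0 ?exprn_gt0 ?subr_gt0// ltr_wpDl// mulr_ge0.
pose g (t : R) := eta * (t - (t0 - h)) + L * sqp (t - p.2).
pose g' (t : R) := eta + L * (2 * Num.max (t - p.2) 0).
have dg (t : R) : is_derive t 1 g (g' t).
  have ds (c : R) : is_derive t 1 (fun s : R => s - c) 1.
    by have := is_deriveB (is_derive_id t 1) (is_derive_cst c t 1); rewrite subr0.
  have d1 := is_deriveZ eta (ds (t0 - h)).
  have d2 := is_deriveZ L (@is_derive1_comp R sqp (fun s => s - p.2) t _ _ (is_derive_sqp _) (ds p.2)).
  have := is_deriveD d1 d2.
  by rewrite /g' /GRing.scale /= !mulr1.
have cg : continuous g'.
  move=> t; have cc (a : R) : {for t, continuous (fun _ : R => a)} by exact: cst_continuous.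
  have c1 : {for t, continuous (fun t : R => Num.max (t - p.2) 0)}.
    exact: (@continuous_comp _ _ _ (fun t : R => t - p.2) (fun x : R => Num.max x 0) t
      (continuousB (@cvg_id _ _) (cc p.2)) (@continuous_max0 R _)).
  exact: (continuousD (cc eta) (continuousM (cc L) (continuousM (cc 2) c1))).
have htau : C1_gradient (fun X : E * R => g X.2) (fun=> 0) (fun X => g' X.2).
  have := C1_gradient_comp dg cg (@C1_gradient_snd R n).
  by congr C1_gradient; apply/funext => X; rewrite ?scaler0 ?mulr1.
pose K : set (E * R) := [set x | enorm (x - x0) <= r] `*` `[t0 - h, t'].
have KQ : K `<=` closure Q.
  move=> X [X1]; rewrite /= in_itv /= => /andP[X2 X3]; apply: closure_Qcyl => //.
  by rewrite X2 (le_trans X3)// ltW.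
have Kp : K p.
  split; rewrite /= ?(ltW p1)// in_itv /=; case/andP: p2 => a b.
  by rewrite (ltW a) (ltW pt).
have cK : compact K by apply: compact_setX; [exact: compact_closed_eball|exact: segment_compact].
have uK : usc_in K (fun X => u X - g X.2 - v X).
  apply: usc_inS KQ _; apply: usc_inD (lsc_on_usc_in vv).
  exact: (usc_in_subtau htau uu).
have [Z KZ Zmax] := compact_usc_max cK (ex_intro _ p Kp) uK.
have Zm : m < u Z - g Z.2 - v Z.
  apply: lt_le_trans (Zmax p Kp).
  rewrite /g subrr sqp_neg// mulr0 addr0.
  have : eta * (p.2 - (t0 - h)) <= eta * h.
    by rewrite ler_wpM2l ?(ltW eta0)//; case/andP: p2 => _; lra.
  have -> : eta * h = ga / 2 by rewrite /eta; field; rewrite gt_eqF.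
  by move: ga0; rewrite /ga; lra.
have [Z1 Z2] := KZ; move: Z2; rewrite /= in_itv /= => /andP[Z2 Z3]; rewrite /= in Z1.
have g0 : 0 <= g Z.2.
  have Z2' : 0 <= Z.2 - (t0 - h) by rewrite subr_ge0.
  by rewrite addr_ge0// mulr_ge0 ?sqp_ge0 ?(ltW eta0) ?(ltW L0).
have nP : ~ parabolic_bdry x0 r t0 h Z by move=> /hP; move: Zm g0; lra.
have Zr : enorm (Z.1 - x0) < r.
  rewrite lt_neqAle Z1 andbT; apply/eqP => Zr; apply: nP; right; split.
    exact: bdry_eball.
  by rewrite /= in_itv /= Z2 (le_lt_trans Z3).
have Zh : t0 - h < Z.2.
  by rewrite lt_neqAle Z2 andbT; apply/eqP => Zh; apply: nP; left; split.
have Zt : Z.2 < t'.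
  rewrite lt_neqAle Z3 andbT; apply/eqP => Zt; move: Zm; apply/negP; rewrite -leNgt.
  have ZQ := KQ _ KZ; have := uC Z ZQ; have := vC Z ZQ.
  rewrite !ler_norml => /andP[v1 _] /andP[_ u1].
  have : 2 * C + 1 <= g Z.2.
    rewrite /g Zt sqp_pos ?subr_ge0 ?(ltW pt)// /L divfK ?lerDr.
      by rewrite mulr_ge0 ?(ltW eta0)// subr_ge0 -Zt.
    by rewrite expf_neq0// subr_eq0 gt_eqF.
  by move: v1 u1 m0; lra.
apply: (no_max htau eta0 (X := Z)).
- have mx (t : R) : 0 <= Num.max t 0 by rewrite le_max lexx orbT.
  by move=> X; rewrite /g' lerDl; apply: mulr_ge0; [exact: ltW|exact: mulr_ge0].
- by split; rewrite /= ?in_itv /= ?Zh ?(lt_trans Zt).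
have oO : open (eball x0 r `*` `]t0 - h, t'[) by apply: open_setX; [exact: eball_open|exact: interval_open].
have OZ : (eball x0 r `*` `]t0 - h, t'[) Z by split; rewrite /= ?in_itv /= ?Zh.
move: oO; rewrite openE => /(_ Z OZ); apply: filterS => Y [Y1 Y2]; apply: Zmax.
move: Y2; rewrite /= in_itv /= => /andP[Y2 Y3].
by split; rewrite /= ?in_itv /= ?(ltW Y1) ?(ltW Y2) ?(ltW Y3).
Qed.

End maximum_principle.
End parabolic_cylinder.

Theorem theorem4p1 (R : realType) (n : nat)
    (Om1 Om2 H : set 'rV[R]_n.+1) (n1 n2 : 'rV[R]_n.+1 -> 'rV[R]_n.+1)
    (T : R) (A1 A2 : metricType R)
    (b1 : 'rV[R]_n.+1 -> R -> A1 -> 'rV[R]_n.+1)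
    (b2 : 'rV[R]_n.+1 -> R -> A2 -> 'rV[R]_n.+1)
    (l1 : 'rV[R]_n.+1 -> R -> A1 -> R) (l2 : 'rV[R]_n.+1 -> R -> A2 -> R)
    (Mb Lb Ml delta : R) (ml : R -> R)
    (x0 : 'rV[R]_n.+1) (t0 h r : R) (u v : 'rV[R]_n.+1 * R -> R) :
  geometry Om1 Om2 H ->
  (forall z, H z -> outward_unit_normal H Om1 z (n1 z)) ->
  (forall z, H z -> outward_unit_normal H Om2 z (n2 z)) ->
  0 < T ->
  control_C1 Om1 T b1 Mb Lb -> control_C1 Om2 T b2 Mb Lb ->
  control_C2 Om1 T l1 Ml ml -> control_C2 Om2 T l2 Ml ml ->
  control_C3 Om1 T b1 l1 -> control_C3 Om2 T b2 l2 ->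
  0 < delta ->
  control_C4 H T b1 n1 delta -> control_C4 H T b2 n2 delta ->
  H x0 -> 0 < t0 - h -> t0 - h < t0 -> t0 < T -> 0 < r ->
  (exists2 Psi : 'rV[R]_n.+1 -> 'rV[R]_n.+1,
     W2oo_diffeo (eball x0 r) Psi
   & Psi @` (H `&` eball x0 r)
       = [set y : 'rV[R]_n.+1 | y 0 ord_max = 0] `&` Psi @` eball x0 r) ->
  let H1 := hamiltonian b1 l1 in
  let H2 := hamiltonian b2 l2 in
  let HT := tangential_hamiltonian b1 b2 l1 l2 n1 in
  let Q := Qcyl x0 r t0 h in
  subsolution_Hminus Om1 Om2 H T H1 H2 HT Q u ->
  supersolution_Hminus Om1 Om2 H T H1 H2 Q v ->
  (sup_norm Q (fun p => Num.max (u p - v p) 0)%R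
   <= sup_norm (parabolic_bdry x0 r t0 h)
        (fun p => Num.max (u p - v p) 0)%R)%E.
Proof.
move=> hg hn1 hn2 T0 hb1 hb2 hl1 hl2 hc1 hc2 delta0 hd1 hd2 Hx0 th0 tht tT r0
  [Psi hPsi flat] H1 H2 HT Q hu hv.
have h0 : 0 < h by lra.
have QT X : Q X -> X.2 \in `]0, T[.
  by move=> [_]; rewrite /= !in_itv /= => /andP[t1 t2]; apply/andP; split; lra.
have delta_itv : (0 : R) \in `[- delta, delta].
  by rewrite in_itv /= oppr_le0 (ltW delta0).
(* (C4) at [x0] provides controls, so the suprema defining the Hamiltonians run over nonempty
   sets. *)
have A10 : [set: A1] !=set0.
  by have [|al _ _] := hd1 x0 0 Hx0 _ 0 delta_itv; [rewrite in_itv /= lexx ltW|exists al].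
have A20 : [set: A2] !=set0.
  by have [|al _ _] := hd2 x0 0 Hx0 _ 0 delta_itv; [rewrite in_itv /= lexx ltW|exists al].
have no_max tau tau' eta X : C1_gradient tau (fun=> 0) tau' -> 0 < eta ->
    (forall X, eta <= tau' X) -> Q X ->
    (\forall Y \near X, u Y - tau Y - v Y <= u X - tau X - v X) -> False.
  move=> htau eta0 tau'_eta QX; have oQ : open Q by exact: Qcyl_open.
  have [inO1|inO2|inH] := geometry_cover hg X.1.
  - exact: (no_max_away_from_interface htau hb1 hl1 A10 (geo_open1 hg) oQ QT
      (sub_Om1 hu) (super_Om1 hv) (sub_usc hu) (super_lsc hv) eta0 tau'_eta QX inO1).
  - exact: (no_max_away_from_interface htau hb2 hl2 A20 (geo_open2 hg) oQ QT
      (sub_Om2 hu) (super_Om2 hv) (sub_usc hu) (super_lsc hv) eta0 tau'_eta QX inO2).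
  - exact: (interface_no_max hg hPsi flat hn1 hn2 hb1 hb2 hl1 hl2 hc1 hc2 delta0 hd1 hd2
      A10 A20 htau oQ QT hu hv eta0 tau'_eta QX inH QX.1).
have max_ge0 p : 0 <= Num.max (u p - v p) 0 by rewrite le_max lexx orbT.
have Pge p : parabolic_bdry x0 r t0 h p -> ((Num.max (u p - v p) 0)%R%:E
    <= sup_norm (parabolic_bdry x0 r t0 h) (fun p => Num.max (u p - v p) 0)%R)%E.
  by move=> Pp; apply: ereal_sup_ubound; exists p => //; rewrite ger0_norm.
apply: ge_ereal_sup => _ [p Qp <-]; rewrite ger0_norm//.
have Px0 : parabolic_bdry x0 r t0 h (x0, t0 - h).
  by left; split => //; rewrite /eball /= subrr enorm0.
(* The case [+oo] is trivial, and [-oo] is excluded by the nonnegative value at [(x0, t0 - h)],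
   which also gives [0 <= m]. *)
have := Pge _ Px0; case: (sup_norm _ _) Pge => [m| |] Pge m0; last 2 first.
- exact: leey.
- by have := le_lt_trans m0 (ltNyr 0); rewrite ltNge lee_fin max_ge0.
have {}m0 : 0 <= m by move: m0; rewrite lee_fin; exact: le_trans.
rewrite lee_fin ge_max m0 andbT.
apply: (penalized_maximum_principle r0 h0 (sub_bounded hu) (super_bounded hv)
  (sub_usc hu) (super_lsc hv) no_max m0 _ Qp) => X /Pge.
by rewrite lee_fin ge_max => /andP[].
Qed.
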